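(* Let $\mathcal{H}$ be a complex Hilbert space, let $d\geq 1$, and let $\mathbf{T}=(T_1,\ldots,T_d)\in\mathcal{B}(\mathcal{H})^d$ be a commuting $d$-tuple of operators, i.e. $T_jT_k=T_kT_j$ for all $1\le j,k\le d$. Define the iterated spherical Aluthge transforms by $\widehat{\mathbf{T}}_0:=\mathbf{T}$ and, for $n\geq1$, let $\widehat{\mathbf{T}}_n$ be the spherical Aluthge transform of $\widehat{\mathbf{T}}_{n-1}$. Then $$\lim_{n\to\infty}\|\widehat{\mathbf{T}}_n\|=r(\mathbf{T}),$$ where $\|\cdot\|$ is the joint operator norm and $r(\mathbf{T})$ is the joint spectral radius of $\mathbf{T}$.
   Context: $\mathcal{B}(\mathcal{H})$ is the algebra of bounded linear operators on the complex Hilbert space $\mathcal{H}$. Joint operator norm: for $\mathbf{T}=(T_1,\ldots,T_d)\in\mathcal{B}(\mathcal{H})^d$, $\|\mathbf{T}\|:=\sup\{(\sum_{k=1}^d\|T_kx\|^2)^{1/2}: x\in\mathcal{H},\ \|x\|=1\}$. Polar decomposition of a tuple: regard $\mathbf{T}$ as the operator $S:\mathcal{H}\to\bigoplus_{i=1}^d\mathcal{H}$, $Sx=(T_1x,\ldots,T_dx)$. Let $S=VP$ be its (canonical) polar decomposition, so $P=(S^*S)^{1/2}=\sqrt{T_1^*T_1+\cdots+T_d^*T_d}$ is a positive operator on $\mathcal{H}$ and $V:\mathcal{H}\to\bigoplus_{i=1}^d\mathcal{H}$, $Vx=(V_1x,\ldots,V_dx)$, is the partial isometry with $\mathcal{N}(V)=\bigcap_{i}\mathcal{N}(V_i)=\mathcal{N}(P)=\bigcap_i\mathcal{N}(T_i)$.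 Thus $T_k=V_kP$ for $1\le k\le d$. Spherical Aluthge transform: $\widehat{\mathbf{T}}=(\widehat{T_1},\ldots,\widehat{T_d}):=(\sqrt{P}V_1\sqrt{P},\ldots,\sqrt{P}V_d\sqrt{P})$. Joint spectral radius of a commuting $d$-tuple: $r(\mathbf{T}):=\sup\{\|\lambda\|_2:\lambda=(\lambda_1,\ldots,\lambda_d)\in\sigma_T(\mathbf{T})\}$, where $\|\lambda\|_2=(\sum_k|\lambda_k|^2)^{1/2}$ and $\sigma_T(\mathbf{T})\subset\mathbb{C}^d$ is the Taylor joint spectrum (the set of $\lambda$ for which the Koszul complex of $(T_1-\lambda_1I,\ldots,T_d-\lambda_dI)$ on $\mathcal{H}$ is not exact). It is a known result of Müller and Soltysiak that for commuting $\mathbf{T}$ one has $r(\mathbf{T})=\lim_{n\to\infty}\|\mathbf{T}^n\|^{1/n}$, where $\mathbf{T}^n$ is the $d^n$-tuple of all products $T_{i_1}T_{i_2}\cdots T_{i_n}$, $1\le i_1,\ldots,i_n\le d$. *)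

(* Defs.v *)
From HB Require Import structures.
From mathcomp Require Import all_boot all_order all_algebra.
From mathcomp Require Import complex.
From mathcomp Require Import all_classical all_reals all_analysis.

Set Implicit Arguments.
Unset Strict Implicit.
Unset Printing Implicit Defensive.

Import Order.TTheory GRing.Theory Num.Theory.
Import numFieldNormedType.Exports.

Local Open Scope classical_set_scope.
Local Open Scope complex_scope.
Local Open Scope ring_scope.

(* Norms of normed R[i]-modules are R[i]-valued (real and nonnegative);
   their real parts are taken in order to get numbers in R. *)
Definition l2norm (R : realType) (d : nat) (V : normedZmodType R[i])
    (u : 'I_d -> V) : R :=
  Num.sqrt (\sum_(k < d) complex.Re `|u k| ^+ 2).

Section HilbertSpaceOperators.
Context (R : realType) (H : completeNormedModType R[i]).

(* {dot H for Num.conj}: positive definite Hermitian forms, linear in the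
   first argument and antilinear in the second one. *)
Definition hilbert_dot (dot : {dot H for Num.conj}) : Prop :=
  forall x : H, `|x| ^+ 2 = dot x x.

Definition bounded_tuple (d : nat) (T : 'I_d -> {linear H -> H}) : Prop :=
  forall k, continuous (T k).

Definition commuting_tuple (d : nat) (T : 'I_d -> {linear H -> H}) : Prop :=
  forall j k x, T j (T k x) = T k (T j x).

Definition joint_norm (d : nat) (T : 'I_d -> {linear H -> H}) : R :=
  sup [set l2norm (fun k => T k x) | x in [set x : H | `|x| = 1]].

Section SphericalAluthge.
Variable dot : {dot H for Num.conj}.

Definition is_adjoint (A B : {linear H -> H}) : Prop :=
  continuous B /\ forall x y, dot (A x) y = dot x (B y).

Definition adjoint (A : {linear H -> H}) : {linear H -> H} :=
  get (is_adjoint A).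

Definition is_sqrt_op (A : H -> H) (B : {linear H -> H}) : Prop :=
  [/\ continuous B, forall x, 0 <= dot (B x) x & forall x, B (B x) = A x].

Definition sqrt_op (A : H -> H) : {linear H -> H} := get (is_sqrt_op A).

Definition polar_modulus (d : nat) (T : 'I_d -> {linear H -> H}) :
    {linear H -> H} :=
  sqrt_op (fun x => \sum_(k < d) adjoint (T k) (T k x)).

Definition joint_kernel (d : nat) (V : 'I_d -> {linear H -> H}) : set H :=
  [set x | forall k, V k x = 0].

(* x |-> (V_1 x, ..., V_d x) is isometric on the orthogonal complement of its
   kernel; l2norm is the Hilbert norm of the direct sum of d copies of H. *)
Definition partial_isometry (d : nat) (V : 'I_d -> {linear H -> H}) : Prop :=
  forall x, (forall y, joint_kernel V y -> dot x y = 0) ->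
    l2norm (fun k => V k x) = complex.Re `|x|.

Definition is_polar_part (d : nat) (T V : 'I_d -> {linear H -> H}) : Prop :=
  [/\ bounded_tuple V,
      partial_isometry V,
      joint_kernel V = [set x | polar_modulus T x = 0] &
      forall k x, T k x = V k (polar_modulus T x)].

Definition polar_part (d : nat) (T : 'I_d -> {linear H -> H}) :
    'I_d -> {linear H -> H} :=
  get (is_polar_part T).

Definition spherical_aluthge (d : nat) (T : 'I_d -> {linear H -> H}) :
    'I_d -> {linear H -> H} :=
  let sqrtP := sqrt_op (polar_modulus T) in
  fun k => sqrtP \o polar_part T k \o sqrtP.

End SphericalAluthge.

(* The p-th term of the Koszul complex of A, i.e. the tensor product of H with
   the p-th exterior power of C^d, is the space of families (f_S) of vectors of
   H indexed by the p-element subsets S = {i_1 < ... < i_p} of 'I_d, f_S being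
   the coefficient of e_{i_1} /\ ... /\ e_{i_p}; such a family is extended
   by 0 to all subsets. *)
Definition koszul_chain (d p : nat) (f : {set 'I_d} -> H) : Prop :=
  forall S : {set 'I_d}, #|S| != p -> f S = 0.

(* f |-> \sum_j (A_j f) e_j /\ _, where e_j /\ e_(S :\ j) equals e_S up to the
   sign given by the number of elements of S smaller than j. *)
Definition koszul_diff (d : nat) (A : 'I_d -> H -> H) (f : {set 'I_d} -> H) :
    {set 'I_d} -> H :=
  fun S => \sum_(j in S)
    (-1) ^+ #|[set i in S | (i < j)%N]| *: A j (f (S :\ j)%SET).

(* The (p-1)-chains are described by #|S|.+1 = p, so that they are all zero
   when p = 0. *)
Definition koszul_exact (d : nat) (A : 'I_d -> H -> H) : Prop :=
  forall (p : nat) (f : {set 'I_d} -> H), koszul_chain p f ->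
    (koszul_diff A f = (fun=> 0)) <->
    (exists g : {set 'I_d} -> H,
      (forall S : {set 'I_d}, #|S|.+1 != p -> g S = 0) /\ koszul_diff A g = f).

Definition taylor_spectrum (d : nat) (T : 'I_d -> {linear H -> H}) :
    set ('I_d -> R[i]) :=
  [set lam | ~ koszul_exact (fun k x => T k x - lam k *: x)].

Definition joint_spectral_radius (d : nat) (T : 'I_d -> {linear H -> H}) : R :=
  sup [set l2norm lam | lam in taylor_spectrum T].

End HilbertSpaceOperators.

Arguments spherical_aluthge {R H} dot {d} T _.

(* Main.v *)
Require Import Defs.
From HB Require Import structures.
From mathcomp Require Import all_boot all_order all_algebra.
From mathcomp Require Import complex polyrcf.
From mathcomp Require Import all_classical all_reals all_analysis.
From mathcomp Require Import ring lra.

(**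
Write [Q_n(T)(x)] for the sum of [`|T_w x|^2] over the words [w] of length [n].
Both the joint norm and the joint spectral radius are governed by the growth of
[Q_n(T)], and [t > 0] is called admissible if [Q_n(T)(x) <= K t^(2n) `|x|^2] for
some [K] and all [n] and [x].

Aluthge transforms. If [Q_n(T) <= a_n `|.|^2] for all [n], then a Heinz inequality
for [sqrt P] gives [Q_(m+1)(That) <= sqrt (a_m a_(m+2)) `|.|^2]. Hence the logarithms
of the bounds for the iterated transforms follow the heat equation of the random
walk on the exponents absorbed at [0]. If [t] is admissible, then the logarithm of
the constant in front of [t^(2m)] at time [n] is at most [log K] times the
probability of survival up to [n], which tends to [0]; so the upper limit of the
joint norms is at most [t]. Conversely [Q_(n+1)(T)] is controlled by [Q_n(That)], so
every number above the joint norm of some iterate is admissible for [T].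

Spectral radius (Mueller and Soltysiak). If [t] is admissible and [`|lam| > t], then
[sum_k conj(lam_k) (T_k - lam_k)] is invertible by a Neumann series, and a homotopy
shows that the Koszul complex of [T - lam] is exact. Let [rho > 0] be the infimum of
the admissible numbers. Then [sum_n t^(-2n) Q_n(T)(y)] is not bounded by a multiple
of [`|y|^2] for [t] close to [rho]. By an average over unit vectors [c], the same
holds, with binomial weights, for the powers of some [S_c = sum_k c_k T_k], and
Parseval's identity then yields approximate eigenvectors of [S_c] for some [z] with
[`|z|] close to [rho]; by compactness [c] can be fixed and [`|z| = rho]. As [Q_n(T)]
grows at most like [rho^(2n)], the powers of the components of [T] orthogonal to
[S_c] are small on these vectors, and modifying the vectors makes the components
themselves small: this gives joint approximate eigenvectors of [T] for
[lam = z conj(c)]. Finally the Koszul complex of [T - lam] cannot be exact, since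
otherwise a gliding hump produces a vector of infinite norm.
*)

Set Implicit Arguments.
Unset Strict Implicit.
Unset Printing Implicit Defensive.

Import Order.TTheory GRing.Theory Num.Theory.
Import numFieldNormedType.Exports.

Local Open Scope classical_set_scope.
Local Open Scope complex_scope.
Local Open Scope ring_scope.

(** * Norms and inner products *)

Definition nrm (R : realType) (V : normedZmodType R[i]) (x : V) : R :=
  complex.Re `|x|.

Section RealNorm.
Context (R : realType) (V : normedModType R[i]).
Implicit Types (x y : V) (a : R[i]).

Lemma nrmE (W : normedZmodType R[i]) (x : W) : `|x| = (nrm x)%:C.
Proof. by rewrite /nrm RRe_real// normr_real. Qed.

Lemma nrm_ge0 (W : normedZmodType R[i]) (x : W) : 0 <= nrm x.
Proof. by rewrite -lecR -nrmE normr_ge0. Qed.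

Lemma nrm0 (W : normedZmodType R[i]) : nrm (0 : W) = 0.
Proof. by rewrite /nrm normr0. Qed.

Lemma nrm0_eq0 (W : normedZmodType R[i]) (x : W) : nrm x = 0 -> x = 0.
Proof. by move=> h; apply/eqP; rewrite -normr_eq0 nrmE h. Qed.

Lemma nrm_gt0 (W : normedZmodType R[i]) (x : W) : (0 < nrm x) = (x != 0).
Proof.
rewrite lt_def nrm_ge0 andbT; congr (~~ _).
by apply/eqP/eqP => [/nrm0_eq0|->]; rewrite ?nrm0.
Qed.

Lemma nrmN (W : normedZmodType R[i]) (x : W) : nrm (- x) = nrm x.
Proof. by rewrite /nrm normrN. Qed.

Lemma nrmD (W : normedZmodType R[i]) (x y : W) : nrm (x + y) <= nrm x + nrm y.
Proof. by rewrite -lecR rmorphD /= -!nrmE ler_normD. Qed.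

Lemma nrmB (W : normedZmodType R[i]) (x y : W) : nrm (x - y) <= nrm x + nrm y.
Proof. by rewrite (le_trans (nrmD _ _)) ?nrmN. Qed.

Lemma nrmBC (W : normedZmodType R[i]) (x y : W) : nrm (x - y) = nrm (y - x).
Proof. by rewrite -nrmN opprB. Qed.

Lemma nrm_sub (W : normedZmodType R[i]) (x y z : W) :
  nrm (x - z) <= nrm (x - y) + nrm (y - z).
Proof. by rewrite (le_trans _ (nrmD _ _)) // addrA subrK. Qed.

Lemma nrm_le_add (W : normedZmodType R[i]) (x y : W) :
  nrm x <= nrm y + nrm (x - y).
Proof. by rewrite (le_trans _ (nrmD _ _)) // addrC subrK. Qed.

Lemma nrm_sum (W : normedZmodType R[i]) I (s : seq I) (P : pred I) (F : I -> W) :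
  nrm (\sum_(i <- s | P i) F i) <= \sum_(i <- s | P i) nrm (F i).
Proof.
elim/big_rec2 : _ => [|i a b _ h]; first by rewrite nrm0.
by rewrite (le_trans (nrmD _ _)) // lerD2l.
Qed.

Lemma nrmZ a x : nrm (a *: x) = nrm a * nrm x.
Proof. by apply: complexI; rewrite rmorphM /= -!nrmE normrZ. Qed.

Lemma nrmM (a b : R[i]) : nrm (a * b) = nrm a * nrm b.
Proof. by apply: complexI; rewrite rmorphM /= -!nrmE normrM. Qed.

Lemma nrm1 : nrm (1 : R[i]) = 1.
Proof. by rewrite /nrm normr1. Qed.

Lemma nrmX (a : R[i]) n : nrm (a ^+ n) = nrm a ^+ n.
Proof. by elim: n => [|n IHn]; rewrite ?expr0 ?nrm1 // !exprS nrmM IHn. Qed.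

Lemma nrmV (a : R[i]) : nrm a^-1 = (nrm a)^-1.
Proof. by apply: complexI; rewrite fmorphV -!nrmE normfV. Qed.

Lemma nrmr (r : R) : nrm (r%:C) = `|r|.
Proof.
rewrite /nrm normc_def /= expr0n addr0 sqrtr_sqr //.
Qed.

Lemma nrm_nat n : nrm (n%:R : R[i]) = n%:R.
Proof. by rewrite /nrm normr_nat -(rmorph_nat (real_complex R)). Qed.

Lemma nrm_conj a : nrm a^* = nrm a.
Proof. by rewrite /nrm normcJ. Qed.

Lemma Re_le_nrm a : complex.Re a <= nrm a.
Proof.
by rewrite (le_trans (ler_norm _)) // -lecR -nrmE normc_ge_Re.
Qed.

Lemma mulJ_nrm a : a * a^* = (nrm a ^+ 2)%:C.
Proof. by rewrite rmorphXn /= -nrmE sqr_normc. Qed.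

End RealNorm.

Lemma conjE (R : realType) (a : R[i]) : Num.conj a = conjc a.
Proof. by []. Qed.

Definition bounded_op (R : realType) (V : normedZmodType R[i]) (f : V -> V) :=
  exists2 C : R, 0 < C & forall x, nrm (f x) <= C * nrm x.

Section Hilbert.
Context (R : realType) (H : completeNormedModType R[i]).
Context (dot : {dot H for Num.conj}) (hdot : hilbert_dot dot).
Implicit Types (x y z : H) (a : R[i]).

Lemma dotDl x y z : dot (x + y) z = dot x z + dot y z.
Proof. exact: linearDl. Qed.
Lemma dotDr x y z : dot z (x + y) = dot z x + dot z y.
Proof. exact: linearDr. Qed.
Lemma dotZl a x y : dot (a *: x) y = a * dot x y.
Proof. exact: linearZl_LR. Qed.
Lemma dotZr a x y : dot x (a *: y) = a^* * dot x y.
Proof. exact: linearZr_LR. Qed.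
Lemma dotNl x y : dot (- x) y = - dot x y.
Proof. exact: linearNl. Qed.
Lemma dotNr x y : dot x (- y) = - dot x y.
Proof. exact: linearNr. Qed.
Lemma dotBl x y z : dot (x - y) z = dot x z - dot y z.
Proof. exact: linearBl. Qed.
Lemma dotBr x y z : dot z (x - y) = dot z x - dot z y.
Proof. exact: linearBr. Qed.
Lemma dot0l x : dot 0 x = 0. Proof. exact: linear0l. Qed.
Lemma dot0r x : dot x 0 = 0. Proof. exact: linear0r. Qed.
Lemma dotC x y : dot x y = (dot y x)^*.
Proof. by rewrite hermC /= expr0 mul1r. Qed.

Lemma dot_suml I (s : seq I) (P : pred I) (F : I -> H) y :
  dot (\sum_(i <- s | P i) F i) y = \sum_(i <- s | P i) dot (F i) y.
Proof. exact: linear_sumlz. Qed.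
Lemma dot_sumr I (s : seq I) (P : pred I) (F : I -> H) y :
  dot y (\sum_(i <- s | P i) F i) = \sum_(i <- s | P i) dot y (F i).
Proof. exact: linear_sumr. Qed.

Lemma dotxx x : dot x x = (nrm x ^+ 2)%:C.
Proof. by rewrite -hdot nrmE rmorphXn. Qed.

Lemma Re_dotxx x : complex.Re (dot x x) = nrm x ^+ 2.
Proof. by rewrite dotxx. Qed.

Lemma cauchy_schwarz x y : nrm (dot x y) <= nrm x * nrm y.
Proof.
have [->|y0] := eqVneq y 0; first by rewrite dot0r !nrm0 mulr0.
have ny : 0 < nrm y by rewrite nrm_gt0.
rewrite -(ler_pXn2r (n := 2)) ?nnegrE ?mulr_ge0 ?nrm_ge0 //.
pose c := (nrm y ^+ 2)%:C; pose a := dot x y.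
have c0 : c = dot y y by rewrite dotxx.
have ca : c^* = c by rewrite conjE conjc_real.
pose z := c *: x - a *: y.
have zE : dot z z = c * (c * dot x x - a * a^*).
  rewrite /z dotBl !dotBr !dotZl !dotZr ca (dotC y x) -/a -c0; ring.
have : 0 <= dot z z by rewrite dotxx ler0c sqr_ge0.
have eE : c * (c * dot x x - a * a^*) =
   (nrm y ^+ 2 * (nrm y ^+ 2 * nrm x ^+ 2 - nrm a ^+ 2))%:C.
  by rewrite mulJ_nrm dotxx /c !(rmorphM, rmorphB).
rewrite zE eE ler0c pmulr_rge0 ?exprn_gt0 // subr_ge0 => h.
by rewrite (le_trans h) // exprMn mulrC.
Qed.

Lemma Re_dot_le x y : complex.Re (dot x y) <= nrm x * nrm y.
Proof. exact: le_trans (Re_le_nrm _) (cauchy_schwarz _ _). Qed.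

Lemma ReC a : complex.Re a^* = complex.Re a.
Proof. by case: a. Qed.

Lemma nrm_addsq x y :
  nrm (x + y) ^+ 2 = nrm x ^+ 2 + nrm y ^+ 2 + 2 * complex.Re (dot x y).
Proof.
rewrite -!Re_dotxx dotDl !dotDr !raddfD /= (dotC y x) ReC; ring.
Qed.

Lemma nrm_subsq x y :
  nrm (x - y) ^+ 2 = nrm x ^+ 2 + nrm y ^+ 2 - 2 * complex.Re (dot x y).
Proof. by rewrite nrm_addsq nrmN dotNr raddfN /= mulrN. Qed.

Lemma parallelogram x y :
  nrm (x + y) ^+ 2 + nrm (x - y) ^+ 2 = 2 * nrm x ^+ 2 + 2 * nrm y ^+ 2.
Proof. rewrite nrm_addsq nrm_subsq; ring. Qed.

Lemma dot_eq0P x : (forall y, dot x y = 0) -> x = 0.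
Proof.
move=> h; apply: nrm0_eq0; apply/eqP; rewrite -sqrf_eq0; apply/eqP.
by apply: complexI; rewrite -dotxx h.
Qed.

Lemma dot_inj x y : (forall z, dot z x = dot z y) -> x = y.
Proof.
move=> h; apply/eqP; rewrite -subr_eq0; apply/eqP/dot_eq0P => z.
by rewrite dotC dotBr h subrr conjE conjc0.
Qed.

Lemma nrm_complete (u : nat -> H) :
  (forall e : R, 0 < e ->
     exists N, forall m n, (N <= m)%N -> (N <= n)%N -> nrm (u m - u n) <= e) ->
  exists l, forall e : R, 0 < e ->
     exists N, forall n, (N <= n)%N -> nrm (u n - l) <= e.
Proof.
move=> hu.
have cu : cvg (u @ \oo).
  apply/cauchy_cvgP/cauchy_ballP => e e0.
  have e0' : 0 < complex.Re e by move: e0; rewrite ltcE => /andP[].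
  have eE : e = (complex.Re e)%:C by rewrite RRe_real// gtr0_real.
  have [N hN] := hu (complex.Re e / 2) ltac:(lra).
  exists (u @` [set n | (N <= n)%N], u @` [set n | (N <= n)%N]).
    by split; exists N => // n hn; exists n.
  move=> [_ _] [/= [m hm <-] [n hn <-]]; rewrite -ball_normE /ball_/=.
  rewrite nrmE eE ltcR (le_lt_trans (hN _ _ hm hn)) //.
  by rewrite ltr_pdivrMr // ltr_pMr // ltr1n.
exists (lim (u @ \oo)) => e e0.
have : 0 < e%:C :> R[i] by rewrite ltcR.
move/cvgrPdist_le: cu => /[apply] -[N _ hN].
by exists N => n /hN /=; rewrite distrC nrmE lecR.
Qed.

End Hilbert.

Section Bounded.
Context (R : realType) (H : completeNormedModType R[i]).

Lemma bounded_opP (f : {linear H -> H}) : continuous f <-> bounded_op f.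
Proof.
rewrite -linear_bounded_continuous linear_boundedP; split.
  move=> /pinfty_ex_gt0[M M0 hM].
  have M0' : 0 < complex.Re M by move: M0; rewrite ltcE => /andP[].
  exists (complex.Re M) => // x; have := hM x.
  have {1}-> : M = (complex.Re M)%:C by rewrite RRe_real// gtr0_real.
  by rewrite !nrmE -rmorphM lecR.
move=> [C C0 hC]; exists C%:C; split; first by rewrite gtr0_real ?ltcR.
move=> r hr x; rewrite (le_trans _ (ler_wpM2r (normr_ge0 _) (ltW hr))) //.
by rewrite !nrmE -rmorphM lecR.
Qed.

Definition linear_of (f : H -> H) (hf : linear f) : {linear H -> H} :=
  HB.pack f (GRing.isLinear.Build _ _ _ _ f hf).

End Bounded.

Lemma small_invS (R : realType) (e : R) : 0 < e ->
  exists N, forall n, (N <= n)%N -> n.+1%:R^-1 <= e.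
Proof.
move=> e0; exists (Num.truncn e^-1) => n hn.
rewrite -[leRHS]invrK lef_pV2 ?posrE ?invr_gt0 ?ltr0n //.
rewrite ltW // (lt_le_trans (truncnS_gt _)) // ler_nat ltnS //.
Qed.

Lemma le_of_le_add (R : realType) (a b : R) :
  (forall e, 0 < e -> a <= b + e) -> a <= b.
Proof.
move=> h; rewrite leNgt; apply/negP => ab.
have := h ((a - b) / 2) ltac:(lra); lra.
Qed.

(** Norms take values in [R[i]]; this form with real epsilons is what [nrm_complete] delivers. *)
Definition tends (R : realType) (V : normedZmodType R[i]) (u : nat -> V) (l : V) :=
  forall e : R, 0 < e -> exists N, forall n, (N <= n)%N -> nrm (u n - l) <= e.

Section Tends.
Context (R : realType) (V : normedModType R[i]).
Implicit Types (u v : nat -> V) (l m : V).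

Lemma tends_const (W : normedZmodType R[i]) (l : W) : tends (fun=> l) l.
Proof. by move=> e /ltW e0; exists 0%N => n _; rewrite subrr nrm0. Qed.

Lemma tends_le (W W' : normedZmodType R[i]) (u : nat -> W') (w : nat -> W)
    (l : W') (m : W) (C : R) :
  0 < C -> tends w m ->
  (forall n, nrm (u n - l) <= C * nrm (w n - m)) -> tends u l.
Proof.
move=> C0 hw h e e0; have [N hN] := hw (e / C) (divr_gt0 e0 C0).
exists N => n /hN hn; rewrite (le_trans (h n)) // mulrC -ler_pdivlMr //.
Qed.

Lemma tendsD (W : normedZmodType R[i]) (u v : nat -> W) (l m : W) :
  tends u l -> tends v m -> tends (fun n => u n + v n) (l + m).
Proof.
move=> hu hv e e0; have e2 : 0 < e / 2 by lra.
have [N hN] := hu _ e2; have [M hM] := hv _ e2.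
exists (maxn N M) => n; rewrite geq_max => /andP[/hN h1 /hM h2].
rewrite opprD addrACA (le_trans (nrmD _ _)) //; lra.
Qed.

Lemma tendsZ u l (a : R[i]) : tends u l -> tends (fun n => a *: u n) (a *: l).
Proof.
move=> hu; apply: (@tends_le _ _ _ u _ l (nrm a + 1)) => //.
  by rewrite ltr_wpDl // nrm_ge0.
by move=> n; rewrite -scalerBr nrmZ ler_wpM2r ?nrm_ge0 // lerDl.
Qed.

Lemma tends_unique (W : normedZmodType R[i]) (u : nat -> W) (l m : W) :
  tends u l -> tends u m -> l = m.
Proof.
move=> hl hm; apply/eqP; rewrite -subr_eq0; apply/eqP/nrm0_eq0/eqP.
rewrite eq_le nrm_ge0 andbT; apply: le_of_le_add => e e0.
have e2 : 0 < e / 2 by lra.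
have [N hN] := hl _ e2; have [M hM] := hm _ e2.
have h1 := hN (maxn N M) (leq_maxl _ _); have h2 := hM (maxn N M) (leq_maxr _ _).
rewrite (le_trans (nrm_sub _ (u (maxn N M)) _)) // (nrmBC l); lra.
Qed.

Lemma tends_nrm_le u l (C : R) : tends u l ->
  (exists N, forall n, (N <= n)%N -> nrm (u n) <= C) -> nrm l <= C.
Proof.
move=> hu [N hC]; apply: le_of_le_add => e /hu [M hM].
have h1 := hM (maxn N M) (leq_maxr _ _); have h2 := hC (maxn N M) (leq_maxl _ _).
by rewrite (le_trans (nrm_le_add _ (u (maxn N M)))) // nrmBC; lra.
Qed.

Lemma tends_eq (W : normedZmodType R[i]) (u v : nat -> W) (l : W) :
  u =1 v -> tends u l -> tends v l.
Proof. by move=> /funext->. Qed.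

Lemma tends_sum (W : normedZmodType R[i]) I (s : seq I)
    (u : I -> nat -> W) (l : I -> W) :
  (forall i, tends (u i) (l i)) ->
  tends (fun n => \sum_(i <- s) u i n) (\sum_(i <- s) l i).
Proof.
move=> h; elim: s => [|i s IHs].
  rewrite big_nil; apply: (tends_eq (u := fun=> 0)); last exact: tends_const.
  by move=> n; rewrite big_nil.
rewrite big_cons; apply: (tends_eq (u := fun n => u i n + \sum_(j <- s) u j n)).
  by move=> n; rewrite big_cons.
exact: tendsD.
Qed.

Lemma tends_shift u l : tends u l -> tends (fun n => u n.+1) l.
Proof. by move=> h e /h[N hN]; exists N => n hn; apply: hN; rewrite leqW. Qed.

End Tends.

Lemma tends_bounded_op (R : realType) (H : normedModType R[i])
    (f : {linear H -> H}) (u : nat -> H) l :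
  bounded_op f -> tends u l -> tends (fun n => f (u n)) (f l).
Proof.
move=> [C C0 hC] hu; apply: (@tends_le _ _ _ _ u _ l C) => // n.
by rewrite -linearB.
Qed.

(** * Adjoints and square roots of operators *)

Section Operators.
Context (R : realType) (H : completeNormedModType R[i]).
Context (dot : {dot H for Num.conj}) (hdot : hilbert_dot dot).
Implicit Types (x y z : H) (a : R[i]).

Lemma tends_dotl (u : nat -> H) l y :
  tends u l -> tends (fun n => dot (u n) y) (dot l y).
Proof.
move=> hu; apply: (@tends_le _ _ _ _ u _ l (nrm y + 1)) => //.
  by rewrite ltr_wpDl // nrm_ge0.
move=> n; rewrite -dotBl (le_trans (cauchy_schwarz hdot _ _)) // mulrC.
by rewrite ler_wpM2r ?nrm_ge0 // lerDl.
Qed.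

Lemma tends_dotr (u : nat -> H) l y :
  tends u l -> tends (fun n => dot y (u n)) (dot y l).
Proof.
move=> hu; apply: (@tends_le _ _ _ _ u _ l (nrm y + 1)) => //.
  by rewrite ltr_wpDl // nrm_ge0.
move=> n; rewrite -dotBr (le_trans (cauchy_schwarz hdot _ _)) //.
by rewrite ler_wpM2r ?nrm_ge0 // lerDl.
Qed.

Definition in_closure (M : set H) p :=
  forall e : R, 0 < e -> exists2 m, M m & nrm (p - m) <= e.

(** Since [M] need not be closed, [p] is only a limit of points of [M]. A sequence in [M] minimizing
    the distance to [x] is Cauchy by the parallelogram law, and orthogonality follows by comparing
    [p] with [p + a *: y]. *)
Lemma orthogonal_projection (M : set H) x : M 0 ->
  (forall a y z, M y -> M z -> M (a *: y + z)) ->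
  exists p, in_closure M p /\ forall m, M m -> dot (x - p) m = 0.
Proof.
move=> M0 Ml.
pose A := [set r : R | exists2 m, M m & r = nrm (x - m)].
have hA : has_inf A.
  split; first by exists (nrm (x - 0)); exists 0.
  by exists 0 => _ [m _ ->]; apply: nrm_ge0.
pose d := inf A.
have d_le m : M m -> d <= nrm (x - m).
  by move=> Mm; apply: ge_inf; [case: hA | exists m].
have d0 : 0 <= d by apply: lb_le_inf; [case: hA | move=> _ [m _ ->]; apply: nrm_ge0].
have ex n : exists m, M m /\ nrm (x - m) <= d + n.+1%:R^-1.
  have n0 : 0 < n.+1%:R^-1 :> R by rewrite invr_gt0.
  have [_ [m Mm ->] h] := inf_adherent n0 hA.
  by exists m; split => //; apply: ltW.
have [m /all_and2[Mm hm]] := choice ex.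
have hp : exists p, tends m p.
  apply: nrm_complete => e e0.
  have k0 : 0 < 8 * d + 4 by lra.
  (* The parallelogram law bounds [|m_i - m_j|^2] by [(4 d + 2) (s + t)] if the two distances to [x]
     exceed [d] by at most [s, t <= 1]. *)
  have [N hN] := small_invS (e := e ^+ 2 / (8 * d + 4)) ltac:(by rewrite divr_gt0 ?exprn_gt0).
  exists N => i j /hN hi /hN hj.
  rewrite -(ler_pXn2r (n := 2)) ?nnegrE ?nrm_ge0 ?(ltW e0) //.
  have Mij : M (2^-1 *: (m i + m j)).
    have := Ml (2^-1) (m i + m j) 0; rewrite addr0; apply => //.
    by have := Ml 1 (m i) (m j); rewrite scale1r; apply.
  have e1 : (x - m i) + (x - m j) = 2 *: (x - 2^-1 *: (m i + m j)).
    rewrite scalerBr scalerA divff ?pnatr_eq0 // scale1r scaler_nat mulr2n.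
    by rewrite addrACA opprD.
  have := parallelogram hdot (x - m i) (x - m j).
  have e2 : x - m i - (x - m j) = m j - m i by rewrite opprB addrC addrA subrK.
  rewrite e1 e2 nrmZ nrm_nat.
  have := d_le _ Mij; have := hm i; have := hm j.
  have : (8 * d + 4) * (i.+1%:R^-1 : R) <= e ^+ 2 by rewrite mulrC -ler_pdivlMr.
  have : (8 * d + 4) * (j.+1%:R^-1 : R) <= e ^+ 2 by rewrite mulrC -ler_pdivlMr.
  have : (i.+1%:R^-1 : R) <= 1 by rewrite invf_le1 // ler1n.
  have : (j.+1%:R^-1 : R) <= 1 by rewrite invf_le1 // ler1n.
  have : 0 < (i.+1%:R^-1 : R) by rewrite invr_gt0.
  have : 0 < (j.+1%:R^-1 : R) by rewrite invr_gt0.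
  move: (i.+1%:R^-1) (j.+1%:R^-1) (nrm_ge0 (x - m i)) (nrm_ge0 (x - m j)) => s t.
  rewrite (nrmBC (m j)).
  move: (nrm (x - m i)) (nrm (x - m j)) (nrm (x - _)) (nrm _) => p q r w.
  nra.
have [p hp'] := hp; exists p.
have cp : in_closure M p.
  by move=> e /hp'[N /(_ N (leqnn _)) h]; exists (m N); rewrite // nrmBC.
split => // y My.
have d_le' q : in_closure M q -> d <= nrm (x - q).
  move=> hq; apply: le_of_le_add => e /hq[z Mz hz].
  rewrite (le_trans (d_le _ Mz)) // (le_trans (nrm_sub _ q _)) // lerD2l //.
have pd : nrm (x - p) <= d.
  apply: le_of_le_add => e e0; have e2 : 0 < e / 2 by lra.
  have [N hN] := hp' _ e2; have [K hK] := small_invS e2.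
  have h1 := hN (maxn N K) (leq_maxl _ _); have h2 := hK (maxn N K) (leq_maxr _ _).
  rewrite (le_trans (nrm_sub _ (m (maxn N K)) _)) //.
  have h3 := lerD (le_trans (hm (maxn N K)) (lerD (lexx d) h2)) h1.
  by rewrite (le_trans h3) // -addrA -splitr.
pose w := x - p; pose c := dot w y.
(* The best coefficient would be [c / |y|^2]. The added 1 allows [y = 0] and keeps [s |y|^2] below
   1, which suffices to force [c = 0]. *)
pose s : R := (nrm y ^+ 2 + 1)^-1.
have s1 : 0 < nrm y ^+ 2 + 1 by rewrite ltr_wpDl ?sqr_ge0.
have s0 : 0 < s by rewrite invr_gt0.
pose a : R[i] := s%:C * c.
have : d <= nrm (w - a *: y).
  have := d_le' (p + a *: y); rewrite /w opprD addrA; apply => e /cp[z Mz hz].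
  exists (a *: y + z); first exact: Ml.
  by rewrite [a *: y + z]addrC opprD addrACA subrr addr0.
have e1 : complex.Re (dot w (a *: y)) = s * nrm c ^+ 2.
  have -> : dot w (a *: y) = (s * nrm c ^+ 2)%:C.
    rewrite dotZr /a rmorphM /= conjE conjc_real -/c (rmorphM (real_complex R)) /=.
    by rewrite -mulJ_nrm -mulrA; congr (_ * _); rewrite mulrC.
  by [].
move=> /(le_trans pd); rewrite -/w -(ler_pXn2r (n := 2)) ?nnegrE ?nrm_ge0 //.
rewrite (nrm_subsq hdot w) e1 nrmZ /a nrmM nrmr (gtr0_norm s0).
have s2 : s * (nrm y ^+ 2 + 1) = 1 by rewrite mulVf // gt_eqF.
move=> h; apply: nrm0_eq0; rewrite -/c.
have h3 : s * nrm c ^+ 2 * (2 - s * nrm y ^+ 2) <= 0 by nra.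
have h4 : 2 - s * nrm y ^+ 2 > 0 by nra.
have h5 : nrm c ^+ 2 <= 0.
  by rewrite -(pmulr_rle0 _ s0); rewrite pmulr_lle0 in h3.
by apply/eqP; rewrite -sqrf_eq0 eq_le h5 sqr_ge0.
Qed.

Lemma riesz (phi : H -> R[i]) (C : R) :
  (forall a x y, phi (a *: x + y) = a * phi x + phi y) ->
  (forall x, nrm (phi x) <= C * nrm x) -> exists z, forall x, phi x = dot x z.
Proof.
move=> lphi bphi.
have C0 : 0 < `|C| + 1 by rewrite ltr_wpDl.
have phi0 : phi 0 = 0.
  have := lphi 1 0 0; rewrite scale1r addr0 mul1r => /eqP.
  by rewrite -subr_eq0 opprD addrA subrr sub0r oppr_eq0 => /eqP.
have phiD x y : phi (x + y) = phi x + phi y by rewrite -[x]scale1r lphi mul1r scale1r.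
have phiZ a x : phi (a *: x) = a * phi x by rewrite -[a *: x]addr0 lphi phi0 addr0.
have phiB x y : phi (x - y) = phi x - phi y by rewrite -scaleN1r phiD phiZ mulN1r.
have [h|] := pselect (forall x, phi x = 0); first by exists 0 => x; rewrite h dot0r.
move=> /existsNP[x0 /eqP nx0].
have [p [cp op]] := @orthogonal_projection [set x | phi x = 0] x0 phi0
  ltac:(by move=> a y z /= hy hz; rewrite lphi hy hz mulr0 addr0).
have phip : phi p = 0.
  apply: nrm0_eq0; apply/eqP; rewrite eq_le nrm_ge0 andbT.
  apply: le_of_le_add => e e0; rewrite add0r.
  have [m hm hpm] := cp (e / (`|C| + 1)) (divr_gt0 e0 C0).
  have -> : phi p = phi (p - m) by rewrite phiB hm subr0.
  rewrite (le_trans (bphi _)) // (@le_trans _ _ ((`|C| + 1) * nrm (p - m))) //.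
    by rewrite ler_wpM2r ?nrm_ge0 // (le_trans (ler_norm _)) // lerDl.
  by rewrite mulrC -ler_pdivlMr.
pose w := x0 - p.
have phiw : phi w != 0 by rewrite phiB phip subr0.
have w0 : w != 0 by apply: contra phiw => /eqP ->; rewrite phi0.
have ww : dot w w != 0.
  rewrite (dotxx hdot); apply/eqP => /complexI /eqP; rewrite sqrf_eq0.
  by apply/negP; rewrite gt_eqF // nrm_gt0.
exists ((phi w / dot w w)^* *: w) => x.
have := op (x - (phi x / phi w) *: w).
rewrite /= phiB phiZ divfK // subrr => /(_ erefl) /eqP.
rewrite dotBr dotZr subr_eq0 => /eqP h.
have h' : dot x w = (phi x / phi w) * dot w w.
  by rewrite dotC h rmorphM /= conjCK -dotC.
by rewrite dotZr conjCK h'; field; rewrite phiw ww.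
Qed.

Lemma form_rep (e : H -> H -> R[i]) (C : R) :
  (forall a x y z, e (a *: x + y) z = a * e x z + e y z) ->
  (forall a x y z, e z (a *: x + y) = a^* * e z x + e z y) ->
  (forall x y, nrm (e x y) <= C * nrm x * nrm y) ->
  exists Z : {linear H -> H}, bounded_op Z /\ forall x y, e x y = dot x (Z y).
Proof.
move=> el er eb.
have ex y : exists z, forall x, e x y = dot x z.
  apply: (@riesz _ (C * nrm y)); first by move=> *; apply: el.
  by move=> x; rewrite mulrAC.
have [Z hZ] := choice ex.
have Zl : linear Z.
  move=> a x y; apply: (dot_inj hdot) => z.
  by rewrite -hZ er dotDr dotZr -!hZ.
exists (linear_of Zl); split => //.
exists (`|C| + 1); first by rewrite ltr_wpDl.
move=> y /=; have [->|] := eqVneq (Z y) 0.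
  by rewrite nrm0 mulr_ge0 ?nrm_ge0 // addr_ge0.
rewrite -nrm_gt0 => Zy; rewrite -(ler_pM2l Zy) -expr2 -(Re_dotxx hdot) -hZ.
rewrite (le_trans (Re_le_nrm _)) // (le_trans (eb _ _)) // -mulrA mulrCA.
rewrite ler_wpM2l ?nrm_ge0 // ler_wpM2r ?nrm_ge0 //.
by rewrite (le_trans (ler_norm _)) // lerDl.
Qed.

Lemma adjointP (A : {linear H -> H}) : bounded_op A -> is_adjoint dot A (adjoint dot A).
Proof.
move=> [C C0 hC].
have [|||Z [bZ hZ]] := @form_rep (fun x y => dot (A x) y) C.
- by move=> a x y z; rewrite linearP dotDl dotZl.
- by move=> a x y z; rewrite dotDr dotZr.
- move=> x y; rewrite (le_trans (cauchy_schwarz hdot _ _)) //.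
  by rewrite ler_wpM2r ?nrm_ge0.
apply: (@getPex _ (is_adjoint dot A)); exists Z; split => //.
by apply/bounded_opP.
Qed.

(** The defect [f] vanishes on the diagonal, so it is antisymmetric; replacing [y] by [i y] shows
    that it is also symmetric, hence zero. *)
Lemma positive_selfadjoint (B : {linear H -> H}) :
  (forall x, 0 <= dot (B x) x) -> forall x y, dot (B x) y = dot x (B y).
Proof.
move=> pB x y.
pose f u v := dot (B u) v - dot u (B v).
have f0 u : f u u = 0.
  rewrite /f (dotC dot u); have := pB u; move: (dot (B u) u) => z /ger0_Im.
  by case: z => r i /= ->; rewrite conjE /= oppr0 subrr.
have fs u v : f u v + f v u = 0.
  transitivity (f (u + v) (u + v) - f u u - f v v).
    by rewrite /f linearD !(dotDl, dotDr); ring.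
  by rewrite !f0 !subr0.
have h1 := fs x y; have := fs x ('i%C *: y).
have BZ a u : B (a *: u) = a *: B u by exact: linearZ.
rewrite /f BZ !dotZl !dotZr => h2.
have iE : ('i%C : R[i])^* = - 'i%C by rewrite conjE; apply/eqP; rewrite eq_complex /= oppr0 !eqxx.
have {}h2 : 'i%C * (f x y - f y x) = 0.
  by apply: oppr_inj; rewrite oppr0 -[RHS]h2 iE /f; ring.
move/eqP: h2; rewrite mulf_eq0.
have -> /= : ('i%C == 0 :> R[i]) = false.
  by rewrite eq_complex /= oner_eq0 andbF.
rewrite subr_eq0 => /eqP h2; move: h1; rewrite -h2 -mulr2n => /eqP.
by rewrite mulrn_eq0 /= subr_eq0 => /eqP.
Qed.

End Operators.

(** * Square roots of positive operators *)

Section SquareRoot.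
Context (R : realType) (H : completeNormedModType R[i]).
Context (dot : {dot H for Num.conj}) (hdot : hilbert_dot dot).

(* Visser's iteration [Y_(n+1) = (X + Y_n ^ 2) / 2] converges to [1 - sqrt (1 - X)]
   when [`|X| <= 1]; the scalar iteration with [X = 1] is a majorant. *)
Fixpoint visser (X : H -> H) (n : nat) : H -> H :=
  if n is m.+1 then fun x => 2^-1 *: (X x + visser X m (visser X m x))
  else fun=> 0.

Fixpoint visser_majorant (n : nat) : R :=
  if n is m.+1 then (1 + visser_majorant m ^+ 2) / 2 else 0.

Local Notation y := visser_majorant.

Lemma visser_majorant_bounds n : 0 <= y n <= 1 /\ y n <= y n.+1.
Proof.
elim: n => [|n [/andP[h0 h1] h2]] /=.
  by split; [rewrite lexx ler01|rewrite expr0n /= addr0; lra].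
split; first by apply/andP; split; nra.
have : y n ^+ 2 <= y n.+1 ^+ 2 by rewrite ler_pXn2r ?nnegrE // (le_trans h0).
rewrite /=; lra.
Qed.

Lemma visser_majorant_homo m n : (m <= n)%N -> y m <= y n.
Proof.
elim: n => [|n IHn]; first by rewrite leqn0 => /eqP->.
rewrite leq_eqVlt => /orP[/eqP->//|/IHn h].
exact: le_trans h (visser_majorant_bounds n).2.
Qed.

Lemma visser_majorant_cauchy (e : R) : 0 < e ->
  exists N, forall m n, (N <= m)%N -> (m <= n)%N -> y n - y m <= e.
Proof.
move=> e0; pose A := [set r | exists n, r = y n].
have hA : has_sup A.
  split; first by exists (y 0%N), 0%N.
  by exists 1 => _ [n ->]; have [/andP[]] := visser_majorant_bounds n.
have [_ [N ->] hN] := sup_adherent e0 hA.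
exists N => m n Nm mn.
have := visser_majorant_homo Nm.
have : y n <= sup A by apply: ub_le_sup; [case: hA|exists n].
lra.
Qed.

Section Contraction.
Variables (X : {linear H -> H}).
Hypothesis X_sa : forall x z, dot (X x) z = dot x (X z).
Hypothesis X_le1 : forall x, nrm (X x) <= nrm x.
Local Notation Y := (visser X).

Lemma visser_linear n a x z : Y n (a *: x + z) = a *: Y n x + Y n z.
Proof.
elim: n x z => [|n IHn] x z /=; first by rewrite scaler0 addr0.
by rewrite !IHn linearP addrACA -(scalerDr a) (scalerDr 2^-1) !scalerA mulrC.
Qed.

Lemma visserB n x z : Y n (x - z) = Y n x - Y n z.
Proof. by rewrite addrC -scaleN1r visser_linear scaleN1r addrC. Qed.

Lemma visser_comm (g : {linear H -> H}) n x :
  (forall x, g (X x) = X (g x)) -> g (Y n x) = Y n (g x).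
Proof.
move=> hg; elim: n x => [|n IHn] x /=; first by rewrite linear0.
by rewrite linearZ linearD /= hg !IHn.
Qed.

Lemma visser_commX n x : X (Y n x) = Y n (X x).
Proof. exact: visser_comm. Qed.

Lemma visserC m n x : Y m (Y n x) = Y n (Y m x).
Proof.
exact: (@visser_comm (linear_of (visser_linear m)) n x
  (fun x => esym (visser_commX m x))).
Qed.

Lemma visser_sa n x z : dot (Y n x) z = dot x (Y n z).
Proof.
elim: n x z => [|n IHn] x z /=; first by rewrite dot0l dot0r.
rewrite dotZl dotZr dotDl dotDr X_sa !IHn; congr (_ * _).
by rewrite fmorphV rmorph_nat.
Qed.

Lemma visser_bound n x : nrm (Y n x) <= y n * nrm x.
Proof.
elim: n x => [|n IHn] x /=; first by rewrite nrm0 mul0r.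
have [/andP[y0 _] _] := visser_majorant_bounds n.
rewrite nrmZ nrmV nrm_nat mulrAC mulrC ler_wpM2r ?invr_ge0 //.
rewrite (le_trans (nrmD _ _)) // mulrDl mul1r lerD //.
by rewrite (le_trans (IHn _)) // expr2 -mulrA ler_wpM2l.
Qed.

(** All iterates are polynomials in [X] and commute, hence [Y_(n+2) - Y_(n+1)] is half of
    [(Y_(n+1) - Y_n) (Y_(n+1) + Y_n)]. The majorant satisfies the same identity. *)
Lemma visser_step n x : nrm (Y n.+1 x - Y n x) <= (y n.+1 - y n) * nrm x.
Proof.
elim: n x => [|n IHn] x.
  rewrite /= !subr0 expr0n /= addr0 nrmZ nrmV nrm_nat addr0.
  rewrite mul1r ler_wpM2l ?invr_ge0 //.
have [/andP[y0 _] y1] := visser_majorant_bounds n.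
have [/andP[y2 _] _] := visser_majorant_bounds n.+1.
have -> : Y n.+2 x - Y n.+1 x =
    2^-1 *: ((Y n.+1 (Y n.+1 x + Y n x)) - Y n (Y n.+1 x + Y n x)).
  rewrite [Y n.+2 x]/= -/(Y n.+1) [in LHS]/=.
  rewrite -scalerBr opprD addrACA subrr add0r; congr (_ *: _).
  have D k u v : Y k (u + v) = Y k u + Y k v.
    by have := visser_linear k 1 u v; rewrite !scale1r.
  rewrite -[2^-1 *: _]/(Y n.+1 _) !D (visserC n n.+1).
  by rewrite opprD addrACA addrA subrK addrC -/(Y n.+1 _) addrC.
rewrite nrmZ nrmV nrm_nat.
have := IHn (Y n.+1 x + Y n x).
have := nrmD (Y n.+1 x) (Y n x).
have := visser_bound n x; have := visser_bound n.+1 x.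
have := nrm_ge0 x; have := nrm_ge0 (Y n.+1 x + Y n x).
have -> : y n.+2 - y n.+1 = 2^-1 * ((y n.+1 - y n) * (y n.+1 + y n)) by rewrite /=; field.
move: (y n) (y n.+1) y0 y1 y2 => s t s0 st t0.
move: (nrm x) (nrm (Y n x)) (nrm (Y n.+1 x)) (nrm (_ + _)) (nrm _) => a b c e f.
move=> e0 a0 hc hb he hf; rewrite -mulrA ler_wpM2l ?invr_ge0 //.
rewrite (le_trans hf) // -mulrA ler_wpM2l ?subr_ge0 //; lra.
Qed.

Lemma visser_dist m n x : (m <= n)%N -> nrm (Y n x - Y m x) <= (y n - y m) * nrm x.
Proof.
elim: n => [|n IHn]; first by rewrite leqn0 => /eqP->; rewrite !subrr nrm0 mul0r.
rewrite leq_eqVlt => /orP[/eqP->|/IHn h]; first by rewrite !subrr nrm0 mul0r.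
rewrite (le_trans (nrm_sub _ (Y n x) _)) //; have := visser_step n x.
by rewrite -[y n.+1 - y m](subrK (y n)) addrAC -addrA [X in _ <= X]mulrDl; lra.
Qed.

(** The limit [Z] of the iterates satisfies [2 Z = X + Z ^ 2], so [1 - Z] squares to [1 - X]; it is
    positive because [Z] is a self-adjoint contraction. *)
Lemma sqrt_one_minus_contraction : exists S : {linear H -> H},
  [/\ bounded_op S, forall x, 0 <= dot (S x) x & forall x, S (S x) = x - X x].
Proof.
have ex x : exists l, tends (fun n => Y n x) l.
  apply: nrm_complete => e e0.
  have x1 : 0 < nrm x + 1 by rewrite ltr_wpDl ?nrm_ge0.
  have [N hN] := visser_majorant_cauchy (divr_gt0 e0 x1).
  exists N => m n.
  wlog mn : m n / (m <= n)%N.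
    move=> h; case: (leqP m n) => [/h //|/ltnW nm] Nm Nn.
    by rewrite nrmBC; apply: h.
  move=> Nm _; rewrite nrmBC (le_trans (visser_dist _ mn)) //.
  have := hN _ _ Nm mn; rewrite ler_pdivlMr // => h.
  rewrite (le_trans _ h) // ler_wpM2l ?lerDl //.
  by rewrite subr_ge0 visser_majorant_homo.
have [Z hZ] := choice ex.
have Zl : linear Z.
  move=> a x z; apply: tends_unique (hZ _) _.
  apply: (tends_eq (u := fun n => a *: Y n x + Y n z)).
    by move=> n; rewrite visser_linear.
  by apply: tendsD => //; apply: tendsZ.
have Z1 x : nrm (Z x) <= nrm x.
  apply: (tends_nrm_le (hZ x)); exists 0%N => n _.
  rewrite (le_trans (visser_bound _ _)) // -[leRHS]mul1r.
  by rewrite ler_wpM2r ?nrm_ge0 //; have [/andP[]] := visser_majorant_bounds n.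
have Zsa x z : dot (Z x) z = dot x (Z z).
  apply: (tends_unique (tends_dotl hdot z (hZ x))).
  by apply: tends_eq (tends_dotr hdot x (hZ z)) => n; rewrite visser_sa.
have Z2 x : Z x = 2^-1 *: (X x + Z (Z x)).
  apply: tends_unique (tends_shift (hZ x)) _ => /=.
  apply: tendsZ; apply: tendsD; first exact: tends_const.
  move=> e e0; have e2 : 0 < e / 2 by lra.
  have [N hN] := hZ x _ e2; have [M hM] := hZ (Z x) _ e2.
  exists (maxn N M) => n; rewrite geq_max => /andP[/hN h1 /hM h2].
  rewrite (le_trans (nrm_sub _ (Y n (Z x)) _)) // -visserB.
  have := visser_bound n (Y n x - Z x).
  have [/andP[? ?] _] := visser_majorant_bounds n.
  have := nrm_ge0 (Y n x - Z x); nra.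
have Sl : linear (fun x => x - Z x).
  by move=> a x z; rewrite Zl scalerBr opprD addrACA.
exists (linear_of Sl); split => /=.
- by exists 2 => // x /=; rewrite (le_trans (nrmB _ _)) //; have := Z1 x; lra.
- move=> x; rewrite dotBl subr_ge0 (dotxx hdot).
  have -> : dot (Z x) x = (complex.Re (dot (Z x) x))%:C.
    have : (dot (Z x) x)^* = dot (Z x) x by rewrite {1}Zsa -dotC.
    case: (dot (Z x) x) => r i; rewrite conjE /= => -[] h.
    by congr (_ +i* _); lra.
  rewrite lecR (le_trans (Re_dot_le hdot _ _)) // expr2.
  by rewrite ler_wpM2r ?nrm_ge0.
move=> x.
have ZB : Z (x - Z x) = Z x - Z (Z x) by rewrite addrC -scaleN1r Zl scaleN1r addrC.
have h : Z x + Z x = X x + Z (Z x).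
  have := congr1 (fun u => 2 *: u) (Z2 x).
  by rewrite scalerA divff ?pnatr_eq0 // scale1r scaler_nat mulr2n.
rewrite ZB opprB addrA addrAC -[x - Z x - Z x]addrA -opprD h opprD addrA subrK //.
Qed.

End Contraction.

(** With a bound [C] of [A], the operator [X = 1 - A / C] is a self-adjoint contraction, and
    [sqrt C] times a root of [1 - X] is a root of [A]. *)
Lemma sqrt_opP (A : {linear H -> H}) : bounded_op A ->
  (forall x, 0 <= dot (A x) x) -> is_sqrt_op dot A (sqrt_op dot A).
Proof.
move=> [C C0 hC] pA.
have Asa := positive_selfadjoint pA.
pose c : R[i] := (C^-1)%:C.
have cJ : c^* = c by rewrite conjE conjc_real.
have Xl : linear (fun x => x - c *: A x).
  by move=> a x z; rewrite linearP scalerDr !scalerA opprD addrACA scalerBr scalerA mulrC.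
pose X := linear_of Xl.
have Xsa x z : dot (X x) z = dot x (X z).
  by rewrite /= dotBl dotBr dotZl dotZr Asa cJ.
pose q x := complex.Re (dot (A x) x).
have Ci : C * C^-1 = 1 by rewrite divff // gt_eqF.
have Ci0 : 0 < C^-1 by rewrite invr_gt0.
have ReZ (r : R) z : complex.Re (r%:C * z) = r * complex.Re z.
  by case: z => u v /=; rewrite mul0r subr0.
(* The inequality [A ^ 2 <= C A] comes from the positivity of [q] at [x - A x / C]. *)
have hq x : nrm (A x) ^+ 2 <= C * q x.
  have : 0 <= q (x - c *: A x).
    by have := pA (x - c *: A x); rewrite lecE => /andP[_].
  have -> : q (x - c *: A x) =
      q x - 2 * C^-1 * nrm (A x) ^+ 2 + C^-1 ^+ 2 * q (A x).
    rewrite /q.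
    have -> : A (x - c *: A x) = A x - c *: A (A x) by rewrite linearB linearZ.
    rewrite dotBl !dotBr !dotZl !dotZr cJ (Asa (A x)).
    by rewrite (dotxx hdot) !raddfB /= !ReZ /=; ring.
  have : q (A x) <= C * nrm (A x) ^+ 2.
    rewrite (le_trans (Re_dot_le hdot _ _)) // expr2 mulrA.
    by rewrite ler_wpM2r ?nrm_ge0.
  move: (q (A x)) (q x) (nrm (A x) ^+ 2) Ci Ci0 C0 => s t u; move: C^-1 => k.
  move=> h1 h2 h3 h4 h5; have : k ^+ 2 * s <= k * u.
    rewrite expr2 -mulrA ler_wpM2l ?(ltW h2) //.
    by rewrite (le_trans (ler_wpM2l (ltW h2) h4)) // mulrA (mulrC k) h1 mul1r.
  move=> h6; have h7 : 0 <= t - k * u by lra.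
  have := mulr_ge0 (ltW h3) h7; rewrite mulrBr mulrA h1; lra.
have X1 x : nrm (X x) <= nrm x.
  rewrite -(ler_pXn2r (n := 2)) ?nnegrE ?nrm_ge0 //= (nrm_subsq hdot).
  rewrite dotZr cJ ReZ -Asa -/(q x) nrmZ nrmr gtr0_norm // exprMn.
  have h : C^-1 ^+ 2 * nrm (A x) ^+ 2 <= C^-1 * q x.
    have -> : C^-1 * q x = C^-1 ^+ 2 * (C * q x) by field; rewrite gt_eqF.
    exact: ler_wpM2l (sqr_ge0 _) _ _ (hq x).
  have : 0 <= C^-1 * q x.
    by rewrite mulr_ge0 ?(ltW Ci0) //; have := pA x; rewrite lecE => /andP[_].
  move: h; lra.
have [S [[D D0 bS] pS S2]] := sqrt_one_minus_contraction Xsa X1.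
pose k : R[i] := (Num.sqrt C)%:C.
have kJ : k^* = k by rewrite conjE conjc_real.
have Bl : linear (fun x => k *: S x).
  by move=> a x z; rewrite linearP scalerDr !scalerA mulrC.
apply: (@getPex _ (is_sqrt_op dot A)); exists (linear_of Bl); split.
- apply/bounded_opP; exists (Num.sqrt C * D); first by rewrite mulr_gt0 ?sqrtr_gt0.
  by move=> x /=; rewrite nrmZ nrmr ger0_norm ?sqrtr_ge0 // -mulrA ler_wpM2l ?sqrtr_ge0.
- by move=> x /=; rewrite dotZl mulr_ge0 // ler0c sqrtr_ge0.
move=> x /=; rewrite linearZ /= scalerA S2 /= opprB addrC subrK scalerA.
rewrite -rmorphM /= -expr2 sqr_sqrtr ?(ltW C0) // /c -rmorphM /= Ci.
by rewrite scale1r.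
Qed.

End SquareRoot.

Lemma bernoulli (R : realType) (s : R) n : -1 <= s -> 1 + n%:R * s <= (1 + s) ^+ n.
Proof.
move=> s1; elim: n => [|n IHn]; first by rewrite mul0r addr0 expr0.
have t0 : 0 <= 1 + s by lra.
have := ler_wpM2l t0 IHn; rewrite exprS -natr1.
have := mulr_ge0 (ler0n R n) (sqr_ge0 s).
move: ((1 + s) ^+ n) (n%:R) => u v; nra.
Qed.

Lemma Re_sum (R : realType) I (s : seq I) (P : pred I) (F : I -> R[i]) :
  complex.Re (\sum_(i <- s | P i) F i) = \sum_(i <- s | P i) complex.Re (F i).
Proof. by elim/big_rec2 : _ => [//|i a b _ <-]; case: (F i) b => ? ? []. Qed.

(** * Word sums and the polar decomposition *)

Section WordSums.
Context (R : realType) (H : completeNormedModType R[i]).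
Context (d : nat).
Implicit Types (T : 'I_d -> {linear H -> H}) (x y z : H) (a : R[i]).

(** A general [f] is allowed because the vectors at the ends of the words will also be measured by
    [nrm (P y)] and [nrm (S y)]. *)
Fixpoint word_sum T (f : H -> R) (n : nat) (x : H) : R :=
  if n is m.+1 then \sum_(k < d) word_sum T f m (T k x) else f x.

(** This is [Q_n(T)]. *)
Definition word_normsq T := word_sum T (fun x => nrm x ^+ 2).

(** The polarization of [word_sum], which can be represented by an operator. *)
Fixpoint word_form T (f : H -> H -> R[i]) (n : nat) (x y : H) : R[i] :=
  if n is m.+1 then \sum_(k < d) word_form T f m (T k x) (T k y) else f x y.

Lemma word_sum_le T (f g : H -> R) n x : (forall x, f x <= g x) ->
  word_sum T f n x <= word_sum T g n x.
Proof.
move=> h; elim: n x => [|n IHn] x //=.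
by apply: ler_sum => k _.
Qed.

Lemma word_sum_eq T (f g : H -> R) n x : f =1 g ->
  word_sum T f n x = word_sum T g n x.
Proof. by move=> /funext ->. Qed.

Lemma word_sumM T (f : H -> R) c n x :
  word_sum T (fun x => c * f x) n x = c * word_sum T f n x.
Proof.
elim: n x => [|n IHn] x //=.
by rewrite mulr_sumr; apply: eq_bigr => k _.
Qed.

Lemma word_sum_add T (f : H -> R) m n x :
  word_sum T f (m + n) x = word_sum T (word_sum T f m) n x.
Proof.
elim: n x => [|n IHn] x; first by rewrite addn0.
by rewrite addnS /=; apply: eq_bigr => k _.
Qed.

Lemma word_sum_ge0 T (f : H -> R) n x : (forall x, 0 <= f x) ->
  0 <= word_sum T f n x.
Proof.
move=> h; elim: n x => [|n IHn] x //=.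
by apply: sumr_ge0 => k _.
Qed.

Lemma word_normsq_ge0 T n x : 0 <= word_normsq T n x.
Proof. by apply: word_sum_ge0 => y; rewrite sqr_ge0. Qed.

Lemma word_normsq_bound T : (forall k, bounded_op (T k)) ->
  forall n, exists2 C : R, 0 < C & forall x, word_normsq T n x <= C * nrm x ^+ 2.
Proof.
move=> bT; elim=> [|n [C C0 hC]]; first by exists 1 => // x; rewrite mul1r.
have hk k : exists D : R, forall x, nrm (T k x) ^+ 2 <= D * nrm x ^+ 2.
  have [D D0 hD] := bT k; exists (D ^+ 2) => x; rewrite -exprMn.
  by rewrite ler_pXn2r ?nnegrE ?nrm_ge0 // mulr_ge0 ?nrm_ge0 // ltW.
have [D hD] := choice hk.
exists (C * \sum_(k < d) `|D k| + 1).
  by rewrite ltr_wpDl // mulr_ge0 ?(ltW C0) // sumr_ge0.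
move=> x; rewrite mulrDl mul1r ler_wpDr ?sqr_ge0 // /word_normsq /=.
rewrite mulr_sumr mulr_suml; apply: ler_sum => k _.
rewrite (le_trans (hC _)) // -mulrA ler_wpM2l ?(ltW C0) //.
by rewrite (le_trans (hD _ _)) // ler_wpM2r ?sqr_ge0 // ler_norm.
Qed.

Lemma sqrt_cauchy2 (p q r s : R) : 0 <= p -> 0 <= q -> 0 <= r -> 0 <= s ->
  Num.sqrt p * Num.sqrt q + Num.sqrt r * Num.sqrt s <=
  Num.sqrt (p + r) * Num.sqrt (q + s).
Proof.
move=> p0 q0 r0 s0.
rewrite -(ler_pXn2r (n := 2)) ?nnegrE ?addr_ge0 ?mulr_ge0 ?sqrtr_ge0 //.
rewrite [leRHS]exprMn !sqr_sqrtr ?addr_ge0 //.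
have := sqr_sqrtr p0; have := sqr_sqrtr q0; have := sqr_sqrtr r0; have := sqr_sqrtr s0.
move: (Num.sqrt p) (Num.sqrt q) (Num.sqrt r) (Num.sqrt s) => u v w t <- <- <- <-.
have := sqr_ge0 (u * t - v * w); nra.
Qed.

Lemma sum_sqrt_le I (s : seq I) (f g : I -> R) :
  (forall i, 0 <= f i) -> (forall i, 0 <= g i) ->
  \sum_(i <- s) Num.sqrt (f i) * Num.sqrt (g i) <=
  Num.sqrt (\sum_(i <- s) f i) * Num.sqrt (\sum_(i <- s) g i).
Proof.
move=> f0 g0; elim: s => [|i s IHs]; first by rewrite !big_nil sqrtr0 mulr0.
rewrite !big_cons (le_trans _ (sqrt_cauchy2 _ _ _ _)) ?sumr_ge0 //.
by rewrite lerD2l.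
Qed.

Lemma word_form_cauchy T (f : H -> H -> R[i]) (g h : H -> R) n x y :
  (forall x, 0 <= g x) -> (forall x, 0 <= h x) ->
  (forall x y, nrm (f x y) <= Num.sqrt (g x) * Num.sqrt (h y)) ->
  nrm (word_form T f n x y) <=
    Num.sqrt (word_sum T g n x) * Num.sqrt (word_sum T h n y).
Proof.
move=> g0 h0 hf; elim: n x y => [|n IHn] x y //=.
rewrite (le_trans (nrm_sum _ _ _)) //.
rewrite (le_trans _ (sum_sqrt_le _ _ _)) //; last 2 first.
- by move=> k; apply: word_sum_ge0.
- by move=> k; apply: word_sum_ge0.
by apply: ler_sum => k _.
Qed.

Lemma word_form_linl T (f : H -> H -> R[i]) n :
  (forall a x y z, f (a *: x + y) z = a * f x z + f y z) ->
  forall a x y z, word_form T f n (a *: x + y) z =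
    a * word_form T f n x z + word_form T f n y z.
Proof.
move=> hf; elim: n => [|n IHn] a x y z //=.
by rewrite mulr_sumr -big_split; apply: eq_bigr => k _ /=; rewrite linearP.
Qed.

Lemma word_form_linr T (f : H -> H -> R[i]) n :
  (forall a x y z, f z (a *: x + y) = a^* * f z x + f z y) ->
  forall a x y z, word_form T f n z (a *: x + y) =
    a^* * word_form T f n z x + word_form T f n z y.
Proof.
move=> hf; elim: n => [|n IHn] a x y z //=.
by rewrite mulr_sumr -big_split; apply: eq_bigr => k _ /=; rewrite linearP.
Qed.

Lemma word_formC T (f : H -> H -> R[i]) n x y :
  (forall x y, f x y = (f y x)^*) -> word_form T f n x y = (word_form T f n y x)^*.
Proof.
move=> hf; elim: n x y => [|n IHn] x y //=.
by rewrite rmorph_sum; apply: eq_bigr.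
Qed.

Lemma Re_word_form T (f : H -> H -> R[i]) n x :
  complex.Re (word_form T f n x x) = word_sum T (fun x => complex.Re (f x x)) n x.
Proof.
elim: n x => [|n IHn] x //=.
by rewrite Re_sum; apply: eq_bigr.
Qed.

End WordSums.

(** * A Heinz inequality *)

Section Heinz.
Context (R : realType) (H : completeNormedModType R[i]).
Context (dot : {dot H for Num.conj}) (hdot : hilbert_dot dot).

(** Replaces taking [n]-th roots: if [K < a], the powers of the quotient of [a] by the midpoint of
    [a] and [K] would be bounded, against Bernoulli's inequality. *)
Lemma le_of_exp_le (a D K : R) : 0 <= a -> 0 <= K ->
  (forall n, a ^+ n.+1 <= D * K ^+ n) -> a <= K.
Proof.
move=> a0 K0 h; rewrite leNgt; apply/negP => Ka.
pose t := a / ((a + K) / 2).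
have m0 : 0 < (a + K) / 2 by lra.
have t1 : 0 < t - 1 by rewrite subr_gt0 ltr_pdivlMr // mul1r; lra.
have D0 : 0 <= D by have := h 0%N; rewrite expr1 expr0 mulr1; apply: le_trans.
have ap : 0 < a by lra.
have tn n : t ^+ n <= D / a.
  rewrite ler_pdivlMr // /t exprMn exprVn mulrAC -exprSr.
  rewrite ler_pdivrMr ?exprn_gt0 // (le_trans (h n)) // ler_wpM2l //.
  by rewrite lerXn2r ?nnegrE //; lra.
have := @bernoulli R (t - 1) (Num.truncn (D / a / (t - 1))).+1 ltac:(lra).
rewrite [1 + (t - 1)]addrC subrK.
have := tn (Num.truncn (D / a / (t - 1))).+1.
have := truncnS_gt (D / a / (t - 1)); rewrite ltr_pdivrMr //.
lra.
Qed.

(* [`|Y| <= K] for the self-adjoint [Y = S Z S]: [Y ^ n] has norm of order [K ^ n]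
   because [Y ^ n.+1 = S (Z S S) ^ n Z S], and [`|Y ^ n x|] is log-convex in [n]. *)
Lemma heinz (S Z : {linear H -> H}) (K : R) :
  bounded_op S -> bounded_op Z ->
  (forall x y, dot (S x) y = dot x (S y)) ->
  (forall x y, dot (Z x) y = dot x (Z y)) -> 0 <= K ->
  (forall x, nrm (Z (S (S x))) <= K * nrm x) ->
  forall x, nrm (S (Z (S x))) <= K * nrm x.
Proof.
move=> [A A0 hA] [B B0 hB] saS saZ K0 hK x.
pose Y x := S (Z (S x)).
have saY u v : dot (Y u) v = dot u (Y v) by rewrite /Y saS saZ saS.
pose s n := nrm (iter n Y x).
have s_conv n : s n.+1 ^+ 2 <= s n * s n.+2.
  rewrite /s -(Re_dotxx hdot) [X in dot X]/= saY.
  exact: Re_dot_le.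
have [->|x0] := eqVneq x 0; first by rewrite !linear0 !nrm0 mulr0.
have s0 : 0 < s 0%N by rewrite /s /= nrm_gt0.
have sge n : 0 <= s n by rewrite nrm_ge0.
(* Log-convexity makes the ratios [s n.+1 / s n] nondecreasing, so none is below the first one; the
   inequality is cross-multiplied since [s n] may vanish. *)
have s_ratio n : s n * s 1%N <= s n.+1 * s 0%N.
  elim: n => [|n IHn]; first by rewrite mulrC.
  have [sn0|] := eqVneq (s n.+1) 0; first by rewrite sn0 mul0r mulr_ge0.
  move=> sn; have sn0 : 0 < s n.+1 by rewrite lt_def sn sge.
  have sn1 : 0 < s n.
    rewrite lt_def sge andbT; apply/eqP => z; have := s_conv n; rewrite z mul0r.
    by rewrite leNgt exprn_gt0.
  rewrite -(ler_pM2l sn1) mulrA mulrA.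
  have := s_conv n; move: IHn sn0 sn1 s0 (sge 1%N) (sge n.+2).
  move: (s n) (s n.+1) (s n.+2) (s 1%N) (s 0%N) => p q r u v h1 h2 h3 h4 h5 h6 h7.
  rewrite (le_trans (_ : p * q * u <= q * q * v)) //.
    by rewrite mulrAC mulrC -mulrA ler_wpM2l ?(ltW h2).
  by rewrite -expr2 ler_wpM2r ?(ltW h4).
have s_pow n : s 1%N ^+ n.+1 <= s n.+1 * s 0%N ^+ n.
  elim: n => [|n IHn]; first by rewrite expr1 expr0 mulr1.
  rewrite exprSr (le_trans (ler_wpM2r (sge 1%N) IHn)) // mulrAC exprS mulrA.
  by rewrite ler_wpM2r ?exprn_ge0 ?(ltW s0).
have iterE n : iter n.+1 Y x = S (iter n (fun z => Z (S (S z))) (Z (S x))).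
  by elim: n => [//|n IHn]; rewrite iterS IHn.
have iterK n z : nrm (iter n (fun z => Z (S (S z))) z) <= K ^+ n * nrm z.
  elim: n => [|n IHn]; first by rewrite expr0 mul1r.
  by rewrite /= (le_trans (hK _)) // exprS -mulrA ler_wpM2l.
suff : s 1%N / s 0%N <= K by rewrite ler_pdivrMr.
apply: (@le_of_exp_le _ (A * nrm (Z (S x)) / s 0%N)) => //.
  by rewrite divr_ge0 // ltW.
move=> n; rewrite exprMn exprVn ler_pdivrMr ?exprn_gt0 //.
rewrite (le_trans (s_pow n)) //.
rewrite [leRHS](_ : _ = s 0%N ^+ n * (A * nrm (Z (S x)) * K ^+ n)); last first.
  by rewrite exprS; field; rewrite gt_eqF.
rewrite mulrC ler_wpM2l ?exprn_ge0 ?(ltW s0) // /s iterE (le_trans (hA _)) //.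
rewrite -mulrA ler_wpM2l ?(ltW A0) // mulrC; exact: iterK.
Qed.

End Heinz.

(** * Polar decomposition of a tuple *)

Section PolarDecomposition.
Context (R : realType) (H : completeNormedModType R[i]).
Context (dot : {dot H for Num.conj}) (hdot : hilbert_dot dot).
Context (d : nat) (T : 'I_d -> {linear H -> H}).
Hypothesis bT : forall k, bounded_op (T k).
Local Notation P := (polar_modulus dot T).

Lemma adjoint_dotP k x y : dot (T k x) y = dot x (adjoint dot (T k) y).
Proof. by have [_] := adjointP hdot (bT k); apply. Qed.

Lemma polar_modulusP : [/\ bounded_op P, forall x, 0 <= dot (P x) x
  & forall x, P (P x) = \sum_(k < d) adjoint dot (T k) (T k x)].
Proof.
have Gl : linear (fun x => \sum_(k < d) adjoint dot (T k) (T k x)).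
  move=> a x y; rewrite scaler_sumr -big_split; apply: eq_bigr => k _ /=.
  by rewrite !linearP.
have bG : bounded_op (linear_of Gl).
  have hk k : exists C : R, 0 <= C /\ forall x, nrm (adjoint dot (T k) (T k x)) <= C * nrm x.
    have [C C0 hC] := bT k; have [/bounded_opP[D D0 hD] _] := adjointP hdot (bT k).
    exists (D * C); split; first by rewrite mulr_ge0 ?ltW.
    move=> x; rewrite (le_trans (hD _)) // -mulrA ler_wpM2l ?(ltW D0) //.
  have [C /all_and2[C0 hC]] := choice hk.
  exists (\sum_(k < d) C k + 1); first by rewrite ltr_wpDl // sumr_ge0.
  move=> x /=; rewrite (le_trans (nrm_sum _ _ _)) // mulrDl mul1r.
  by rewrite ler_wpDr ?nrm_ge0 // mulr_suml; apply: ler_sum.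
have pG x : 0 <= dot (linear_of Gl x) x.
  rewrite /= dot_suml sumr_ge0 // => k _.
  rewrite dotC -adjoint_dotP (dotxx hdot) conjE conjc_real ler0c sqr_ge0 //.
by have [/bounded_opP ? ? ?] := sqrt_opP hdot bG pG; split.
Qed.

Lemma polar_modulus_sa x y : dot (P x) y = dot x (P y).
Proof. by have [_ /positive_selfadjoint h _] := polar_modulusP; apply: h. Qed.

Lemma polar_modulus_dot x y : dot (P x) (P y) = \sum_(k < d) dot (T k x) (T k y).
Proof.
have [_ _ PP] := polar_modulusP.
rewrite polar_modulus_sa PP dot_sumr.
by apply: eq_bigr => k _; rewrite adjoint_dotP.
Qed.

Lemma nrm_polar_modulus x : nrm (P x) ^+ 2 = \sum_(k < d) nrm (T k x) ^+ 2.
Proof.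
rewrite -(Re_dotxx hdot) polar_modulus_dot Re_sum.
by apply: eq_bigr => k _; rewrite (Re_dotxx hdot).
Qed.

Lemma nrm_le_polar_modulus k x : nrm (T k x) <= nrm (P x).
Proof.
rewrite -(ler_pXn2r (n := 2)) ?nnegrE ?nrm_ge0 // nrm_polar_modulus (bigD1 k) //=.
by rewrite lerDl sumr_ge0 // => i _; rewrite sqr_ge0.
Qed.

(** The graph of the partial isometry: [p] is the projection of [x] onto the closure of the range of
    [P], and [v] is the value at [p] of the continuous extension of [P y |-> T y]. *)
Let polar_data x p (v : 'I_d -> H) :=
  (forall m, dot (x - p) (P m) = 0) /\
  exists y, tends (fun n => P (y n)) p /\ forall k, tends (fun n => T k (y n)) (v k).

(** As [T k] is dominated by [P], the sequence [T k (y n)] is Cauchy once [P (y n)] converges. *)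
Let polar_data_ex x : exists pv, polar_data x pv.1 pv.2.
Proof.
have [||p [cp op]] := @orthogonal_projection R H dot hdot (range P) x.
- by exists 0 => //; rewrite linear0.
- by move=> a _ _ [y _ <-] [z _ <-]; exists (a *: y + z) => //; rewrite linearP.
have ex n : exists y, nrm (P y - p) <= n.+1%:R^-1.
  have n0 : 0 < n.+1%:R^-1 :> R by rewrite invr_gt0.
  by have [_ [y _ <-] h] := cp _ n0; exists y; rewrite nrmBC.
have [y hy] := choice ex.
have ty : tends (fun n => P (y n)) p.
  move=> e /small_invS[N hN]; exists N => n /hN h.
  exact: le_trans (hy n) h.
have exv k : exists v, tends (fun n => T k (y n)) v.
  apply: nrm_complete => e e0; have e2 : 0 < e / 2 by lra.
  have [N hN] := ty _ e2; exists N => m n /hN hm /hN hn.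
  rewrite -linearB (le_trans (nrm_le_polar_modulus _ _)) // linearB.
  rewrite (le_trans (nrm_sub _ p _)) // (nrmBC p); lra.
have [v hv] := choice exv.
exists (p, v); split; last by exists y.
by move=> m; apply: op; exists m.
Qed.

Let polar_data_lin a x p v x' p' v' : polar_data x p v -> polar_data x' p' v' ->
  polar_data (a *: x + x') (a *: p + p') (fun k => a *: v k + v' k).
Proof.
move=> [h1 [y [hy hv]]] [h2 [z [hz hw]]]; split.
  by move=> m; rewrite opprD addrACA -scalerBr dotDl dotZl h1 h2 mulr0 addr0.
exists (fun n => a *: y n + z n); split => [|k].
  apply: (tends_eq (u := fun n => a *: P (y n) + P (z n))).
    by move=> n; rewrite linearP.
  by apply: tendsD => //; apply: tendsZ.
apply: (tends_eq (u := fun n => a *: T k (y n) + T k (z n))).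
  by move=> n; rewrite linearP.
by apply: tendsD => //; apply: tendsZ.
Qed.

(** The identity [polar_modulus_dot] passes to the limit in one argument at a time. *)
Let polar_data_norm x p v : polar_data x p v ->
  \sum_(k < d) nrm (v k) ^+ 2 = nrm p ^+ 2.
Proof.
move=> [_ [y [hy hv]]].
have h1 z : \sum_(k < d) dot (v k) (T k z) = dot p (P z).
  apply: tends_unique (tends_dotl hdot (P z) hy).
  apply: (tends_eq (u := fun n => \sum_(k < d) dot (T k (y n)) (T k z))).
    by move=> n; rewrite polar_modulus_dot.
  by apply: tends_sum => k; apply: tends_dotl.
have h2 : \sum_(k < d) dot (v k) (v k) = dot p p.
  apply: tends_unique (tends_dotr hdot p hy).
  apply: (tends_eq (u := fun n => \sum_(k < d) dot (v k) (T k (y n)))).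
    by move=> n; rewrite h1.
  by apply: tends_sum => k; apply: tends_dotr.
rewrite -(Re_dotxx hdot) -h2 Re_sum.
by apply: eq_bigr => k _; rewrite (Re_dotxx hdot).
Qed.

Let polar_data_orth x p v : polar_data x p v -> dot (x - p) p = 0.
Proof.
move=> [h1 [y [hy _]]]; apply: (tends_unique (tends_dotr hdot _ hy)).
apply: (tends_eq (u := fun=> 0)); last exact: tends_const.
by move=> n; rewrite h1.
Qed.

Let polar_data0 p v : polar_data 0 p v -> p = 0 /\ v = fun=> 0.
Proof.
move=> h; have := polar_data_orth h; rewrite sub0r dotNl => /eqP.
rewrite oppr_eq0 (dotxx hdot) => /eqP /complexI /eqP; rewrite sqrf_eq0 => /eqP /nrm0_eq0 p0.
split => //; have := polar_data_norm h; rewrite p0 nrm0 expr0n /= => /eqP.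
rewrite psumr_eq0; last by move=> *; rewrite sqr_ge0.
move=> /allP hv; apply/funext => k; apply/nrm0_eq0/eqP.
by rewrite -sqrf_eq0; apply: hv; rewrite mem_index_enum.
Qed.

(** The difference of two data belongs to the vector 0, and then its [p] is orthogonal to itself.
    Uniqueness is what makes the partial isometry linear. *)
Let polar_data_uniq x p v p' v' : polar_data x p v -> polar_data x p' v' ->
  p = p' /\ v = v'.
Proof.
move=> h1 h2; have := polar_data_lin (-1) h1 h2.
rewrite scaleN1r addNr => /polar_data0[hp hv]; split.
  by apply/eqP; rewrite eq_sym -subr_eq0 addrC -scaleN1r hp.
apply/funext => k; have := congr1 (fun f => f k) hv => /= {}hv.
by apply/eqP; rewrite eq_sym -subr_eq0 addrC -scaleN1r hv.
Qed.

Let polar_data_range z : polar_data (P z) (P z) (fun k => T k z).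
Proof.
split; first by move=> m; rewrite subrr dot0l.
by exists (fun=> z); split => [|k]; exact: tends_const.
Qed.

Let polar_data_ker z : P z = 0 -> polar_data z 0 (fun=> 0).
Proof.
move=> h; split; first by move=> m; rewrite subr0 -polar_modulus_sa h dot0l.
by exists (fun=> 0); split => [|k]; rewrite linear0; exact: tends_const.
Qed.

Let polar_data_le x p v : polar_data x p v -> nrm p <= nrm x.
Proof.
move=> h; rewrite -(ler_pXn2r (n := 2)) ?nnegrE ?nrm_ge0 //.
rewrite -[in leRHS](subrK p x) (nrm_addsq hdot) (polar_data_orth h) /=.
by rewrite mulr0 addr0 lerDr sqr_ge0.
Qed.

Lemma polar_partP : is_polar_part dot T (polar_part dot T).
Proof.
have [pv hpv] := choice polar_data_ex.
pose V k x := (pv x).2 k.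
have Vl k : linear (V k).
  move=> a x y; rewrite /V.
  by have [_ ->] := polar_data_uniq (hpv (a *: x + y)) (polar_data_lin a (hpv x) (hpv y)).
pose W k := linear_of (Vl k).
have Wk k x : nrm (W k x) <= nrm x.
  apply: le_trans (polar_data_le (hpv x)).
  rewrite -(ler_pXn2r (n := 2)) ?nnegrE ?nrm_ge0 // -(polar_data_norm (hpv x)).
  by rewrite (bigD1 k) //= lerDl sumr_ge0 // => i _; rewrite sqr_ge0.
have kerW x : P x = 0 -> forall k, W k x = 0.
  by move=> /polar_data_ker/(polar_data_uniq (hpv x))[_ h] k; rewrite /= /V h.
apply: (@getPex _ (is_polar_part dot T)); exists W; split.
- by move=> k; apply/bounded_opP; exists 1 => // x; rewrite mul1r.
- move=> x hx.
  have [h1 _] := hpv x; have h2 := polar_data_orth (hpv x).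
  (* The vector [x - p] lies in the kernel of [P], hence in the joint kernel, to which [x] is
     orthogonal; therefore [x = p]. *)
  have Pxp : P (x - (pv x).1) = 0.
    apply: nrm0_eq0; apply/eqP; rewrite -sqrf_eq0 -(Re_dotxx hdot).
    by rewrite polar_modulus_sa h1.
  have := hx _ (kerW _ Pxp).
  have -> : dot x (x - (pv x).1) = dot (x - (pv x).1) (x - (pv x).1).
    by rewrite [in RHS]dotBl (dotC _ (pv x).1) h2 conjE conjc0 subr0.
  rewrite (dotxx hdot) => /complexI /eqP; rewrite sqrf_eq0 => /eqP /nrm0_eq0 /eqP.
  rewrite subr_eq0 => /eqP xE.
  rewrite /l2norm; under eq_bigr do rewrite -/(nrm _).
  rewrite [\sum_(k < d) _](polar_data_norm (hpv x)) -xE sqrtr_sqr ger0_norm ?nrm_ge0 //.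
- apply/seteqP; split => x /=; last exact: kerW.
  move=> hx; have := polar_data_norm (hpv x).
  rewrite big1; last by move=> k _; rewrite [(pv x).2 k]hx nrm0 expr0n.
  move=> /esym/eqP; rewrite sqrf_eq0 => /eqP /nrm0_eq0 p0.
  have [h1 _] := hpv x; apply: (dot_eq0P hdot) => y.
  by rewrite polar_modulus_sa; have := h1 y; rewrite p0 subr0.
move=> k x; rewrite /= /V.
by have [_ ->] := polar_data_uniq (hpv (P x)) (polar_data_range x).
Qed.

End PolarDecomposition.

(** * Effect of one Aluthge transform on the word sums *)

Section AluthgeStep.
Context (R : realType) (H : completeNormedModType R[i]).
Context (dot : {dot H for Num.conj}) (hdot : hilbert_dot dot).
Context (d : nat) (T : 'I_d -> {linear H -> H}).
Hypothesis bT : forall k, bounded_op (T k).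
Local Notation P := (polar_modulus dot T).
Local Notation V := (polar_part dot T).
Local Notation S := (sqrt_op dot P).
Local Notation That := (spherical_aluthge dot T).

Lemma sqrt_polar_modulusP : [/\ bounded_op S, forall x y, dot (S x) y = dot x (S y)
  & forall x, S (S x) = P x].
Proof.
have [bP pP _] := polar_modulusP hdot bT.
have [/bounded_opP bS pS SS] := sqrt_opP hdot bP pP.
by split => //; exact: positive_selfadjoint.
Qed.

Lemma bounded_polar_part k : bounded_op (V k).
Proof. by have [h _ _ _] := polar_partP hdot bT; apply/bounded_opP/h. Qed.

Lemma polar_part_modulus k x : V k (P x) = T k x.
Proof. by have [_ _ _ ->] := polar_partP hdot bT. Qed.

(** Derived from the defining properties of the polar part: [x] is split along the closure of the
    joint kernel, where [V] vanishes by continuity. *)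
Lemma polar_part_contraction x : \sum_(k < d) nrm (V k x) ^+ 2 <= nrm x ^+ 2.
Proof.
have [_ iV _ _] := polar_partP hdot bT.
have [||p [cp op]] := @orthogonal_projection R H dot hdot (joint_kernel V) x.
- by move=> k; rewrite linear0.
- by move=> a y z hy hz k; rewrite linearP hy hz scaler0 addr0.
have Vp k : V k p = 0.
  apply: nrm0_eq0; apply/eqP; rewrite eq_le nrm_ge0 andbT.
  have [C C0 hC] := bounded_polar_part k.
  apply: le_of_le_add => e e0; rewrite add0r.
  have [m hm hpm] := cp _ (divr_gt0 e0 C0).
  rewrite -[V k p]subr0 -(hm k) -linearB (le_trans (hC _)) //.
  by rewrite mulrC -ler_pdivlMr.
have := iV (x - p); rewrite /l2norm => /(_ op) h.
have : \sum_(k < d) nrm (V k x) ^+ 2 = nrm (x - p) ^+ 2.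
  rewrite /nrm -h sqr_sqrtr ?sumr_ge0 // => [|k _]; last by rewrite sqr_ge0.
  by apply: eq_bigr => k _; rewrite linearB Vp subr0.
move=> ->; have o : dot (x - p) p = 0 by apply: op => k.
have := nrm_addsq hdot (x - p) p; rewrite subrK o /= mulr0 addr0 => ->.
by rewrite lerDl sqr_ge0.
Qed.

Lemma bounded_spherical_aluthge k : bounded_op (That k).
Proof.
have [[C C0 hC] _ _] := sqrt_polar_modulusP.
have [D D0 hD] := bounded_polar_part k.
exists (C * (D * C)); first by rewrite !mulr_gt0.
move=> x /=; rewrite (le_trans (hC _)) // -!mulrA ler_wpM2l ?(ltW C0) //.
by rewrite (le_trans (hD _)) // ler_wpM2l ?(ltW D0).
Qed.

(** [S] intertwines the two tuples: [That k (S x) = S (V k (P x)) = S (T k x)]. *)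
Lemma word_normsq_aluthge n x :
  word_normsq That n (S x) = word_sum T (fun y => nrm (S y) ^+ 2) n x.
Proof.
have [_ _ SS] := sqrt_polar_modulusP.
elim: n x => [//|n IHn] x; rewrite /word_normsq /=.
by apply: eq_bigr => k _; rewrite SS polar_part_modulus [LHS]IHn.
Qed.

Lemma word_normsqSr n x :
  word_normsq T n.+1 x = word_sum T (fun y => nrm (P y) ^+ 2) n x.
Proof.
rewrite [LHS](word_sum_add T _ 1 n).
by apply: word_sum_eq => y; rewrite nrm_polar_modulus.
Qed.

(** The last letter of a word is absorbed into [P = S S], one factor of which is estimated by a
    constant. *)
Lemma word_normsq_le_aluthge : exists2 C : R, 0 < C &
  forall n x, word_normsq T n.+1 x <= C * word_normsq That n (S x).
Proof.
have [[C C0 hC] _ SS] := sqrt_polar_modulusP.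
exists (C ^+ 2); first by rewrite exprn_gt0.
move=> n x; rewrite word_normsqSr word_normsq_aluthge -word_sumM.
apply: word_sum_le => y; rewrite -SS -exprMn.
by rewrite ler_pXn2r ?nnegrE ?nrm_ge0 // mulr_ge0 ?nrm_ge0 // ltW.
Qed.

(** Formally [Z] is the sum of [(T_w V_k)^* P T_w V_k] over [k] and the words [w] of length [n].
    Then [S Z S] has the quadratic form [word_normsq That n.+1], while [Z P] is bounded by
    [sqrt a sqrt b] because [V k (P u) = T k u]. As [P = S S], [heinz] transfers this bound to
    [S Z S]. *)
Lemma spherical_aluthge_step n (a b : R) : 0 <= a -> 0 <= b ->
  (forall x, word_normsq T n.+2 x <= a * nrm x ^+ 2) ->
  (forall x, word_normsq T n x <= b * nrm x ^+ 2) ->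
  forall x, word_normsq That n.+1 x <= Num.sqrt a * Num.sqrt b * nrm x ^+ 2.
Proof.
move=> a0 b0 hA hB x.
have [bS saS SS] := sqrt_polar_modulusP.
have saP := polar_modulus_sa hdot bT.
pose phi y z := dot (P y) z.
pose e y z := \sum_(k < d) word_form T phi n (V k y) (V k z).
(* The factor [P] goes to the first vector only, where it counts as one more letter; hence the
   lengths [n.+1] and [n]. *)
have e_le y z : nrm (e y z) <=
    Num.sqrt (\sum_(k < d) word_normsq T n.+1 (V k y)) *
    Num.sqrt (\sum_(k < d) word_normsq T n (V k z)).
  rewrite (le_trans (nrm_sum _ _ _)) //.
  rewrite (le_trans _ (sum_sqrt_le _ _ _)) // => [|k|k]; try exact: word_normsq_ge0.
  apply: ler_sum => k _; rewrite word_normsqSr.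
  apply: word_form_cauchy => [u|u|u v]; rewrite ?sqr_ge0 //.
  by rewrite !sqrtr_sqr !ger0_norm ?nrm_ge0 // cauchy_schwarz.
have e_r z : Num.sqrt (\sum_(k < d) word_normsq T n (V k z)) <= Num.sqrt b * nrm z.
  rewrite -[nrm z]ger0_norm ?nrm_ge0 // -sqrtr_sqr -sqrtrM // ler_sqrt.
    rewrite (le_trans _ (ler_wpM2l b0 (polar_part_contraction z))) //.
    by rewrite mulr_sumr; apply: ler_sum => k _.
  by rewrite mulr_ge0 ?sqr_ge0.
have phil c u v w : phi (c *: u + v) w = c * phi u w + phi v w.
  by rewrite /phi linearP dotDl dotZl.
have phir c u v w : phi w (c *: u + v) = c^* * phi w u + phi w v.
  by rewrite /phi dotDr dotZr.
have phiC u v : phi u v = (phi v u)^* by rewrite /phi saP dotC.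
(* A crude bound, sufficient for the existence of [Z]. *)
have [C C0 hC] := word_normsq_bound bT n.+1.
have [|||Z [bZ hZ]] := @form_rep R H dot hdot e (Num.sqrt C * Num.sqrt b).
- move=> c u v w; rewrite /e mulr_sumr -big_split; apply: eq_bigr => k _ /=.
  by rewrite linearP word_form_linl.
- move=> c u v w; rewrite /e mulr_sumr -big_split; apply: eq_bigr => k _ /=.
  by rewrite linearP word_form_linr.
- move=> u v; rewrite (le_trans (e_le _ _)) //.
  rewrite [leRHS](_ : _ = (Num.sqrt C * nrm u) * (Num.sqrt b * nrm v)); last by ring.
  rewrite ler_pM ?sqrtr_ge0 //.
  rewrite -[nrm u]ger0_norm ?nrm_ge0 // -sqrtr_sqr -sqrtrM ?(ltW C0) // ler_sqrt.
    rewrite (le_trans _ (ler_wpM2l (ltW C0) (polar_part_contraction u))) //.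
    by rewrite mulr_sumr; apply: ler_sum => k _.
  by rewrite mulr_ge0 ?sqr_ge0 // ltW.
have eC u v : e u v = (e v u)^*.
  by rewrite /e rmorph_sum; apply: eq_bigr => k _; apply: word_formC.
have saZ u v : dot (Z u) v = dot u (Z v).
  by rewrite -hZ (dotC dot (Z u)) -hZ -eC.
pose K := Num.sqrt a * Num.sqrt b.
have K0 : 0 <= K by rewrite mulr_ge0 ?sqrtr_ge0.
have hK u : nrm (Z (S (S u))) <= K * nrm u.
  rewrite SS; have [->|] := eqVneq (Z (P u)) 0.
    by rewrite nrm0 mulr_ge0 ?nrm_ge0.
  rewrite -nrm_gt0 => h; rewrite -(ler_pM2r h) -expr2 -(Re_dotxx hdot).
  rewrite (le_trans (Re_le_nrm _)) // -hZ eC nrm_conj (le_trans (e_le _ _)) //.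
  rewrite [leRHS](_ : _ = (Num.sqrt a * nrm u) * (Num.sqrt b * nrm (Z (P u)))).
    2: by rewrite /K; ring.
  rewrite ler_pM ?sqrtr_ge0 //.
  rewrite -[nrm u]ger0_norm ?nrm_ge0 // -sqrtr_sqr -sqrtrM // ler_sqrt.
    by under eq_bigr do rewrite polar_part_modulus; exact: hA.
  by rewrite mulr_ge0 ?sqr_ge0.
have := heinz hdot bS bZ saS saZ K0 hK x.
have -> : word_normsq That n.+1 x = complex.Re (dot x (S (Z (S x)))).
  rewrite -saS -hZ /e Re_sum; apply: eq_bigr => k _.
  rewrite Re_word_form /= [LHS]word_normsq_aluthge.
  by apply: word_sum_eq => y; rewrite /phi -SS saS (Re_dotxx hdot).
move=> h; rewrite (le_trans (Re_dot_le hdot _ _)) // mulrC expr2 mulrA.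
by rewrite ler_wpM2r ?nrm_ge0.
Qed.

End AluthgeStep.

(** * Iterated Aluthge transforms *)

Section Survival.
Context (R : realType).

(* Probability that the simple random walk on [nat] started at [m] and absorbed
   at 0 is not absorbed after [n] steps. *)
Fixpoint survival (n m : nat) : R :=
  match m, n with
  | 0, _ => 0
  | _.+1, 0 => 1
  | m'.+1, n'.+1 => (survival n' m.+1 + survival n' m') / 2
  end.

Lemma survival0 n : survival n 0 = 0. Proof. by case: n. Qed.

Lemma survivalS n m : survival n.+1 m.+1 = (survival n m.+2 + survival n m) / 2.
Proof. by []. Qed.

Lemma survival_itv n m : 0 <= survival n m <= 1.
Proof.
elim: n m => [|n IHn] [|m]; rewrite ?survival0 ?lexx ?ler01 //.
rewrite survivalS; have := IHn m; have := IHn m.+2.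
by move=> /andP[? ?] /andP[? ?]; apply/andP; split; lra.
Qed.

Lemma survival_nonincreasing n m : survival n.+1 m <= survival n m.
Proof.
elim: n m => [|n IHn] [|m]; rewrite ?survival0 //.
  rewrite survivalS; have /andP[_ ?] := survival_itv 0 m.+2.
  have /andP[_ ?] := survival_itv 0 m; rewrite [leRHS]/=; lra.
by rewrite (survivalS n.+1 m) (survivalS n m); have := IHn m.+2; have := IHn m; lra.
Qed.

(** The pointwise limit [L] is harmonic on the positive integers with [L 0 = 0], so it is linear;
    being bounded by 1, it vanishes. *)
Lemma survival_cvg0 : survival n 1 @[n --> \oo] --> 0.
Proof.
pose L m := lim (survival n m @[n --> \oo]).
have cL m : survival n m @[n --> \oo] --> L m.
  apply: nonincreasing_is_cvgn.
    by apply/nonincreasing_seqP => n; exact: survival_nonincreasing.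
  by exists 0 => _ [n _ <-]; have /andP[] := survival_itv n m.
have L0 : L 0%N = 0.
  apply: (cvg_unique _ (cL 0%N)) => //.
  have -> : survival^~ 0%N = fun=> 0 :> R by apply/funext => n; rewrite survival0.
  exact: cvg_cst.
have LS m : L m.+1 = (L m.+2 + L m) / 2.
  have h : survival n.+1 m.+1 @[n --> \oo] --> L m.+1.
    by have := cL m.+1; rewrite -[X in X -> _](cvg_shiftS (survival^~ m.+1)).
  apply: (cvg_unique _ h) => //.
  by apply: cvgMl; apply: cvgD.
have Lm m : L m = m%:R * L 1%N /\ L m.+1 = m.+1%:R * L 1%N.
  elim: m => [|m [h1 h2]]; first by rewrite L0 mul0r mul1r.
  split => //; have := LS m; rewrite h1 h2.
  rewrite -[m.+2%:R]natr1 -[m.+1%:R]natr1 => h; nra.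
have L1 : 0 <= L 1%N.
  by apply: limr_ge; [exact: cL|near=> n; have /andP[] := survival_itv n 1].
have Lle m : m%:R * L 1%N <= 1.
  rewrite -(Lm m).1; apply: limr_le; first exact: cL.
  by near=> n; have /andP[] := survival_itv n m.
suff <- : L 1%N = 0 by exact: cL.
apply/eqP; rewrite eq_le L1 andbT leNgt; apply/negP => Lp.
have := Lle (Num.truncn (L 1%N)^-1).+1; apply/negP; rewrite -ltNge.
by rewrite -ltr_pdivrMr // mul1r truncnS_gt.
Unshelve. all: by end_near. Qed.

End Survival.

(** Sets without a supremum are covered, as [sup] is then 0 by convention. *)
Lemma sup_nneg (R : realType) (A : set R) : (forall a, A a -> 0 <= a) -> 0 <= sup A.
Proof.
move=> A0; have [hA|/sup_out->//] := pselect (has_sup A).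
have [[a Aa] ubA] := hA.
exact: le_trans (A0 a Aa) (ub_le_sup ubA Aa).
Qed.

(** * Admissible numbers and the limit of the joint norms *)

Section Growth.
Context (R : realType) (H : completeNormedModType R[i]).
Context (dot : {dot H for Num.conj}) (hdot : hilbert_dot dot).
Context (d : nat).
Implicit Types (T : 'I_d -> {linear H -> H}) (s : R).

(** [growth_le T (t ^+ 2)] says that [t] is admissible. No sign is imposed on [K], hence the
    passages to its absolute value. *)
Definition growth_le T s := exists K : R,
  forall n x, word_normsq T n x <= K * s ^+ n * nrm x ^+ 2.

Lemma joint_norm_le T (c : R) : 0 <= c ->
  (forall x, word_normsq T 1 x <= c ^+ 2 * nrm x ^+ 2) -> joint_norm T <= c.
Proof.
move=> c0 h; rewrite /joint_norm; set A := [set _ | _ in _].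
(* If [H] is trivial there are no unit vectors, and the supremum of the empty set is 0. *)
have [->|/set0P A0] := eqVneq A set0; first by rewrite sup0.
apply: ge_sup => // _ [x /= x1 <-]; rewrite /l2norm.
rewrite -[c]ger0_norm // -sqrtr_sqr ler_sqrt ?sqr_ge0 //.
by have := h x; rewrite (_ : nrm x = 1) ?expr1n ?mulr1 // /nrm x1.
Qed.

Lemma joint_norm_ge0 T : 0 <= joint_norm T.
Proof.
by apply: sup_nneg => _ [x _ <-]; exact: sqrtr_ge0.
Qed.

Lemma word_normsq1_le T x : (forall k, bounded_op (T k)) ->
  word_normsq T 1 x <= joint_norm T ^+ 2 * nrm x ^+ 2.
Proof.
move=> bT; have [->|x0] := eqVneq x 0.
  rewrite nrm0 expr0n mulr0 /word_normsq /= big1 // => k _.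
  by rewrite linear0 nrm0 expr0n.
have nx : 0 < nrm x by rewrite nrm_gt0.
have [C C0 hC] := word_normsq_bound bT 1.
pose y := ((nrm x)^-1)%:C *: x.
have y1 : nrm y = 1.
  by rewrite nrmZ nrmr gtr0_norm ?invr_gt0 // mulVf // gt_eqF.
have xE : x = (nrm x)%:C *: y.
  by rewrite scalerA -rmorphM /= divff ?gt_eqF // scale1r.
have hy : l2norm (fun k => T k y) <= joint_norm T.
  apply: ub_le_sup; last by exists y => //=; rewrite nrmE y1.
  exists (Num.sqrt C) => _ [z /= z1 <-]; rewrite ler_sqrt ?(ltW C0) //.
  by have := hC z; rewrite (_ : nrm z = 1) ?expr1n ?mulr1 // /nrm z1.
have -> : word_normsq T 1 x = nrm x ^+ 2 * word_normsq T 1 y.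
  rewrite /word_normsq /= mulr_sumr; apply: eq_bigr => k _.
  by rewrite [in LHS]xE linearZ nrmZ nrmr ger0_norm ?nrm_ge0 // exprMn.
rewrite mulrC ler_wpM2r ?sqr_ge0 //.
rewrite -[leLHS]sqr_sqrtr ?word_normsq_ge0 // ler_pXn2r ?nnegrE ?sqrtr_ge0 //.
exact: joint_norm_ge0.
Qed.

Lemma growth_joint_norm T : (forall k, bounded_op (T k)) ->
  forall n x, word_normsq T n x <= (joint_norm T ^+ 2) ^+ n * nrm x ^+ 2.
Proof.
move=> bT; elim=> [|n IHn] x; first by rewrite expr0 mul1r.
rewrite exprSr -mulrA.
have := ler_wpM2l (exprn_ge0 n (sqr_ge0 (joint_norm T))) (word_normsq1_le x bT).
apply: le_trans; rewrite /word_normsq /= mulr_sumr.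
by apply: ler_sum => k _; apply: IHn.
Qed.

Lemma growth_le_aluthge T s : (forall k, bounded_op (T k)) -> 0 < s ->
  growth_le (spherical_aluthge dot T) s -> growth_le T s.
Proof.
move=> bT s0 [K hK].
have [[A A0 hA] _ _] := sqrt_polar_modulusP hdot bT.
have [C C0 hC] := word_normsq_le_aluthge hdot bT.
have D0 : 0 <= C * `|K| * A ^+ 2 / s.
  rewrite divr_ge0 ?(ltW s0) // mulr_ge0 ?sqr_ge0 // mulr_ge0 ?(ltW C0) //.
(* The summand 1 serves [n = 0]; dividing by [s] makes up for the different lengths [n.+1] and [n]
   in [hC]. *)
exists (1 + C * `|K| * A ^+ 2 / s) => n x.
case: n => [|n].
  by rewrite expr0 mulr1 /word_normsq /= mulrDl mul1r lerDl mulr_ge0 ?sqr_ge0.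
rewrite mulrDl mulrDl mul1r ler_wpDl ?mulr_ge0 ?exprn_ge0 ?nrm_ge0 ?(ltW s0) //.
have hS : nrm (sqrt_op dot (polar_modulus dot T) x) ^+ 2 <= A ^+ 2 * nrm x ^+ 2.
  rewrite -exprMn ler_pXn2r ?nnegrE ?nrm_ge0 //.
  by rewrite mulr_ge0 ?nrm_ge0 // ltW.
rewrite (le_trans (hC _ _)) //.
rewrite [leRHS](_ : _ = C * (`|K| * s ^+ n * (A ^+ 2 * nrm x ^+ 2))); last first.
  by rewrite (exprS s n); field; rewrite gt_eqF.
rewrite ler_wpM2l ?(ltW C0) // (le_trans (hK _ _)) //.
apply: (@le_trans _ _ (`|K| * s ^+ n * nrm (sqrt_op dot (polar_modulus dot T) x) ^+ 2)).
  by rewrite ler_wpM2r ?sqr_ge0 // ler_wpM2r ?exprn_ge0 ?(ltW s0) // ler_norm.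
by rewrite ler_wpM2l // mulr_ge0 ?exprn_ge0 ?(ltW s0).
Qed.

Lemma bounded_iter_aluthge T n : (forall k, bounded_op (T k)) ->
  forall k, bounded_op (iter n (spherical_aluthge dot) T k).
Proof.
by move=> bT; elim: n => [//|n IHn] k; rewrite iterS; apply: bounded_spherical_aluthge.
Qed.

Lemma growth_le_iter_aluthge T s n : (forall k, bounded_op (T k)) -> 0 < s ->
  growth_le (iter n (spherical_aluthge dot) T) s -> growth_le T s.
Proof.
move=> bT s0; elim: n => [//|n IHn]; rewrite iterS.
by move=> /growth_le_aluthge h; apply: IHn; apply: h => // k; apply: bounded_iter_aluthge.
Qed.

(* The bounds for the iterates evolve by [a_(n+1, m) <= sqrt (a_(n, m+1) a_(n, m-1))],
   a random walk on the exponents which is stopped at [m = 0], where the bound is 1. *)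
Lemma iter_aluthge_bound T (K s : R) : (forall k, bounded_op (T k)) -> 0 < s -> 0 <= K ->
  (forall n x, word_normsq T n x <= K * s ^+ n * nrm x ^+ 2) ->
  forall n m x, word_normsq (iter n (spherical_aluthge dot) T) m x <=
    expR (K * survival R n m) * s ^+ m * nrm x ^+ 2.
Proof.
move=> bT s0 K0 hK; elim=> [|n IHn] [|m] x.
- by rewrite survival0 mulr0 expR0 mul1r expr0 mul1r.
- rewrite (le_trans (hK _ _)) // ler_wpM2r ?sqr_ge0 //.
  rewrite ler_wpM2r ?exprn_ge0 ?(ltW s0) //= mulr1.
  (* From [K <= 1 + K <= expR K]: the exponent [K] stands in for [ln K] and also covers [K = 0]. *)
  by rewrite (le_trans _ (expR_ge1Dx K)) // lerDr.
- by rewrite survival0 mulr0 expR0 mul1r expr0 mul1r.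
pose b j := expR (K * survival R n j) * s ^+ j.
have b0 j : 0 <= b j by rewrite mulr_ge0 ?expR_ge0 ?exprn_ge0 ?(ltW s0).
rewrite iterS (le_trans (@spherical_aluthge_step _ _ _ hdot _ _ _ m (b m.+2) (b m) _ _ _ _ x)) //.
  exact: bounded_iter_aluthge.
rewrite ler_wpM2r ?sqr_ge0 // -sqrtrM //.
set c := leRHS.
have c0 : 0 <= c by rewrite mulr_ge0 ?expR_ge0 ?exprn_ge0 ?(ltW s0).
rewrite -[leRHS]ger0_norm // -sqrtr_sqr ler_sqrt ?sqr_ge0 //.
rewrite /b /c exprMn -expRM_natl survivalS.
rewrite mulrACA -expRD -exprD -exprM -mulrDr.
rewrite [(m.+1 * 2)%N](_ : _ = (m.+2 + m)%N); last by rewrite muln2 -addnn addnS.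
by rewrite [2 * _](_ : _ = K * (survival R n m.+2 + survival R n m)) //; field.
Qed.

(** The joint norm of an iterate, enlarged by any [e > 0], is admissible for that iterate, hence for
    [T]; so no iterate has norm below [r]. The upper bound is [iter_aluthge_bound] at [m = 1]. *)
Lemma joint_norm_iter_aluthge_cvg T (r : R) : (forall k, bounded_op (T k)) -> 0 <= r ->
  (forall t, r < t -> growth_le T (t ^+ 2)) ->
  (forall t, 0 < t -> growth_le T (t ^+ 2) -> r <= t) ->
  joint_norm (iter n (spherical_aluthge dot) T) @[n --> \oo] --> r.
Proof.
move=> bT r0 hup hlow.
have low n : r <= joint_norm (iter n (spherical_aluthge dot) T).
  have bTn := bounded_iter_aluthge n bT.
  set M := joint_norm _; have M0 : 0 <= M := joint_norm_ge0 _.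
  apply: le_of_le_add => e e0; apply: hlow; first lra.
  apply: (@growth_le_iter_aluthge _ _ n) => //; first by rewrite exprn_gt0 //; lra.
  exists 1 => j x; rewrite mul1r (le_trans (growth_joint_norm bTn _ _)) //.
  rewrite ler_wpM2r ?sqr_ge0 // lerXn2r ?nnegrE ?sqr_ge0 //.
  by rewrite -/M lerXn2r ?nnegrE ?addr_ge0 ?lerDl ?(ltW e0).
apply/cvgrPdist_le => e e0.
pose t := r + e / 2; have t0 : 0 < t by rewrite /t; lra.
have [K hK] : growth_le T (t ^+ 2) by apply: hup; rewrite /t; lra.
have hK' n x : word_normsq T n x <= `|K| * (t ^+ 2) ^+ n * nrm x ^+ 2.
  rewrite (le_trans (hK n x)) // ler_wpM2r ?sqr_ge0 //.
  exact: ler_wpM2r (exprn_ge0 n (sqr_ge0 t)) _ _ (ler_norm K).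
have hb := iter_aluthge_bound bT (exprn_gt0 2 t0) (normr_ge0 K) hK'.
(* The margin between [t] and [r + e] on a logarithmic scale; it is doubled below because the word
   sums contain squares. *)
pose del := ln ((r + e) / t).
have d1 : 1 < (r + e) / t by rewrite ltr_pdivlMr // mul1r /t; lra.
have del0 : 0 < del by rewrite ln_gt0.
have K1 : 0 < `|K| + 1 by rewrite ltr_wpDl.
have /cvgrPdist_le /(_ (2 * del / (`|K| + 1))) := @survival_cvg0 R.
move=> /(_ ltac:(by rewrite divr_gt0 // mulr_gt0)) [N _ hN].
exists N => // n /hN /=; rewrite sub0r normrN.
have /andP[q0 _] := survival_itv R n 1; rewrite ger0_norm // => hq.
rewrite distrC ger0_norm ?subr_ge0 ?low // lerBlDl.
have -> : r + e = expR del * t by rewrite /del lnK ?posrE ?divfK ?gt_eqF // divr_gt0 //; lra.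
apply: joint_norm_le; first by rewrite mulr_ge0 ?expR_ge0 ?(ltW t0).
move=> x; rewrite (le_trans (hb n 1%N x)) // ler_wpM2r ?sqr_ge0 //.
rewrite (exprMn 2 (expR del) t).
apply: (ler_wpM2r (sqr_ge0 t)).
rewrite  -expRM_natl ler_expR.
have : (`|K| + 1) * survival R n 1 <= 2 * del by rewrite mulrC -ler_pdivlMr.
by rewrite mulrDl mul1r; apply: le_trans; rewrite lerDl.
Qed.

End Growth.

(** * Neumann series *)

Section Neumann.
Context (R : realType) (H : completeNormedModType R[i]).

Lemma exprn_small (th e : R) : 0 <= th < 1 -> 0 < e ->
  exists N, forall n, (N <= n)%N -> th ^+ n <= e.
Proof.
move=> /andP[th0 th1] e0.
have h : `|th| < 1 by rewrite ger0_norm.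
have /cvgrPdist_le /(_ e e0) [N _ hN] := cvg_expr h.
exists N => n /hN /=; rewrite sub0r normrN ger0_norm ?exprn_ge0 //.
Qed.

Lemma iterB (C : {linear H -> H}) n x y : iter n C (x - y) = iter n C x - iter n C y.
Proof. by elim: n => [//|n IHn]; rewrite !iterS IHn linearB. Qed.

Lemma iterP (C : {linear H -> H}) n a x y :
  iter n C (a *: x + y) = a *: iter n C x + iter n C y.
Proof. by elim: n => [//|n IHn]; rewrite !iterS IHn linearP. Qed.

Lemma iter_scale (A : {linear H -> H}) (a : R[i]) n x :
  iter n A (a *: x) = a *: iter n A x.
Proof. by elim: n => [//|n IHn]; rewrite !iterS IHn linearZ. Qed.

Lemma iter_comm (A C : {linear H -> H}) n x : (forall x, A (C x) = C (A x)) ->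
  A (iter n C x) = iter n C (A x).
Proof. by move=> h; elim: n => [//|n IHn]; rewrite !iterS h IHn. Qed.

(** The powers of [C] decay geometrically although [C] itself may have norm above 1. Commutation
    with [A] passes from the partial sums to [G]; the Koszul homotopy will require it. *)
Lemma neumann (C : {linear H -> H}) (K th : R) : bounded_op C -> 0 <= th < 1 ->
  (forall n x, nrm (iter n C x) <= K * th ^+ n * nrm x) ->
  exists G : {linear H -> H}, [/\ forall x, G (x - C x) = x,
    forall x, G x - C (G x) = x &
    forall A : {linear H -> H}, bounded_op A -> (forall x, A (C x) = C (A x)) ->
      forall x, A (G x) = G (A x)].
Proof.
move=> bC /[dup] hth /andP[th0 th1] hC.
pose u n x := \sum_(i < n) iter i C x.
have hu x n k : nrm (u (n + k)%N x - u n x) <= K * nrm x / (1 - th) * (th ^+ n - th ^+ (n + k)).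
  elim: k => [|k IHk]; first by rewrite addn0 !subrr nrm0 mulr0.
  have -> : u (n + k.+1)%N x - u n x = (u (n + k)%N x - u n x) + iter (n + k) C x.
    by rewrite addnS /u big_ord_recr /= addrAC.
  rewrite (le_trans (nrmD _ _)) //.
  rewrite [leRHS](_ : _ = K * nrm x / (1 - th) * (th ^+ n - th ^+ (n + k)) +
     K * th ^+ (n + k) * nrm x); last first.
    by rewrite addnS (exprS th (n + k)); field; rewrite gt_eqF // subr_gt0.
  by apply: lerD.
have ex x : exists l, tends (fun n => u n x) l.
  apply: nrm_complete => e e0.
  pose c := `|K| * nrm x / (1 - th) + 1.
  have c0 : 0 < c by rewrite ltr_wpDl // divr_ge0 ?mulr_ge0 ?nrm_ge0 // subr_ge0 ltW.
  have [N hN] := exprn_small hth (divr_gt0 e0 c0).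
  exists N => m n.
  wlog mn : m n / (n <= m)%N.
    move=> h; case: (leqP n m) => [/h //|/ltnW nm] Nm Nn.
    by rewrite nrmBC; apply: h.
  move=> _ /hN; rewrite ler_pdivlMr // => h.
  rewrite -(subnKC mn) (le_trans (hu _ _ _)) // (le_trans _ h) // mulrC.
  apply: (@le_trans _ _ ((th ^+ n - th ^+ (n + (m - n))) * c)).
    rewrite ler_wpM2l //; last first.
      rewrite /c ler_wpDr // ler_wpM2r ?invr_ge0 ?subr_ge0 ?(ltW th1) //.
      by rewrite ler_wpM2r ?nrm_ge0 // ler_norm.
    by rewrite subr_ge0 ler_wiXn2l ?leq_addr // ltW.
  by rewrite ler_wpM2r ?(ltW c0) // lerBlDr lerDl exprn_ge0.
have [G hG] := choice ex.
have Gl : linear G.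
  move=> a x y; apply: (tends_unique (hG _)).
  apply: (tends_eq (u := fun n => a *: u n x + u n y)).
    by move=> n; rewrite /u scaler_sumr -big_split; apply: eq_bigr => i _; rewrite iterP.
  by apply: tendsD => //; apply: tendsZ.
have GA (A : {linear H -> H}) : bounded_op A -> (forall x, A (C x) = C (A x)) ->
    forall x, A (G x) = G (A x).
  move=> bA AC x; apply: (tends_unique (tends_bounded_op bA (hG x))).
  apply: (tends_eq (u := fun n => u n (A x))); last exact: hG.
  by move=> n; rewrite /u linear_sum; apply: eq_bigr => i _; rewrite iter_comm.
have G1 x : G (x - C x) = x.
  apply: (tends_unique (hG _)).
  have uE n : u n (x - C x) = x - iter n C x.
    elim: n => [|n IHn]; first by rewrite /u big_ord0 subrr.
    rewrite /u big_ord_recr /= -/(u n _) IHn iterB addrA subrK.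
    by rewrite -iterSr iterS.
  apply: (tends_eq (u := fun n => x - iter n C x)); first by move=> n; rewrite uE.
  move=> e e0; pose c := `|K| * nrm x + 1.
  have c0 : 0 < c by rewrite ltr_wpDl // mulr_ge0 ?nrm_ge0.
  have [N hN] := exprn_small hth (divr_gt0 e0 c0).
  exists N => n /hN; rewrite ler_pdivlMr // => h.
  rewrite addrAC subrr sub0r nrmN (le_trans (hC _ _)) // (le_trans _ h) //.
  rewrite mulrAC mulrC ler_wpM2l ?exprn_ge0 // /c ler_wpDr //.
  by rewrite ler_wpM2r ?nrm_ge0 // ler_norm.
exists (linear_of Gl); split => //= x.
have GB y z : G (y - z) = G y - G z by rewrite addrC -scaleN1r Gl scaleN1r addrC.
by rewrite [C (G x)]GA // -[RHS]G1 GB.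
Qed.

End Neumann.

(** * Exactness of Koszul complexes and the Taylor spectrum *)

Section Koszul.
Context (R : realType) (H : completeNormedModType R[i]) (d : nat).
Implicit Types (S : {set 'I_d}) (j k : 'I_d) (f g : {set 'I_d} -> H).

Local Notation below j S := #|[set i in S | (i < j)%N]|.

Lemma below_setU1 j k S : k \notin S ->
  below j (k |: S)%SET = ((k < j)%N + below j S)%N.
Proof.
move=> kS; case: (ltnP k j) => kj /=.
  rewrite (_ : [set i in k |: S | (i < j)%N] = k |: [set i in S | (i < j)%N])%SET.
    by rewrite cardsU1 inE (negPf kS).
  apply/setP => i; rewrite !inE; case: eqP => [->|//] /=; by rewrite kj.
rewrite add0n; apply: eq_card => i; rewrite !inE; case: eqP => [->|//] /=.
by rewrite ltnNge kj andbF.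
Qed.

Lemma below_setD1 j k S : k \in S ->
  below j S = ((k < j)%N + below j (S :\ k)%SET)%N.
Proof. by move=> kS; rewrite -{1}(finset.setD1K kS) below_setU1 // !inE eqxx. Qed.

(** Exchanging the two summations shows that the sum is its own opposite. *)
Lemma sum_antisymmetric S (F : 'I_d -> 'I_d -> H) :
  (forall j k, j \in S -> k \in S -> j != k -> F j k = - F k j) ->
  \sum_(j in S) \sum_(k in (S :\ j)%SET) F j k = 0.
Proof.
move=> hF; set X := LHS.
have : X = - X.
  rewrite {1}/X (exchange_big_dep (mem S)) /=; last first.
    by move=> j k _; rewrite !inE => /andP[].
  rewrite /X -sumrN; apply: eq_bigr => k kS; rewrite -sumrN.
  rewrite (eq_bigl (fun j => j \in (S :\ k)%SET)) => [|j]; last first.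
    by rewrite !inE kS andbT eq_sym andbC.
  by apply: eq_bigr => j; rewrite !inE => /andP[jk jS]; apply: hF.
move=> /eqP; rewrite -addr_eq0 -mulr2n -scaler_nat scaler_eq0 pnatr_eq0 /=.
by move=> /eqP.
Qed.

(** Exactly one of [j < k] and [k < j] holds, so removing the two indices in the opposite order
    changes the total sign. *)
Lemma koszul_diffK (A : 'I_d -> {linear H -> H}) g :
  (forall j k x, A j (A k x) = A k (A j x)) ->
  koszul_diff A (koszul_diff A g) = fun=> 0.
Proof.
move=> AC; apply/funext => S; rewrite /koszul_diff.
under eq_bigr => j _ do rewrite linear_sum scaler_sumr.
apply: sum_antisymmetric => j k jS kS jk.
rewrite !linearZ /= !scalerA AC.
rewrite (_ : (S :\ j) :\ k = (S :\ k) :\ j)%SET; last by rewrite !finset.setDDl finset.setUC.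
rewrite scalerN -scaleNr -!exprD; congr (_ *: _).
rewrite (below_setD1 j kS) (below_setD1 k jS).
have [kj|jk'|/val_inj e] := ltngtP (val k) (val j); last by rewrite e eqxx in jk.
  by rewrite !exprD /= expr0 expr1; ring.
by rewrite !exprD /= expr0 expr1; ring.
Qed.

(** [h] is contraction with the tuple [B]. In the anticommutator the terms with [j != k] cancel; the
    diagonal terms with index in [S] come from the first product and the others from the second. *)
Lemma koszul_homotopy (A B : 'I_d -> {linear H -> H}) f :
  (forall j k x, A j (B k x) = B k (A j x)) ->
  (forall x, \sum_(k < d) B k (A k x) = x) ->
  let h g S := \sum_(k | k \notin S) (-1) ^+ below k S *: B k (g (k |: S)%SET) in
  forall S, koszul_diff A (h f) S + h (koszul_diff A f) S = f S.
Proof.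
move=> AB AB1 h S; rewrite /koszul_diff /h.
have e1 : \sum_(j in S) (-1) ^+ below j S *: A j
      (\sum_(k | k \notin (S :\ j)%SET)
        (-1) ^+ below k (S :\ j)%SET *: B k (f (k |: (S :\ j))%SET)) =
    \sum_(j in S) B j (A j (f S)) +
    \sum_(j in S) \sum_(k | k \notin S) ((-1) ^+ below j S * (-1) ^+ below k (S :\ j)%SET) *:
         A j (B k (f (k |: (S :\ j))%SET)).
  rewrite -big_split; apply: eq_bigr => j jS /=.
  rewrite (bigD1 j) /=; last by rewrite !inE eqxx.
  rewrite linearD linearZ /= scalerDr scalerA finset.setD1K // AB.
  congr (_ + _).
    rewrite -exprD (below_setD1 j jS) ltnn add0n addnn -mul2n exprM sqrrN expr1n.
    by rewrite expr1n scale1r.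
  rewrite linear_sum scaler_sumr; apply: eq_big => [k|k _].
    rewrite !inE negb_and negbK; case: eqP => [->|_] /=; first by rewrite jS.
    by rewrite andbT.
  by rewrite linearZ /= scalerA.
have e2 : \sum_(k | k \notin S) (-1) ^+ below k S *: B k
      (\sum_(j in (k |: S)%SET) (-1) ^+ below j (k |: S)%SET *: A j (f ((k |: S) :\ j)%SET)) =
    \sum_(k | k \notin S) B k (A k (f S)) -
    \sum_(j in S) \sum_(k | k \notin S) ((-1) ^+ below j S * (-1) ^+ below k (S :\ j)%SET) *:
         A j (B k (f (k |: (S :\ j))%SET)).
  rewrite (exchange_big_dep (fun k => k \notin S)) //= -sumrB; apply: eq_bigr => k kS.
  rewrite (bigD1 k) /=; last by rewrite !inE eqxx.
  rewrite linearD linearZ /= scalerDr scalerA (finset.setU1K kS); congr (_ + _).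
    rewrite -exprD (below_setU1 k kS) ltnn add0n addnn -mul2n exprM sqrrN expr1n.
    by rewrite expr1n scale1r.
  rewrite linear_sum scaler_sumr -sumrN; apply: eq_big => [j|j].
    rewrite !inE; case: eqP => [->|_] /=; first by rewrite (negPf kS).
    by rewrite kS.
  rewrite !inE => /andP[jkS jk].
  have jS : j \in S by move: jkS; rewrite (negPf jk).
  rewrite linearZ /= scalerA AB -scaleNr.
  rewrite (_ : (k |: S) :\ j = k |: (S :\ j))%SET; last first.
    rewrite finset.setDUl; congr (_ :|: _)%SET; apply/finset.setDidPl.
    by rewrite disjoints1 inE eq_sym.
  congr (_ *: _); rewrite -!exprD (below_setU1 j kS) (below_setD1 k jS).
  have [kj|jk'|/val_inj e] := ltngtP (val k) (val j); last by rewrite e eqxx in jk.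
    by rewrite !exprD /= expr0 expr1; ring.
  by rewrite !exprD /= expr0 expr1; ring.
rewrite e1 e2 addrACA subrr addr0 -[RHS]AB1.
by rewrite [in RHS](bigID (fun k => k \in S)).
Qed.

Lemma koszul_exact_of_bezout (A B : 'I_d -> {linear H -> H}) :
  (forall j k x, A j (A k x) = A k (A j x)) ->
  (forall j k x, A j (B k x) = B k (A j x)) ->
  (forall x, \sum_(k < d) B k (A k x) = x) -> koszul_exact A.
Proof.
move=> AC AB AB1 p f fp; split => [Df|[g [_ <-]]]; last exact: koszul_diffK.
exists (fun S => \sum_(k | k \notin S) (-1) ^+ below k S *: B k (f (k |: S)%SET)).
split.
  move=> S hS; apply: big1 => k kS; rewrite fp ?linear0 ?scaler0 //.
  by rewrite cardsU1 kS.
apply/funext => S; rewrite -[RHS](koszul_homotopy f AB AB1) Df.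
by rewrite [X in _ + X]big1 ?addr0 // => k _; rewrite linear0 scaler0.
Qed.

End Koszul.

(** * The Taylor spectrum lies below every admissible number *)

Section UpperBound.
Context (R : realType) (H : completeNormedModType R[i]).
Context (d : nat) (T : 'I_d -> {linear H -> H}).
Hypothesis bT : forall k, bounded_op (T k).
Hypothesis cT : commuting_tuple T.

Lemma combination_linear (c : 'I_d -> R[i]) : linear (fun x => \sum_(k < d) c k *: T k x).
Proof.
move=> a x y; rewrite scaler_sumr -big_split; apply: eq_bigr => k _ /=.
by rewrite linearP scalerDr !scalerA mulrC.
Qed.

Definition combination c := linear_of (combination_linear c).

Lemma nrm_sum_scale_le (c : 'I_d -> R[i]) (x : 'I_d -> H) :
  nrm (\sum_(k < d) c k *: x k) ^+ 2 <=
  (\sum_(k < d) nrm (c k) ^+ 2) * \sum_(k < d) nrm (x k) ^+ 2.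
Proof.
have s0 (I : finType) (f : I -> R) : 0 <= \sum_(k : I) f k ^+ 2.
  by apply: sumr_ge0 => k _; rewrite sqr_ge0.
rewrite -[leRHS]sqr_sqrtr ?mulr_ge0 // ler_pXn2r ?nnegrE ?nrm_ge0 ?sqrtr_ge0 //.
rewrite sqrtrM // (le_trans (nrm_sum _ _ _)) //.
have h := @sum_sqrt_le R _ (index_enum 'I_d) (fun k => nrm (c k) ^+ 2)
  (fun k => nrm (x k) ^+ 2) (fun k => sqr_ge0 _) (fun k => sqr_ge0 _).
apply: le_trans h; apply: ler_sum => k _.
by rewrite !sqrtr_sqr !ger0_norm ?nrm_ge0 // nrmZ.
Qed.

Lemma word_normsq_combination (c : 'I_d -> R[i]) (x : 'I_d -> H) n :
  word_normsq T n (\sum_(k < d) c k *: x k) <=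
  (\sum_(k < d) nrm (c k) ^+ 2) * \sum_(k < d) word_normsq T n (x k).
Proof.
elim: n x => [|n IHn] x; first exact: nrm_sum_scale_le.
rewrite {1}/word_normsq /=.
apply: (@le_trans _ _ (\sum_(j < d) (\sum_(k < d) nrm (c k) ^+ 2) *
    \sum_(k < d) word_normsq T n (T j (x k)))).
  apply: ler_sum => j _; rewrite -[word_sum _ _ _ _]/(word_normsq _ _ _).
  rewrite linear_sum; under eq_bigr do rewrite linearZ.
  exact: IHn.
by rewrite -mulr_sumr exchange_big.
Qed.

(** This is how admissibility controls the powers of the combinations [S_c]. *)
Lemma iter_combination_le (c : 'I_d -> R[i]) n x :
  nrm (iter n (combination c) x) ^+ 2 <=
  (\sum_(k < d) nrm (c k) ^+ 2) ^+ n * word_normsq T n x.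
Proof.
have c0 : 0 <= \sum_(k < d) nrm (c k) ^+ 2 by apply: sumr_ge0 => k _; rewrite sqr_ge0.
elim: n x => [|n IHn] x; first by rewrite expr0 mul1r.
rewrite iterSr (le_trans (IHn _)) // exprSr -mulrA ler_wpM2l ?exprn_ge0 //.
exact: word_normsq_combination.
Qed.

Lemma bounded_combination c : bounded_op (combination c).
Proof.
have [C C0 hC] := word_normsq_bound bT 1.
have c0 : 0 <= \sum_(k < d) nrm (c k) ^+ 2 by apply: sumr_ge0 => k _; rewrite sqr_ge0.
pose D := \sum_(k < d) nrm (c k) ^+ 2 * C + 1.
have D0 : 0 < D.
  by rewrite ltr_wpDl // sumr_ge0 // => k _; rewrite mulr_ge0 ?sqr_ge0 // ltW.
exists (Num.sqrt D); first by rewrite sqrtr_gt0.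
move=> x; rewrite -[nrm x]ger0_norm ?nrm_ge0 // -sqrtr_sqr -sqrtrM ?(ltW D0) //.
rewrite -[leLHS]ger0_norm ?nrm_ge0 // -sqrtr_sqr ler_sqrt; last first.
  by rewrite mulr_ge0 ?sqr_ge0 // ltW.
rewrite (le_trans (iter_combination_le c 1 x)) // expr1.
rewrite (le_trans (ler_wpM2l c0 (hC x))) // mulrA ler_wpM2r ?sqr_ge0 //.
by rewrite /D -mulr_suml lerDl.
Qed.

Lemma combination_comm c k x : T k (combination c x) = combination c (T k x).
Proof.
rewrite /= linear_sum; apply: eq_bigr => j _; by rewrite linearZ /= cT.
Qed.

Lemma shift_linear (lam : 'I_d -> R[i]) k : linear (fun x => T k x - lam k *: x).
Proof.
move=> a x y; rewrite linearP !scalerDr !scalerA opprD addrACA.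
by rewrite scalerN scalerA mulrC.
Qed.

Definition shift lam k := linear_of (shift_linear lam k).

Lemma shift_comm lam : commuting_tuple (shift lam).
Proof.
move=> j k x /=.
have TB i l : T i (T l x - lam l *: x) = T i (T l x) - lam l *: T i x.
  by rewrite linearB linearZ.
rewrite !TB cT !scalerBr !scalerA (mulrC (lam k)) !opprB addrACA [RHS]addrACA.
by congr (_ + _); rewrite addrC.
Qed.

Lemma bounded_shift lam k : bounded_op (shift lam k).
Proof.
have [C C0 hC] := bT k; exists (C + nrm (lam k)); first by rewrite ltr_wpDr ?nrm_ge0.
by move=> x; rewrite (le_trans (nrmB _ _)) // mulrDl lerD // nrmZ.
Qed.

(** For [c = conj(lam) / L^2] the powers of [C = sum_k c_k T_k] decay like [(t / L)^n], so
    [1 - C = - sum_k c_k (T_k - lam_k)] has an inverse [G], and the operators [- c_k G] satisfy the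
    Bezout identity. *)
Lemma taylor_spectrum_le (t : R) lam : 0 < t -> growth_le T (t ^+ 2) ->
  taylor_spectrum T lam -> l2norm lam <= t.
Proof.
move=> t0 [K hK] hlam; rewrite leNgt; apply/negP => tL; apply: hlam.
set L := l2norm lam in tL.
have L0 : 0 < L by rewrite (lt_trans t0).
have L2 : \sum_(k < d) nrm (lam k) ^+ 2 = L ^+ 2.
  by rewrite /L /l2norm sqr_sqrtr // sumr_ge0 // => k _; rewrite sqr_ge0.
pose c k : R[i] := (L ^- 2)%:C * (lam k)^*.
have cL : \sum_(k < d) c k * lam k = 1.
  transitivity ((L ^- 2)%:C * (\sum_(k < d) nrm (lam k) ^+ 2)%:C).
    rewrite rmorph_sum mulr_sumr /=; apply: eq_bigr => k _.
    by rewrite -mulJ_nrm /c -mulrA (mulrC (lam k)).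
  by rewrite L2 -rmorphM /= mulVf // expf_neq0 // gt_eqF.
have c2 : \sum_(k < d) nrm (c k) ^+ 2 = L ^- 2.
  rewrite /c; under eq_bigr do rewrite nrmM nrm_conj exprMn.
  rewrite -mulr_sumr L2 nrmr ger0_norm ?invr_ge0 ?sqr_ge0 // expr2 -mulrA.
  by rewrite mulVf ?mulr1 // expf_neq0 // gt_eqF.
pose C := combination c.
have thE : 0 <= t / L < 1.
  by rewrite divr_ge0 ?(ltW t0) ?(ltW L0) //= ltr_pdivrMr // mul1r.
have CP n x : nrm (iter n C x) <= Num.sqrt `|K| * (t / L) ^+ n * nrm x.
  have r0 : 0 <= Num.sqrt `|K| * (t / L) ^+ n * nrm x.
    rewrite mulr_ge0 ?nrm_ge0 // mulr_ge0 ?sqrtr_ge0 // exprn_ge0 //.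
    by case/andP: thE.
  rewrite -(ler_pXn2r (n := 2)) ?nnegrE ?nrm_ge0 //.
  rewrite (le_trans (iter_combination_le c n x)) // c2.
  have e1 : ((t / L) ^+ n) ^+ 2 = (L ^- 2) ^+ n * (t ^+ 2) ^+ n.
    rewrite -[RHS]exprMn -exprM mulnC exprM; congr (_ ^+ n).
    by rewrite exprMn exprVn mulrC.
  rewrite [leRHS](_ : _ = (L ^- 2) ^+ n * (`|K| * (t ^+ 2) ^+ n * nrm x ^+ 2)); last first.
    by rewrite [LHS]exprMn [X in X * _]exprMn e1 sqr_sqrtr //; ring.
  apply: ler_wpM2l; first by rewrite exprn_ge0 // invr_ge0 sqr_ge0.
  apply: le_trans (hK n x) _; apply: (ler_wpM2r (sqr_ge0 _)).
  exact: ler_wpM2r (exprn_ge0 n (sqr_ge0 t)) _ _ (ler_norm K).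
have [G [G1 _ GA]] := neumann (bounded_combination c) thE CP.
have Bl k : linear (fun x => - c k *: G x).
  by move=> a x y; rewrite linearP scalerDr !scalerA mulrC.
have GT k x : T k (G x) = G (T k x).
  by apply: GA => // y; apply: combination_comm.
apply: (@koszul_exact_of_bezout _ _ _ (shift lam) (fun k => linear_of (Bl k))).
- exact: shift_comm.
- move=> j k x /=.
  have GB : G (T j x - lam j *: x) = G (T j x) - lam j *: G x.
    by rewrite linearB linearZ.
  have TZ : T j (- c k *: G x) = - c k *: T j (G x) by rewrite linearZ.
  by rewrite GB TZ GT scalerBr !scalerA mulrC.
move=> x /=; rewrite -[RHS]G1 /=.
transitivity (- G (\sum_(k < d) c k *: (T k x - lam k *: x))).
  rewrite linear_sum -sumrN; apply: eq_bigr => k _.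
  by rewrite scaleNr; congr (- _); rewrite [RHS]linearZ.
rewrite -linearN; congr (G _).
rewrite (eq_bigr (fun k => c k *: T k x - (c k * lam k) *: x)) => [|k _]; last first.
  by rewrite scalerBr scalerA.
by rewrite sumrB opprB -scaler_suml cL scale1r.
Qed.

Lemma joint_spectral_radius_le (t : R) : 0 < t -> growth_le T (t ^+ 2) ->
  joint_spectral_radius T <= t.
Proof.
move=> t0 ht; rewrite /joint_spectral_radius; set A := [set _ | _ in _].
have [->|/set0P A0] := eqVneq A set0; first by rewrite sup0 ltW.
by apply: ge_sup => // _ [lam hl <-]; apply: taylor_spectrum_le.
Qed.

End UpperBound.

(** * Approximate eigenvalues at the joint growth rate *)

Section Parseval.
Context (R : realType) (H : completeNormedModType R[i]).
Context (dot : {dot H for Num.conj}) (hdot : hilbert_dot dot).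

(** Iterated square roots of -1 give an element whose order divides [2 ^ n.+1] but not [2 ^ n]. *)
Lemma prim_root_pow2 n : exists z : R[i], (2 ^ n.+1).-primitive_root z.
Proof.
have [z hz] : exists z : R[i], z ^+ (2 ^ n)%N = -1.
  elim: n => [|n [z hz]]; first by exists (-1); rewrite expr1.
  by exists (sqrtC z); rewrite expnS exprM sqrtCK.
have h1 : z ^+ (2 ^ n.+1)%N = 1 by rewrite expnSr exprM hz sqrrN expr1n.
have [m pm dm] := prim_order_exists (expn_gt0 2 n.+1) h1.
exists z; suff -> : (2 ^ n.+1)%N = m by [].
move: dm => /(dvdn_pfactor _ _ (isT : prime 2)) [k kn mE].
move: kn; rewrite leq_eqVlt => /orP[/eqP <- //|]; rewrite ltnS => kn.
have : z ^+ (2 ^ n)%N = 1.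
  by apply/eqP; rewrite -(prim_order_dvd pm) mE dvdn_exp2l.
rewrite hz => /eqP; rewrite -subr_eq0 -opprD oppr_eq0 -(natrD _ 1 1) pnatr_eq0 //.
Qed.

Lemma nrm_unity_root n (z : R[i]) : (0 < n)%N -> z ^+ n = 1 -> nrm z = 1.
Proof.
move=> n0 zn; apply/eqP; rewrite -(pexpr_eq1 n0 (nrm_ge0 z)) -nrmX zn.
by rewrite nrm1.
Qed.

Lemma nrmsq_sum n (v : nat -> H) :
  (nrm (\sum_(j < n) v j) ^+ 2)%:C = \sum_(j < n) \sum_(k < n) dot (v j) (v k).
Proof.
by rewrite -(dotxx hdot) dot_suml; apply: eq_bigr => j _; rewrite dot_sumr.
Qed.

(** The [z i] are the powers of a primitive root of unity of order [L = 2 ^ N.+1]. Since [N < L],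
    the characters with exponents below [N] are orthogonal, so the same [z] serves all lengths up to
    [N]. *)
Lemma parseval_roots N : exists (L : nat) (z : nat -> R[i]), [/\ (0 < L)%N,
  forall i, nrm (z i) = 1 & forall n (v : nat -> H), (n <= N)%N ->
    \sum_(i < L) nrm (\sum_(j < n) z i ^+ j *: v j) ^+ 2 =
    L%:R * \sum_(j < n) nrm (v j) ^+ 2].
Proof.
have [w pw] := prim_root_pow2 N; set L := (2 ^ N.+1)%N in pw.
have L0 : (0 < L)%N by rewrite expn_gt0.
have NL : (N < L)%N by rewrite (ltn_trans (ltnSn N)) // ltn_expl.
have wL := prim_expr_order pw.
have nw : nrm w = 1 by exact: nrm_unity_root L0 wL.
exists L, (fun i => w ^+ i); split => // [i|n v nN].
  by rewrite nrmX nw expr1n.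
have wJ : w * w^* = 1 by rewrite mulJ_nrm nw expr1n.
have orth (j k : 'I_n) : \sum_(i < L) (w ^+ i) ^+ j * ((w ^+ i) ^+ k)^* =
    if j == k then L%:R else 0.
  pose u := w ^+ j * (w ^+ k)^*.
  have uE i : (w ^+ i) ^+ j * ((w ^+ i) ^+ k)^* = u ^+ i.
    by rewrite /u exprMn -!rmorphXn -!exprM mulnC (mulnC i).
  under eq_bigr do rewrite uE.
  case: eqP => [jk|/eqP jk].
    have -> : u = 1 by rewrite /u jk rmorphXn /= -exprMn wJ expr1n.
    by under eq_bigr do rewrite expr1n; rewrite sumr_const card_ord.
  have u1 : u != 1.
    apply: contra jk => /eqP u1.
    have : w ^+ j = w ^+ k.
      have wk : (w ^+ k)^* * w ^+ k = 1.
        by rewrite rmorphXn /= -exprMn mulrC wJ expr1n.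
      by rewrite -[LHS]mulr1 -wk mulrA -/u u1 mul1r.
    move=> /eqP; rewrite (eq_prim_root_expr pw) !modn_small //.
    - by rewrite (leq_trans (ltn_ord k)) // (leq_trans nN) // ltnW.
    - by rewrite (leq_trans (ltn_ord j)) // (leq_trans nN) // ltnW.
  have := subrX1 u L; rewrite {1}/u exprMn -rmorphXn -!exprM mulnC exprM wL.
  rewrite expr1n mul1r mulnC exprM wL expr1n rmorph1 subrr => /esym/eqP.
  by rewrite mulf_eq0 subr_eq0 (negPf u1) => /eqP.
apply: complexI; rewrite rmorph_sum /=.
under eq_bigr => i _.
  rewrite (nrmsq_sum n (fun j => w ^+ i ^+ j *: v j)).
  under eq_bigr => j _ do under eq_bigr => k _ do rewrite dotZl dotZr mulrA.
  over.
rewrite exchange_big /= rmorphM rmorph_nat rmorph_sum mulr_sumr /=.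
apply: eq_bigr => j _; rewrite exchange_big /= (bigD1 j) //= [X in _ + X]big1.
  by rewrite addr0 -mulr_suml orth eqxx (dotxx hdot).
by move=> k kj; rewrite -mulr_suml orth eq_sym (negPf kj) mul0r.
Qed.

End Parseval.

(** * Pascal's rule and Beta integrals *)

Section Pascal.

(** The common induction step of the binomial formulas [iter_pencil] and [word_normsq_recl]. *)
Lemma pascal_sum (V : zmodType) (m : nat -> nat -> V) n :
  \sum_(j < n.+2) m (n.+1 - j)%N j *+ 'C(n.+1, j) =
  \sum_(j < n.+1) (m (n - j).+1 j + m (n - j)%N j.+1) *+ 'C(n, j).
Proof.
rewrite big_ord_recl /= bin0 subn0.
under eq_bigr => j _ do rewrite /bump /= add1n subSS binS mulrnDr.
rewrite big_split addrA /=.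
under [RHS]eq_bigr => j _ do rewrite mulrnDl.
rewrite big_split /=; congr (_ + _).
rewrite big_ord_recr /= bin_small // mulr0n addr0.
rewrite [RHS]big_ord_recl /= bin0 subn0; congr (_ + _).
by apply: eq_bigr => j _; rewrite /bump /= add1n subnSK.
Qed.

Lemma deriv_sum (R : nzRingType) I (r : seq I) (F : I -> {poly R}) :
  (\sum_(i <- r) F i)^`() = \sum_(i <- r) (F i)^`().
Proof. exact: raddf_sum. Qed.

(** The Beta integral, written with an antiderivative [p] so that the mean value theorem for
    polynomials can replace integration. The induction on [j] is integration by parts. *)
Lemma beta_poly (R : realFieldType) i j : exists p : {poly R},
  p^`() = 'X ^+ i * (1 - 'X) ^+ j /\
  (p.[1] - p.[0]) *+ 'C(i + j, j) = (i + j).+1%:R^-1.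
Proof.
elim: j i => [|j IHj] i.
  exists (i.+1%:R^-1 *: 'X ^+ i.+1); rewrite addn0 bin0 mulr1n; split.
    rewrite derivZ derivXn expr0 mulr1 /= -scalerMnr scalerMnl -mulr_natr.
    by rewrite mulVf ?pnatr_eq0 ?scale1r.
  by rewrite !hornerE /= expr1n expr0n /= mulr0 mulr1 subr0.
have [p [dp p1]] := IHj i.+1.
exists (i.+1%:R^-1 *: ('X ^+ i.+1 * (1 - 'X) ^+ j.+1 + j.+1%:R *: p)); split.
  rewrite derivZ derivD derivM derivXn derivZ dp /= deriv_exp /= derivB derivC derivX.
  rewrite sub0r mulN1r mulrnAr mulrN mulNrn scaler_nat addrNK.
  rewrite mulrnAl -scalerMnr scalerMnl -mulr_natr mulVf ?pnatr_eq0 ?scale1r //.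
have h : (j.+1%:R * ('C(i + j.+1, j.+1))%:R : R) = i.+1%:R * ('C(i + j.+1, j))%:R.
  by rewrite -!natrM mul_bin_left addnS -addSn addnK.
move: p1; rewrite addSnnS => <-.
rewrite !hornerE /= subrr expr1n !expr0n /= !mulr0 !mul0r !add0r.
rewrite -[LHS]mulr_natr -[RHS]mulr_natr.
transitivity (i.+1%:R^-1 * (p.[1] - p.[0]) * (j.+1%:R * ('C(i + j.+1, j.+1))%:R)); first by ring.
have i0 : i.+1%:R != 0 :> R by rewrite pnatr_eq0.
by rewrite h; move: i.+1%:R i0 => q q0; field.
Qed.

End Pascal.

(** * Merging commuting operators into one combination *)

Section Merging.
Context (R : realType) (H : completeNormedModType R[i]).
Context (dot : {dot H for Num.conj}) (hdot : hilbert_dot dot).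

Lemma iter_pencil (A B : {linear H -> H}) (a b : R[i]) n x :
  (forall x, A (B x) = B (A x)) ->
  iter n (fun x => a *: A x + b *: B x) x =
  \sum_(j < n.+1) (a ^+ (n - j) * b ^+ j) *: iter (n - j) A (iter j B x) *+ 'C(n, j).
Proof.
move=> AB.
pose m i j := (a ^+ i * b ^+ j) *: iter i A (iter j B x).
rewrite -[RHS]/(\sum_(j < n.+1) m (n - j)%N j *+ 'C(n, j)).
elim: n => [|n IHn]; first by rewrite big_ord1 /m /= bin0 mulr1n !expr0 mul1r scale1r.
rewrite pascal_sum iterS IHn !linear_sum ?scaler_sumr -big_split /=.
apply: eq_bigr => j _; rewrite !raddfMn /= -mulrnDl; congr (_ *+ _).
rewrite /m !linearZ /= !scalerA; congr (_ *: _ + _ *: _).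
- by rewrite exprS mulrC mulrA.
- by rewrite [in RHS]exprSr mulrA.
by rewrite -(iter_comm _ _ (fun x => esym (AB x))).
Qed.

(* Averaging over [s] in [0, 1] and over the phases [z] turns the square of each
   binomial coefficient into [binomial / (n + 1)]. *)
Lemma merge_pair (A B : {linear H -> H}) (L : seq (R * nat * H)) :
  (forall x, A (B x) = B (A x)) ->
  exists a b : R[i], nrm a ^+ 2 + nrm b ^+ 2 = 1 /\
  \sum_(e <- L) e.1.1 * \sum_(j < e.1.2.+1)
      nrm (iter (e.1.2 - j) A (iter j B e.2)) ^+ 2 *+ 'C(e.1.2, j) <=
  \sum_(e <- L) e.1.1 * e.1.2.+1%:R *
      nrm (iter e.1.2 (fun x => a *: A x + b *: B x) e.2) ^+ 2.
Proof.
move=> AB.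
pose bp i := projT1 (choice (beta_poly R i)).
have hbp i j : (bp i j)^`() = 'X ^+ i * (1 - 'X) ^+ j /\
    ((bp i j).[1] - (bp i j).[0]) *+ 'C(i + j, j) = (i + j).+1%:R^-1.
  exact: projT2 (choice (beta_poly R i)) j.
pose q (e : R * nat * H) j := nrm (iter (e.1.2 - j) A (iter j B e.2)) ^+ 2.
(* An antiderivative in [s] of the average over the phases of the right-hand side; its increment
   [p01] is the left-hand side. *)
pose p : {poly R} := \sum_(e <- L) (e.1.1 * e.1.2.+1%:R) *: \sum_(j < e.1.2.+1)
   ('C(e.1.2, j)%:R ^+ 2 * q e j) *: bp (e.1.2 - j)%N j.
have p01 : p.[1] - p.[0] = \sum_(e <- L) e.1.1 * \sum_(j < e.1.2.+1) q e j *+ 'C(e.1.2, j).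
  rewrite /p !horner_sum -sumrB; apply: eq_bigr => e _.
  rewrite !hornerZ !horner_sum -mulrBr -sumrB -mulrA; congr (_ * _).
  rewrite mulr_sumr; apply: eq_bigr => j _.
  have je : (j <= e.1.2)%N by rewrite -ltnS.
  have [_ h] := hbp (e.1.2 - j)%N j; rewrite (subnK je) in h.
  rewrite !hornerZ -mulrBr.
  have n0 : e.1.2.+1%:R != 0 :> R by rewrite pnatr_eq0.
  move/(congr1 (fun u => u * e.1.2.+1%:R)): h; rewrite mulVf //.
  rewrite -[X in X * _]mulr_natr => h.
  rewrite -[RHS]mulr_natr; move: h {n0}.
  move: (_.[1] - _.[0]) ('C(_, _)%:R) (_.+1%:R) => D C N h.
  by transitivity (D * C * N * (q e j * C)); [ring|rewrite h mul1r].
have [s s01] := @poly_mvt R 0 1 p ltr01.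
rewrite p01 subr0 mulr1 => ->.
have dpE : p^`().[s] = \sum_(e <- L) e.1.1 * e.1.2.+1%:R * \sum_(j < e.1.2.+1)
   ('C(e.1.2, j)%:R ^+ 2 * q e j) * (s ^+ (e.1.2 - j) * (1 - s) ^+ j).
  rewrite /p deriv_sum horner_sum; apply: eq_bigr => e _.
  rewrite derivZ hornerZ deriv_sum horner_sum; congr (_ * _); apply: eq_bigr => j _.
  by rewrite derivZ hornerZ (hbp _ _).1 !hornerE.
have s0 : 0 <= s by move: s01; rewrite in_itv /= => /andP[/ltW].
have s1 : 0 <= 1 - s by move: s01; rewrite in_itv /= subr_ge0 => /andP[_ /ltW].
pose u := (Num.sqrt s)%:C : R[i]; pose v := (Num.sqrt (1 - s))%:C : R[i].
pose M := \max_(e <- L) e.1.2.+1.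
have [K [z [K0 z1 hz]]] := parseval_roots hdot M.
have hM e : e \in L -> (e.1.2 < M)%N.
  move=> eL; rewrite /M; elim: L eL {p p01 s01 dpE M K z K0 z1 hz} => // x L IHL.
  by rewrite inE big_cons => /orP[/eqP ->|/IHL h]; rewrite leq_max ?leqnn // h orbT.
have avg : \sum_(i < K) (\sum_(e <- L) e.1.1 * e.1.2.+1%:R *
      nrm (iter e.1.2 (fun x => u *: A x + (z i * v) *: B x) e.2) ^+ 2) =
   K%:R * p^`().[s].
  rewrite exchange_big dpE mulr_sumr /= [LHS]big_seq_cond [RHS]big_seq_cond.
  apply: eq_bigr => e /andP[eL _].
  rewrite -mulr_sumr mulrCA; congr (_ * _).
  pose w j := (u ^+ (e.1.2 - j) * v ^+ j) *: iter (e.1.2 - j) A (iter j B e.2) *+ 'C(e.1.2, j).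
  transitivity (\sum_(i < K) nrm (\sum_(j < e.1.2.+1) z i ^+ j *: w j) ^+ 2).
    apply: eq_bigr => i _; congr (nrm _ ^+ 2); rewrite iter_pencil //.
    apply: eq_bigr => j _; rewrite /w -scalerMnr scalerA; congr (_ *: _ *+ _).
    by rewrite exprMn mulrCA.
  rewrite hz; last exact: hM.
  congr (_ * _); apply: eq_bigr => j _.
  rewrite /w -scaler_nat nrmZ nrmZ nrm_nat nrmM !nrmX !nrmr !ger0_norm ?sqrtr_ge0 //.
  rewrite !exprMn -!exprM ![(_ * 2)%N]mulnC !exprM !sqr_sqrtr //.
  by rewrite [RHS]mulrAC -[RHS]mulrA.
(* Some phase does at least as well as the average. *)
have [i hi] : exists i : 'I_K, p^`().[s] <= \sum_(e <- L) e.1.1 * e.1.2.+1%:R *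
      nrm (iter e.1.2 (fun x => u *: A x + (z i * v) *: B x) e.2) ^+ 2.
  apply: contrapT => /forallNP hn.
  have : \sum_(i < K) (\sum_(e <- L) e.1.1 * e.1.2.+1%:R *
      nrm (iter e.1.2 (fun x => u *: A x + (z i * v) *: B x) e.2) ^+ 2) <
      \sum_(i < K) p^`().[s].
    apply: ltr_sum => [|i _]; first by apply/hasP; exists (Ordinal K0); rewrite ?mem_index_enum.
    by rewrite ltNge; apply/negP/hn.
  by rewrite avg sumr_const card_ord mulr_natl ltxx.
exists u, (z i * v); split => //.
rewrite nrmM z1 mul1r !nrmr !ger0_norm ?sqrtr_ge0 // !sqr_sqrtr //.
by rewrite addrC subrK.
Qed.

End Merging.

Section MergeTuple.
Context (R : realType) (H : completeNormedModType R[i]).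
Context (dot : {dot H for Num.conj}) (hdot : hilbert_dot dot).

(** Words are grouped by their number [j] of letters other than [T ord0], whose positions can be
    chosen in ['C(n, j)] ways. *)
Lemma word_normsq_recl d (T : 'I_d.+1 -> {linear H -> H}) n y :
  commuting_tuple T ->
  word_normsq T n y = \sum_(j < n.+1)
    word_normsq (fun k => T (lift ord0 k)) j (iter (n - j) (T ord0) y) *+ 'C(n, j).
Proof.
move=> cT; elim: n y => [|n IHn] y; first by rewrite big_ord1 bin0 mulr1n.
pose m i j := word_normsq (fun k => T (lift ord0 k)) j (iter i (T ord0) y).
rewrite -/(m _ _) (pascal_sum m) /word_normsq /= -/(word_normsq _ _ _) big_ord_recl.
rewrite -/(word_normsq T n _) IHn.
under [X in _ + X]eq_bigr => k _ do rewrite -/(word_normsq T n _) IHn.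
rewrite exchange_big -big_split; apply: eq_bigr => j _ /=.
rewrite sumrMnl -mulrnDl; congr ((_ + _) *+ _).
  by rewrite /m -iterSr.
rewrite /m /word_normsq /=; apply: eq_bigr => k _; congr word_sum.
by rewrite (iter_comm (A := T (lift ord0 k))).
Qed.

Lemma combination_recl d (T : 'I_d.+1 -> {linear H -> H}) (a b : R[i]) c x :
  combination T (fun k => if unlift ord0 k is Some i then b * c i else a) x =
  a *: T ord0 x + b *: combination (fun k => T (lift ord0 k)) c x.
Proof.
rewrite /= big_ord_recl unlift_none; congr (_ + _).
by rewrite scaler_sumr; apply: eq_bigr => k _; rewrite liftK scalerA.
Qed.

(** Induction on [d]: the hypothesis merges all operators but the first into [S'], then [merge_pair]
    merges [T ord0] with [S']. Lists of weights, lengths and vectors occur because one [c] must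
    serve all terms created by the splitting. The loss is only polynomial in the length. *)
Lemma merge_tuple d (T : 'I_d.+1 -> {linear H -> H}) (L : seq (R * nat * H)) :
  commuting_tuple T -> (forall e, e \in L -> 0 <= e.1.1) ->
  exists c : 'I_d.+1 -> R[i], \sum_(k < d.+1) nrm (c k) ^+ 2 = 1 /\
  \sum_(e <- L) e.1.1 * word_normsq T e.1.2 e.2 <=
  d`!%:R * \sum_(e <- L) e.1.1 * 'C(e.1.2 + d, d)%:R *
      nrm (iter e.1.2 (combination T c) e.2) ^+ 2.
Proof.
elim: d T L => [|d IHd] T L cT L0.
  exists (fun=> 1); split; first by rewrite big_ord1 nrm1 expr1n.
  rewrite fact0 mul1r; apply: ler_sum => e _; rewrite addn0 bin0 mulr1.
  rewrite le_eqVlt; apply/orP; left; apply/eqP; congr (_ * _); elim: e.1.2 e.2 => [//|n IHn] y.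
  have Cy : combination T (fun=> 1) y = T ord0 y by rewrite /= big_ord1 scale1r.
  by rewrite iterSr Cy -IHn /word_normsq /= big_ord1.
pose T' k := T (lift ord0 k).
have cT' : commuting_tuple T' by move=> j k x; apply: cT.
pose L' := [seq (e.1.1 * 'C(e.1.2, j)%:R, j, iter (e.1.2 - j) (T ord0) e.2) |
   e <- L, j <- index_iota 0 e.1.2.+1].
have L'0 e : e \in L' -> 0 <= e.1.1.
  move=> /allpairsPdep[e1 [j [e1L _ ->]]] /=.
  by rewrite mulr_ge0 ?L0.
have [c' [c'1 hc']] := IHd T' L' cT' L'0.
pose L2 := [seq (e.1.1 * 'C(e.1.2 + d, d)%:R, e.1.2, e.2) | e <- L].
pose S' := combination T' c'.
have AS x : T ord0 (S' x) = S' (T ord0 x).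
  rewrite /S' /= linear_sum; apply: eq_bigr => k _.
  by rewrite linearZ /= /T' cT.
have [a [b [ab hab]]] := merge_pair hdot L2 AS.
exists (fun k => if unlift ord0 k is Some i then b * c' i else a); split.
  rewrite big_ord_recl unlift_none -[RHS]ab; congr (_ + _).
  under eq_bigr do rewrite liftK nrmM exprMn.
  by rewrite -mulr_sumr c'1 mulr1.
have -> : \sum_(e <- L) e.1.1 * word_normsq T e.1.2 e.2 =
    \sum_(e <- L') e.1.1 * word_normsq T' e.1.2 e.2.
  rewrite big_allpairs_dep; apply: eq_bigr => e _ /=.
  rewrite big_mkord word_normsq_recl // mulr_sumr; apply: eq_bigr => j _.
  by rewrite -mulrA mulr_natl.
pose X := \sum_(e <- L2) e.1.1 * \sum_(j < e.1.2.+1)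
  nrm (iter (e.1.2 - j) (T ord0) (iter j S' e.2)) ^+ 2 *+ 'C(e.1.2, j).
apply: (@le_trans _ _ (d`!%:R * X)).
  rewrite (le_trans hc') // ler_wpM2l // big_allpairs_dep /X big_map.
  rewrite [leLHS]big_seq_cond [leRHS]big_seq_cond; apply: ler_sum => e /andP[eL _] /=.
  rewrite big_mkord mulr_sumr; apply: ler_sum => j _.
  rewrite (_ : iter j S' _ = iter (e.1.2 - j) (T ord0) (iter j S' e.2)).
    set u := nrm _ ^+ 2.
    rewrite [leRHS](_ : _ = e.1.1 * 'C(e.1.2, j)%:R * 'C(e.1.2 + d, d)%:R * u); last first.
      by rewrite -mulr_natl; ring.
    rewrite ler_wpM2r ?sqr_ge0 // ler_wpM2l ?mulr_ge0 ?L0 //.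
    by rewrite ler_nat leq_bin2l // leq_add2r -ltnS.
  elim: (e.1.2 - j)%N => [//|k IHk]; rewrite !iterS -IHk.
  by rewrite (iter_comm (A := T ord0)).
apply: (@le_trans _ _ (d`!%:R * \sum_(e <- L2) e.1.1 * e.1.2.+1%:R *
       nrm (iter e.1.2 (fun x => a *: T ord0 x + b *: S' x) e.2) ^+ 2)).
  by rewrite ler_wpM2l.
(* The weights fit because [n.+1 * 'C(n + d, d) <= d.+1 * 'C(n + d.+1, d.+1)]. *)
rewrite factS mulnC natrM -mulrA ler_wpM2l // big_map mulr_sumr.
rewrite [leLHS]big_seq_cond [leRHS]big_seq_cond; apply: ler_sum => e /andP[eL _] /=.
rewrite (eq_iter (fun x => combination_recl T a b c' x)).
set u := nrm _ ^+ 2.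
rewrite [leLHS](_ : _ = e.1.1 * ('C(e.1.2 + d, d) * e.1.2.+1)%:R * u); last first.
  by rewrite natrM; ring.
rewrite [leRHS](_ : _ = e.1.1 * (d.+1 * 'C(e.1.2 + d.+1, d.+1))%:R * u); last first.
  by rewrite natrM; ring.
rewrite ler_wpM2r ?sqr_ge0 // ler_wpM2l ?L0 // ler_nat addnS -mul_bin_diag mulnC.
by rewrite leq_mul2r ltnS leq_addr orbT.
Qed.

End MergeTuple.

(** * Sums over powers of an operator with bounded resolvent *)

Section ApproximateEigenvalue.
Context (R : realType) (H : completeNormedModType R[i]).
Context (dot : {dot H for Num.conj}) (hdot : hilbert_dot dot).

Lemma parallelogram_le (x y : H) :
  nrm (x - y) ^+ 2 <= 2 * (nrm x ^+ 2 + nrm y ^+ 2).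
Proof.
have := parallelogram hdot x y; rewrite -mulrDr => <-.
by rewrite lerDr sqr_ge0.
Qed.

(* Parseval for [x = sum_(j < n) z ^- j S ^ j v], whose image under [1 - S / z] is
   [v - z ^- n S ^ n v]. *)
Lemma resolvent_sum_le (S : {linear H -> H}) (t k : R) : 0 < t -> 0 < k ->
  (forall z, nrm z = t -> forall x, k * nrm x <= nrm (x - z^-1 *: S x)) ->
  (forall v (e : R), 0 < e -> exists N, forall n, (N <= n)%N ->
     t ^- 2 ^+ n * nrm (iter n S v) ^+ 2 <= e) ->
  forall n v, \sum_(j < n) t ^- 2 ^+ j * nrm (iter j S v) ^+ 2 <= 2 * k ^- 2 * nrm v ^+ 2.
Proof.
move=> t0 k0 hk hS n v.
pose b j := t ^- 2 ^+ j * nrm (iter j S v) ^+ 2.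
have b0 j : 0 <= b j by rewrite mulr_ge0 ?sqr_ge0 // exprn_ge0 // invr_ge0 sqr_ge0.
have tele (u : R[i]) M : \sum_(j < M) u ^+ j *: iter j S v -
    u *: S (\sum_(j < M) u ^+ j *: iter j S v) = v - u ^+ M *: iter M S v.
  elim: M => [|M IHM].
    by rewrite !big_ord0 linear0 scaler0 subr0 expr0 scale1r subrr.
  have SZ : S (u ^+ M *: iter M S v) = u ^+ M *: S (iter M S v) by exact: linearZ.
  rewrite big_ord_recr linearD /= SZ scalerDr scalerA -exprS opprD addrACA IHM.
  by rewrite addrA subrK.
have main N : k ^+ 2 * \sum_(j < N) b j <= 2 * (nrm v ^+ 2 + b N).
  have [L [z [L0 z1 hz]]] := parseval_roots hdot N.
  pose y (i j : nat) : H := (t^-1)%:C ^+ j *: iter j S v.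
  pose x i := \sum_(j < N) z i ^+ j *: y i j.
  have hx i : k ^+ 2 * nrm (x i) ^+ 2 <= 2 * (nrm v ^+ 2 + b N).
    pose w := (z i * (t^-1)%:C)^-1.
    have zi0 : z i != 0 by rewrite -nrm_gt0 z1.
    have ti0 : (t^-1)%:C != 0 :> R[i] by rewrite -nrm_gt0 nrmr normr_gt0 gt_eqF // invr_gt0.
    have nw : nrm w = t.
      by rewrite /w nrmV nrmM z1 mul1r nrmr gtr0_norm ?invr_gt0 // invrK.
    have := hk w nw (x i); rewrite -(ler_pXn2r (n := 2)) ?nnegrE ?mulr_ge0 ?nrm_ge0 ?(ltW k0) //.
    rewrite exprMn => /le_trans; apply.
    have -> : x i - w^-1 *: S (x i) = v - w^-1 ^+ N *: iter N S v.
      rewrite -tele (_ : x i = \sum_(j < N) w^-1 ^+ j *: iter j S v) //.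
      by apply: eq_bigr => j _; rewrite /y scalerA -exprMn /w invrK.
    rewrite (le_trans (parallelogram_le _ _)) // ler_wpM2l // lerD2l.
    rewrite nrmZ exprMn nrmX nrmV nw /b -exprVn -!exprM mulnC //.
  have : \sum_(i < L) k ^+ 2 * nrm (x i) ^+ 2 <= \sum_(i < L) 2 * (nrm v ^+ 2 + b N).
    by apply: ler_sum => i _.
  rewrite -mulr_sumr; under eq_bigr do rewrite /x /y.
  rewrite (hz N (fun j => (t^-1)%:C ^+ j *: iter j S v)) //.
  rewrite sumr_const card_ord; set W := 2 * _.
  rewrite -[W *+ L]mulr_natl mulrCA ler_pM2l ?ltr0n //.
  congr (_ * _ <= _); apply: eq_bigr => j _.
  rewrite nrmZ nrmX nrmr gtr0_norm ?invr_gt0 // exprMn /b -exprVn -!exprM mulnC //.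
have k2 : 0 < k ^+ 2 by rewrite exprn_gt0.
rewrite mulrAC ler_pdivlMr // mulrC; apply: le_of_le_add => e e0.
(* The bound [main] is used at the late index [N + n], where its remainder is small, and the sum is
   then cut back to [n] terms. *)
have [N hN] := hS v (e / 2) ltac:(lra).
have := hN (N + n)%N (leq_addr _ _); rewrite -/(b _) => h.
have := main (N + n)%N; rewrite addnC big_split_ord /= mulrDr.
have : 0 <= k ^+ 2 * \sum_(i < N) b (n + i)%N by rewrite mulr_ge0 ?sumr_ge0 // ltW.
rewrite (addnC n N); move: h; rewrite /b; lra.
Qed.

(** Pascal's rule turns the sum with weights of order [p.+1] into sums of order [p] at all iterates
    of [v], each at most [C ^+ p.+1] times its first term; the hypothesis once more adds up these
    terms. *)
Lemma resolvent_binomial_sum_le (S : {linear H -> H}) (t C : R) p : 0 < t -> 0 <= C ->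
  (forall n v, \sum_(j < n) t ^- 2 ^+ j * nrm (iter j S v) ^+ 2 <= C * nrm v ^+ 2) ->
  forall n v, \sum_(j < n) 'C(j + p, p)%:R * (t ^- 2 ^+ j * nrm (iter j S v) ^+ 2) <=
    C ^+ p.+1 * nrm v ^+ 2.
Proof.
move=> t0 C0 hC; elim: p => [|p IHp] n v.
  by under eq_bigr do rewrite addn0 bin0 mul1r; rewrite expr1.
have step : \sum_(j < n) 'C(j + p.+1, p.+1)%:R * (t ^- 2 ^+ j * nrm (iter j S v) ^+ 2) <=
    C ^+ p.+1 * \sum_(j < n) t ^- 2 ^+ j * nrm (iter j S v) ^+ 2.
  elim: n v => [|n IHn] v; first by rewrite !big_ord0 mulr0.
  have b0 (j : nat) u : 0 <= t ^- 2 ^+ j * nrm (iter j S u) ^+ 2.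
    by rewrite mulr_ge0 ?sqr_ge0 // exprn_ge0 // invr_ge0 sqr_ge0.
  have -> : \sum_(j < n.+1) t ^- 2 ^+ j * nrm (iter j S v) ^+ 2 =
      nrm v ^+ 2 + t ^- 2 * \sum_(j < n) t ^- 2 ^+ j * nrm (iter j S (S v)) ^+ 2.
    rewrite big_ord_recl expr0 mul1r mulr_sumr; congr (_ + _); apply: eq_bigr => j _.
    by rewrite mulrA -exprS -iterSr.
  have -> : \sum_(j < n.+1) 'C(j + p.+1, p.+1)%:R * (t ^- 2 ^+ j * nrm (iter j S v) ^+ 2) =
      \sum_(j < n.+1) 'C(j + p, p)%:R * (t ^- 2 ^+ j * nrm (iter j S v) ^+ 2) +
      t ^- 2 * \sum_(j < n) 'C(j + p.+1, p.+1)%:R * (t ^- 2 ^+ j * nrm (iter j S (S v)) ^+ 2).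
    under eq_bigr do rewrite addnS binS natrD mulrDl.
    rewrite big_split /= addrC; congr (_ + _).
    rewrite big_ord_recl add0n bin_small // mul0r add0r mulr_sumr; apply: eq_bigr => j _.
    by rewrite lift0 addSnnS exprS iterSr; ring.
  rewrite mulrDr lerD // mulrCA ler_wpM2l // invr_ge0 sqr_ge0 //.
apply: le_trans step _; rewrite [in leRHS]exprSr -mulrA.
exact: ler_wpM2l (exprn_ge0 _ C0) _ _ (hC n v).
Qed.

End ApproximateEigenvalue.

(** * Blow-up of the word sums at the critical rate *)

Section Blowup.
Context (R : realType) (H : completeNormedModType R[i]).
Context (d : nat) (T : 'I_d -> {linear H -> H}).
Hypothesis bT : forall k, bounded_op (T k).

(** By Euclidean division of [n] by [N]; the finitely many remainders only affect the constant. *)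
Lemma growth_of_power N (s : R) : (0 < N)%N -> 0 < s ->
  (forall x, word_normsq T N x <= s ^+ N * nrm x ^+ 2) -> growth_le T s.
Proof.
move=> N0 s0 hN.
have hq q x : word_normsq T (q * N) x <= (s ^+ N) ^+ q * nrm x ^+ 2.
  elim: q x => [|q IHq] x; first by rewrite mul0n expr0 mul1r.
  rewrite mulSn addnC /word_normsq word_sum_add exprSr -mulrA.
  apply: le_trans (ler_wpM2l (exprn_ge0 q (exprn_ge0 N (ltW s0))) (hN x)).
  by rewrite -word_sumM; apply: word_sum_le.
have hC r : exists C : R, 0 < C /\ forall x, word_normsq T r x <= C * nrm x ^+ 2.
  by have [C C0 h] := word_normsq_bound bT r; exists C.
have [C /all_and2[C0 hC']] := choice hC.
exists (\sum_(r < N) C r / s ^+ r) => n x.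
pose r := Ordinal (ltn_pmod n N0); pose q := (n %/ N)%N.
have nE : n = (r + q * N)%N by rewrite addnC -divn_eq.
rewrite nE /word_normsq word_sum_add.
apply: (@le_trans _ _ (C r * ((s ^+ N) ^+ q * nrm x ^+ 2))).
  apply: le_trans (ler_wpM2l (ltW (C0 r)) (hq q x)).
  by rewrite -word_sumM; apply: word_sum_le => y; apply: hC'.
rewrite mulrA ler_wpM2r ?sqr_ge0 // exprD mulnC exprM mulrA.
rewrite ler_wpM2r ?exprn_ge0 ?(ltW s0) // -ler_pdivrMr ?exprn_gt0 //.
rewrite (bigD1 r) //= lerDl sumr_ge0 // => i _.
by rewrite divr_ge0 ?exprn_ge0 ?(ltW s0) ?(ltW (C0 _)).
Qed.

(* If the sums were bounded by [B] then [b n := t ^ (-2n) word_normsq T n] would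
   satisfy [b N <= B b j] for [j < N], hence [N b N <= B ^ 2]: so [b N <= 1 / 4] for
   an [N] independent of [t], which is impossible for [t] close to [rho]. *)
Lemma growth_blowup (rho B eps : R) : 0 < rho -> 0 < eps ->
  (forall s, 0 < s < rho -> ~ growth_le T (s ^+ 2)) ->
  exists t, rho < t <= rho + eps /\ exists y N,
    B * nrm y ^+ 2 < \sum_(n < N) t ^- 2 ^+ n * word_normsq T n y.
Proof.
move=> rho0 eps0 hn; apply: contrapT => hcontra.
pose D := `|B| + 1; have D0 : 0 < D by rewrite ltr_wpDl.
pose N := (Num.truncn (4 * D ^+ 2)).+1.
have hN : 4 * D ^+ 2 < N%:R by exact: truncnS_gt.
have N0 : 0 < N%:R :> R by rewrite ltr0n.
(* The second bound makes [s = t (1 - 1 / (4 N))] smaller than [rho], whereas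
   [(1 - 1 / (4 N)) ^ (2 N) >= 1 / 2] by Bernoulli's inequality. *)
pose del := Num.min eps (rho / (8 * N%:R)).
have N8 : 0 < 8 * N%:R :> R by rewrite mulr_gt0.
have del0 : 0 < del by rewrite lt_min eps0 divr_gt0.
have dele : del <= eps by rewrite ge_min lexx.
have delN : del * (8 * N%:R) <= rho by rewrite -ler_pdivlMr // ge_min lexx orbT.
pose t := rho + del.
have t0 : 0 < t by rewrite addr_gt0.
have ht : rho < t <= rho + eps by rewrite ltrDl del0 lerD2l.
pose b n y := t ^- 2 ^+ n * word_normsq T n y.
have b0 n y : 0 <= b n y.
  by rewrite mulr_ge0 ?word_normsq_ge0 // exprn_ge0 // invr_ge0 sqr_ge0.
have hb M y : \sum_(n < M) b n y <= D * nrm y ^+ 2.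
  apply: (@le_trans _ _ (B * nrm y ^+ 2)).
    rewrite leNgt; apply/negP => h; apply: hcontra; exists t; split => //.
    by exists y, M.
  by rewrite ler_wpM2r ?sqr_ge0 // /D (le_trans (ler_norm _)) // lerDl.
have tn n : 0 < t ^+ 2 ^+ n by rewrite !exprn_gt0.
have hb1 n y : word_normsq T n y <= D * t ^+ 2 ^+ n * nrm y ^+ 2.
  have : b n y <= D * nrm y ^+ 2.
    by rewrite (le_trans _ (hb n.+1 y)) // big_ord_recr lerDr sumr_ge0.
  by rewrite /b exprVn mulrC ler_pdivrMr // mulrAC.
have hbN y j : (j <= N)%N -> b N y <= D * b j y.
  move=> jN; rewrite /b !exprVn mulrC ler_pdivrMr // mulrCA -mulrA mulrC.
  rewrite [leRHS](_ : _ = D * t ^+ 2 ^+ (N - j) * word_normsq T j y); last first.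
    rewrite -{1}(subnK jN) exprD; field; rewrite -exprM expf_neq0 // gt_eqF //.
  rewrite -{1}(subnK jN) /word_normsq word_sum_add -word_sumM.
  by apply: word_sum_le => z; apply: hb1.
have hbN4 y : b N y <= 4^-1 * nrm y ^+ 2.
  have : N%:R * b N y <= D * (D * nrm y ^+ 2).
    rewrite (le_trans _ (ler_wpM2l (ltW D0) (hb N y))) // mulr_sumr.
    rewrite (_ : N%:R * b N y = \sum_(i < N) b N y).
      by apply: ler_sum => j _; apply: hbN; rewrite ltnW.
    by rewrite sumr_const card_ord mulr_natl.
  have := ler_wpM2r (sqr_ge0 (nrm y)) (ltW hN); have := b0 N y.
  move: (N%:R) N0 (b N y) (nrm y ^+ 2) => u u0 v w h1 h2 h3.
  rewrite -(ler_pM2l u0); lra.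
pose s := t * (1 - (4 * N%:R)^-1).
have N4 : (4 * N%:R)^-1 <= 4^-1 :> R.
  by rewrite invfM ler_piMr ?invr_ge0 // invf_le1 ?ler1n.
have s0 : 0 < s by rewrite mulr_gt0 //; lra.
have srho : s < rho.
  rewrite /s mulrBr mulr1 ltrBlDr -ltrBlDl /t addrAC subrr add0r.
  rewrite ltr_pdivlMr ?mulr_gt0 //; lra.
apply: (hn s); first by rewrite s0.
apply: (@growth_of_power N) => //; first by rewrite exprn_gt0.
have key : 4^-1 * t ^+ 2 ^+ N <= s ^+ 2 ^+ N.
  have -> : s ^+ 2 ^+ N = t ^+ 2 ^+ N * (1 - (4 * N%:R)^-1) ^+ 2 ^+ N.
    by rewrite /s (exprMn 2 t) exprMn.
  rewrite mulrC.
  apply: (ler_wpM2l (ltW (tn N))); rewrite -exprM.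
  have := @bernoulli R (- (4 * N%:R)^-1) (2 * N) ltac:(lra).
  have -> : (2 * N)%:R * - (4 * N%:R)^-1 = - 2^-1 :> R.
    by rewrite natrM; field; rewrite gt_eqF.
  lra.
move=> x; have := hbN4 x; rewrite /b exprVn mulrC ler_pdivrMr // => /le_trans; apply.
by rewrite mulrAC; apply: (ler_wpM2r (sqr_ge0 (nrm x))).
Qed.

End Blowup.

(** * Approximate eigenvectors of a combination *)

Section JointApproximateEigenvalue.
Context (R : realType) (H : completeNormedModType R[i]).
Context (dot : {dot H for Num.conj}) (hdot : hilbert_dot dot).

(** Otherwise, at the [t] supplied by [growth_blowup], all operators [1 - S_c / z] with [|z| = t]
    are bounded below by [k]. Then [merge_tuple] and the resolvent sums bound the word sums at [y]
    by [B |y|^2], a contradiction. *)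
Lemma approximate_eigenvalue d (T : 'I_d.+1 -> {linear H -> H}) (rho k eps : R) :
  (forall j, bounded_op (T j)) -> commuting_tuple T ->
  0 < rho -> 0 < k -> 0 < eps ->
  (forall t, rho < t -> growth_le T (t ^+ 2)) ->
  (forall s, 0 < s < rho -> ~ growth_le T (s ^+ 2)) ->
  exists (c : 'I_d.+1 -> R[i]) (z : R[i]) (x : H),
    [/\ \sum_(j < d.+1) nrm (c j) ^+ 2 = 1, rho < nrm z <= rho + eps, x != 0 &
        nrm (x - z^-1 *: combination T c x) < k * nrm x].
Proof.
move=> bT cT rho0 k0 eps0 hU hL; apply: contrapT => hcontra.
(* The factorial comes from [merge_tuple], the power from [resolvent_binomial_sum_le] with
   [p = d]. *)
pose B := d`!%:R * (2 * k ^- 2) ^+ d.+1.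
have [t [ht [y [N hy]]]] := growth_blowup bT B rho0 eps0 hL.
have /andP[rt _] := ht; have t0 : 0 < t by rewrite (lt_trans rho0).
pose L := [seq (t ^- 2 ^+ n, n, y) | n <- index_iota 0 N].
have L0 e : e \in L -> 0 <= e.1.1.
  by move=> /mapP[n _ ->] /=; rewrite exprn_ge0 // invr_ge0 sqr_ge0.
have [c [c1 hc]] := merge_tuple hdot cT L0.
have hk z : nrm z = t -> forall x, k * nrm x <= nrm (x - z^-1 *: combination T c x).
  move=> zt x; rewrite leNgt; apply/negP => h; apply: hcontra.
  exists c, z, x; split => //; first by rewrite zt.
  by apply/eqP => x0; move: h; rewrite x0 linear0 scaler0 subr0 !nrm0 mulr0 ltxx.
(* The midpoint [u] of [rho] and [t] is admissible, which gives decay like [(u / t)^(2n)]. *)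
have hS v (e : R) : 0 < e -> exists N, forall n, (N <= n)%N ->
     t ^- 2 ^+ n * nrm (iter n (combination T c) v) ^+ 2 <= e.
  move=> e0; pose u := (rho + t) / 2.
  have [K hK] : growth_le T (u ^+ 2) by apply: hU; rewrite /u; lra.
  have u0 : 0 < u by rewrite /u; lra.
  have ut : 0 <= u ^+ 2 / t ^+ 2 < 1.
    rewrite divr_ge0 ?sqr_ge0 //= ltr_pdivrMr ?exprn_gt0 // mul1r.
    by rewrite ltr_pXn2r ?nnegrE ?(ltW u0) ?(ltW t0) // /u; lra.
  pose D := `|K| * nrm v ^+ 2 + 1.
  have D0 : 0 < D by rewrite ltr_wpDl // mulr_ge0 ?sqr_ge0.
  have [M hM] := exprn_small ut (divr_gt0 e0 D0).
  exists M => n /hM; rewrite ler_pdivlMr // => /(le_trans _); apply.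
  have := iter_combination_le T c n v; rewrite c1 expr1n mul1r => h.
  have tn : 0 <= t ^- 2 ^+ n by rewrite exprn_ge0 // invr_ge0 sqr_ge0.
  apply: le_trans (ler_wpM2l tn h) _.
  apply: le_trans (ler_wpM2l tn (hK n v)) _.
  rewrite (exprMn n (u ^+ 2)).
  have -> : t ^- 2 ^+ n * (K * u ^+ 2 ^+ n * nrm v ^+ 2) =
      u ^+ 2 ^+ n * t ^- 2 ^+ n * (K * nrm v ^+ 2) by ring.
  apply: ler_wpM2l; first by rewrite mulr_ge0 // exprn_ge0 // sqr_ge0.
  rewrite /D ler_wpDr //; apply: (ler_wpM2r (sqr_ge0 _)); exact: ler_norm.
have C0 : 0 <= 2 * k ^- 2 by rewrite mulr_ge0 // invr_ge0 sqr_ge0.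
have hsum := resolvent_binomial_sum_le d t0 C0
  (resolvent_sum_le hdot t0 k0 hk hS) N y.
move: hy; apply/negP; rewrite -leNgt.
move: hc; rewrite !big_map !big_mkord /= => /le_trans; apply.
rewrite /B -mulrA ler_wpM2l // (le_trans _ hsum) // le_eqVlt; apply/orP; left.
by apply/eqP/eq_bigr => n _; ring.
Qed.

End JointApproximateEigenvalue.

Section ComplexCluster.
Context (R : realType).

(** Real and imaginary parts lie in a real cube, which is compact. *)
Lemma complex_cluster n (w : nat -> 'I_n -> R[i]) (B : R) :
  (forall k i, nrm (w k i) <= B) -> exists l : 'I_n -> R[i],
  forall (e : R) N, 0 < e -> exists k, (N <= k)%N /\ forall i, nrm (w k i - l i) <= e.
Proof.
move=> hB.
pose u k : 'rV[R]_(n + n) :=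
  row_mx (\row_i complex.Re (w k i)) (\row_i complex.Im (w k i)).
have ReIm (a : R[i]) : `|complex.Re a| <= nrm a /\ `|complex.Im a| <= nrm a.
  have aE : nrm a = Num.sqrt (complex.Re a ^+ 2 + complex.Im a ^+ 2).
    by rewrite /nrm normc_def.
  by rewrite aE -!sqrtr_sqr !ler_sqrt ?addr_ge0 ?sqr_ge0 // lerDl lerDr !sqr_ge0.
have uB k i : u k ord0 i \in `[- B, B].
  rewrite in_itv /= -ler_norml /u; case: (split_ordP i) => j ->.
    by rewrite row_mxEl mxE (le_trans (ReIm _).1).
  by rewrite row_mxEr mxE (le_trans (ReIm _).2).
have cK := @rV_compact R (n + n) (fun=> `[- B, B]%classic)
  (fun=> @segment_compact _ _ _).
have [|p [_ cp]] := cK (u @ \oo) _.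
  by exists 0%N => // k _ i /=; have := uB k i.
pose l i := (p ord0 (lshift n i)) +i* (p ord0 (rshift n i)).
exists l => e N e0.
have e2 : 0 < e / 2 by lra.
have [q []] := cp [set v | exists2 k, (N <= k)%N & v = u k] (ball p (e / 2))
  ltac:(by exists N => // k /= hk; exists k) (nbhsx_ballx _ _ e2).
move=> [k Nk ->] hball; exists k; split => // i.
case: hball => _ hball.
have hR := hball ord0 (lshift n i); have hI := hball ord0 (rshift n i).
move: hR hI; rewrite /ball /= /u row_mxEl row_mxEr !mxE => hR hI.
have -> : w k i - l i =
    (complex.Re (w k i) - p ord0 (lshift n i))%:C +
    'i%C * (complex.Im (w k i) - p ord0 (rshift n i))%:C.
  by rewrite [LHS]complexE /l; case: (w k i) => ? ?; rewrite /= !rmorphB.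
rewrite (le_trans (nrmD _ _)) // nrmM !nrmr.
have -> : nrm ('i%C : R[i]) = 1.
  by rewrite /nrm normc_def /= expr0n add0r expr1n sqrtr1.
rewrite mul1r distrC [X in _ + X]distrC [leRHS]splitr lerD // ltW //.
Qed.
End ComplexCluster.

Section ExactApproximation.
Context (R : realType) (H : completeNormedModType R[i]).
Context (dot : {dot H for Num.conj}) (hdot : hilbert_dot dot).
Context (d : nat) (T : 'I_d.+1 -> {linear H -> H}).
Hypothesis bT : forall k, bounded_op (T k).
Hypothesis cT : commuting_tuple T.
Variable rho : R.
Hypothesis rho0 : 0 < rho.
Hypothesis hU : forall t, rho < t -> growth_le T (t ^+ 2).
Hypothesis hL : forall s, 0 < s < rho -> ~ growth_le T (s ^+ 2).

(** The limit of [approximate_eigenvalue] for [k = eps = 1 / (n + 1)]. The vectors need not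
    converge: the parameters have a cluster point, and replacing them by it costs an error uniform
    in the vector since [T] is bounded. *)
Lemma exists_approximate_eigenvalue : exists (c : 'I_d.+1 -> R[i]) (z : R[i]),
  [/\ \sum_(k < d.+1) nrm (c k) ^+ 2 = 1, nrm z = rho &
   forall e : R, 0 < e -> exists x : H, x != 0 /\
     nrm (z *: x - combination T c x) <= e * nrm x].
Proof.
have n0 n : 0 < n.+1%:R^-1 :> R by rewrite invr_gt0.
have ex n : exists w : 'I_d.+1 -> R[i], exists (z : R[i]) (x : H),
    [/\ \sum_(j < d.+1) nrm (w j) ^+ 2 = 1, rho < nrm z <= rho + n.+1%:R^-1, x != 0 &
        nrm (x - z^-1 *: combination T w x) < n.+1%:R^-1 * nrm x].
  exact: approximate_eigenvalue.
have [c hc] := choice ex; have [z hz] := choice hc; have [x hx] := choice hz.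
have c1 n j : nrm (c n j) <= 1.
  have [h _ _ _] := hx n.
  rewrite -(ler_pXn2r (n := 2)) ?nnegrE ?nrm_ge0 // expr1n -h (bigD1 j) //= lerDl.
  by rewrite sumr_ge0 // => i _; rewrite sqr_ge0.
have zB n : nrm (z n) <= rho + 1.
  have [_ /andP[_ h] _ _] := hx n; rewrite (le_trans h) // lerD2l.
  by rewrite invf_le1 // ler1n.
(* Appending [z n] to [c n] yields a common cluster point. *)
pose w (n : nat) (i : 'I_(d.+1 + 1)) : R[i] :=
  match fintype.split i with inl j => c n j | inr _ => z n end.
have wB n i : nrm (w n i) <= rho + 1.
  rewrite /w; case: (fintype.split i) => // j; rewrite (le_trans (c1 _ _)) // lerDr.
  exact: ltW.
have [l hl] := complex_cluster wB.
pose cc j := l (lshift 1 j); pose zz := l (rshift d.+1 ord0).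
have hl' (e : R) N : 0 < e -> exists n, [/\ (N <= n)%N,
    forall j, nrm (c n j - cc j) <= e & nrm (z n - zz) <= e].
  move=> /(hl e N)[n [Nn hn]]; exists n; split => // [j|].
    by have := hn (lshift 1 j); rewrite /w (unsplitK (inl _ j)).
  by have := hn (rshift d.+1 ord0); rewrite /w (unsplitK (inr _ ord0)).
have nrm_dist (a b : R[i]) : `|nrm a - nrm b| <= nrm (a - b).
  rewrite ler_norml; apply/andP; split; last by rewrite lerBlDl nrm_le_add.
  by rewrite lerNl opprB lerBlDl nrmBC nrm_le_add.
have cc1 : \sum_(k < d.+1) nrm (cc k) ^+ 2 = 1.
  apply/eqP; rewrite eq_sym -subr_eq0 -normr_le0.
  apply: le_of_le_add => e e0; rewrite add0r.
  (* The 3 comes from [|p^2 - q^2| <= 3 |p - q|], valid as [p <= 1] and [q <= 1 + e' <= 2]. *)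
  pose e' := Num.min 1 (e / (3 * d.+1%:R)).
  have D0 : 0 < 3 * d.+1%:R :> R by rewrite mulr_gt0.
  have e'0 : 0 < e' by rewrite lt_min ltr01 divr_gt0.
  have e'1 : e' <= 1 by rewrite ge_min lexx.
  have e'2 : e' * (3 * d.+1%:R) <= e by rewrite -ler_pdivlMr // ge_min lexx orbT.
  have [n [_ hn _]] := hl' _ 0%N e'0.
  have [<- _ _ _] := hx n; rewrite -sumrB (le_trans (ler_norm_sum _ _ _)) //.
  apply: (@le_trans _ _ (\sum_(k < d.+1) 3 * e')).
    apply: ler_sum => k _.
    have := le_trans (nrm_dist _ _) (hn k); have := c1 n k.
    have := nrm_ge0 (c n k); have := nrm_ge0 (cc k).
    rewrite !ler_norml; move: (nrm (c n k)) (nrm (cc k)) => p q q0 p0 p1 /andP[h1 h2].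
    by apply/andP; split; nra.
  rewrite sumr_const card_ord; set W := 3 * e'.
  rewrite -[W *+ _]mulr_natl (le_trans _ e'2) // /W mulrA mulrC (mulrC 3) //.
have zz1 : nrm zz = rho.
  apply/eqP; rewrite -subr_eq0 -normr_le0; apply: le_of_le_add => e e0.
  rewrite add0r; have e2 : 0 < e / 2 by lra.
  have [N hN] := small_invS e2.
  have [n [/hN h1 _ h2]] := hl' _ N e2; have [_ /andP[h3 h4] _ _] := hx n.
  have := le_trans (nrm_dist _ _) h2; rewrite !ler_norml => /andP[h5 h6].
  have h7 := le_trans h4 (lerD (lexx rho) h1).
  by apply/andP; split; lra.
exists cc, zz; split => // e e0.
have [C hC] : exists C : R, forall k y, nrm (T k y) <= C * nrm y.
  have h k : exists D : R, 0 <= D /\ forall y, nrm (T k y) <= D * nrm y.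
    by have [D D0 hD] := bT k; exists D; split => //; apply: ltW.
  have [D /all_and2[D0 hD]] := choice h.
  exists (\sum_(k < d.+1) D k) => k y; rewrite (le_trans (hD _ _)) //.
  by rewrite ler_wpM2r ?nrm_ge0 // (bigD1 k) //= lerDl sumr_ge0.
(* The summands of [F] belong to the errors from [zz - z n], from the approximate eigenvector of
   index [n], and from [c n - cc]. *)
pose F := 1 + (rho + 1) + d.+1%:R * `|C|.
have F0 : 0 < F.
  have : 0 <= d.+1%:R * `|C| by rewrite mulr_ge0.
  by move=> h; rewrite /F ltr_wpDr // addr_gt0 // addr_gt0.
have e0' : 0 < e / F by rewrite divr_gt0.
have [N hN] := small_invS e0'.
have [n [/hN h1 h2 h3]] := hl' _ N e0'; have [_ /andP[h4 _] xn0 h5] := hx n.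
exists (x n); split => //.
have zn0 : z n != 0 by rewrite -nrm_gt0 (lt_trans rho0).
have -> : zz *: x n - combination T cc (x n) =
    (zz - z n) *: x n + (z n *: (x n - (z n)^-1 *: combination T (c n) (x n)) +
      \sum_(k < d.+1) (c n k - cc k) *: T k (x n)).
  have -> : \sum_(k < d.+1) (c n k - cc k) *: T k (x n) =
      combination T (c n) (x n) - combination T cc (x n).
    by rewrite /= -sumrB; apply: eq_bigr => k _; rewrite scalerBl.
  move: (combination T (c n) (x n)) (combination T cc (x n)) => u v.
  have e1 : z n *: (x n - (z n)^-1 *: u) = z n *: x n - u.
    by rewrite scalerBr scalerA divff // scale1r.
  by rewrite e1 scalerBl !addrA !subrK.
have -> : e * nrm (x n) = e / F * nrm (x n) + ((rho + 1) * (e / F * nrm (x n)) +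
    d.+1%:R * `|C| * (e / F) * nrm (x n)).
  have {1}-> : e = e / F * F by rewrite divfK // gt_eqF.
  by move: (e / F) => q; rewrite /F; ring.
have xn := nrm_ge0 (x n).
rewrite (le_trans (nrmD _ _)) // lerD //.
  by rewrite nrmZ nrmBC ler_wpM2r.
rewrite (le_trans (nrmD _ _)) // lerD //.
  rewrite nrmZ ler_pM ?nrm_ge0 // (le_trans (ltW h5)) // ler_wpM2r //.
rewrite (le_trans (nrm_sum _ _ _)) //.
apply: (@le_trans _ _ (\sum_(k < d.+1) `|C| * (e / F) * nrm (x n))).
  apply: ler_sum => k _; rewrite nrmZ [X in _ <= X]mulrAC [X in _ <= X]mulrC.
  rewrite ler_pM ?nrm_ge0 // (le_trans (hC k _)) // ler_wpM2r // ler_norm //.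
by rewrite sumr_const card_ord -[leLHS]mulr_natl !mulrA.
Qed.

End ExactApproximation.

(** * Components orthogonal to a combination *)

Section OrthogonalComponents.
Context (R : realType) (H : completeNormedModType R[i]).
Context (dot : {dot H for Num.conj}) (hdot : hilbert_dot dot).
Context (d : nat) (T : 'I_d -> {linear H -> H}).
Hypothesis cT : commuting_tuple T.
Variable c : 'I_d -> R[i].
Hypothesis c1 : \sum_(k < d) nrm (c k) ^+ 2 = 1.

Local Notation S := (combination T c).

Lemma component_linear k : linear (fun x => T k x - (c k)^* *: S x).
Proof.
move=> a x y; have SP : S (a *: x + y) = a *: S x + S y by exact: linearP.
by rewrite linearP SP scalerDr opprD addrACA scalerBr !scalerA mulrC.
Qed.

(* [S] and the [N_k] are the components of the column [T] along the unit vector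
   conjugate to [c] and orthogonally to it. *)
Definition component k := linear_of (component_linear k).

Local Notation N := component.

(** With [s = sum_j c_j x_j], the families [conj(c) s] and [x - conj(c) s] are orthogonal in the
    direct sum of [d] copies of [H]. *)
Lemma word_normsq_pythagoras n (x : 'I_d -> H) :
  \sum_(k < d) word_normsq T n (x k) =
  word_normsq T n (\sum_(j < d) c j *: x j) +
  \sum_(k < d) word_normsq T n (x k - (c k)^* *: \sum_(j < d) c j *: x j).
Proof.
elim: n x => [|n IHn] x; rewrite /word_normsq /=.
  set s := \sum_(j < d) c j *: x j.
  have e1 : \sum_(k < d) nrm (x k - (c k)^* *: s) ^+ 2 =
      \sum_(k < d) nrm (x k) ^+ 2 + nrm s ^+ 2 - 2 * nrm s ^+ 2.
    under eq_bigr => k _.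
      rewrite (nrm_subsq hdot) nrmZ nrm_conj exprMn dotZr conjCK -dotZl.
      over.
    rewrite sumrB big_split /= -mulr_suml c1 mul1r; congr (_ - _).
    by rewrite -mulr_sumr -Re_sum -dot_suml (Re_dotxx hdot).
  rewrite e1; ring.
under eq_bigr => k _ do rewrite -/(word_normsq T n _).
rewrite exchange_big /= [X in _ + X]exchange_big /= -big_split.
apply: eq_bigr => i _ /=; rewrite [LHS]IHn.
have e1 : T i (\sum_(j < d) c j *: x j) = \sum_(j < d) c j *: T i (x j).
  by rewrite linear_sum; apply: eq_bigr => j _; rewrite linearZ.
congr (_ + _); first by rewrite e1.
apply: eq_bigr => k _; congr word_sum.
by rewrite -e1 linearB; congr (_ - _); rewrite linearZ.
Qed.

Lemma word_normsqS_components n x : word_normsq T n.+1 x =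
  word_normsq T n (S x) + \sum_(k < d) word_normsq T n (N k x).
Proof. by rewrite -(word_normsq_pythagoras n (fun k => T k x)). Qed.

Lemma combination_component k x : S (N k x) = N k (S x).
Proof.
have e1 : S (T k x - (c k)^* *: S x) = S (T k x) - (c k)^* *: S (S x).
  by rewrite linearB; congr (_ - _); rewrite linearZ.
rewrite -[N k x]/(T k x - (c k)^* *: S x) e1.
by rewrite -[N k (S x)]/(T k (S x) - (c k)^* *: S (S x)) (combination_comm cT).
Qed.

(** Each letter contributes at least [S] and [N k]. Of the resulting words, ['C(M, m)] contain [N k]
    exactly [m] times, and they coincide since [S] and [N k] commute. *)
Lemma word_normsq_ge_component k M m x :
  'C(M, m)%:R * nrm (iter (M - m) S (iter m (N k) x)) ^+ 2 <= word_normsq T M x.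
Proof.
have hNk n y : word_normsq T n (S y) + word_normsq T n (N k y) <= word_normsq T n.+1 y.
  rewrite word_normsqS_components lerD2l (bigD1 k) //= lerDl sumr_ge0 // => i _.
  exact: word_normsq_ge0.
elim: M m x => [|M IHM] [|m] x.
- by rewrite bin0 mul1r.
- by rewrite bin0n mul0r word_normsq_ge0.
- rewrite bin0 mul1r subn0 iterSr.
  have := IHM 0%N (S x); rewrite bin0 mul1r subn0 => h.
  have := hNk M x; have := word_normsq_ge0 T M (N k x); rewrite /=; lra.
apply: le_trans (hNk M x); rewrite binS natrD mulrDl subSS.
apply: lerD; last by have := IHM m (N k x); rewrite -iterSr.
have [Mm|mM] := leqP M m.
  by rewrite bin_small ?ltnS // mul0r word_normsq_ge0.
have := IHM m.+1 (S x).
rewrite -(iter_comm (A := S)) => [|y]; last exact: combination_component.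
by rewrite -iterSr subnSK.
Qed.

End OrthogonalComponents.

(** The quotients [(p m - i) / (m - i)] are at least [p]. *)
Lemma expn_le_bin p m : (p ^ m <= 'C(p * m, m))%N.
Proof.
case: p => [|p]; first by case: m => [//|m]; rewrite exp0n.
have ffact_le j : (j <= m)%N -> (p.+1 ^ j * m ^_ j <= (p.+1 * m) ^_ j)%N.
  elim: j => [//|j IHj] jm; rewrite !ffactnSr expnSr mulnACA leq_mul //.
    by rewrite IHj // ltnW.
  by rewrite mulnBr leq_sub2l // leq_pmull.
have := ffact_le m (leqnn m); rewrite ffactnn -bin_ffact.
by rewrite leq_pmul2r ?fact_gt0.
Qed.

Section PowerRatio.
Context (R : realType) (H : completeNormedModType R[i]).

Lemma iter_le (A : {linear H -> H}) (C : R) : 0 <= C ->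
  (forall x, nrm (A x) <= C * nrm x) ->
  forall n x, nrm (iter n A x) <= C ^+ n * nrm x.
Proof.
move=> C0 hC; elim=> [|n IHn] x; first by rewrite expr0 mul1r.
rewrite (le_trans (hC _)) // exprS -mulrA.
exact: ler_wpM2l C0 _ _ (IHn x).
Qed.

(** [j] is the last index below [m] at which the lower bound holds, so the step after it must
    contract by [eta]. *)
Lemma power_ratio (A : {linear H -> H}) (eta : R) m x : 0 < eta ->
  nrm (iter m A x) <= eta ^+ m * nrm x -> x != 0 -> (0 < m)%N ->
  exists j, [/\ (j < m)%N, eta ^+ j * nrm x <= nrm (iter j A x) &
    nrm (iter j.+1 A x) <= eta * nrm (iter j A x)].
Proof.
move=> eta0 + x0; elim: m => [//|m IHm] hm _.
have [h|h] := leP (eta ^+ m * nrm x) (nrm (iter m A x)).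
  exists m; split => //; rewrite (le_trans hm) // exprS -mulrA.
  exact: ler_wpM2l (ltW eta0) _ _ h.
case: m IHm hm h => [|m] IHm hm h; first by rewrite expr0 mul1r ltxx in h.
by have [j [jm h1 h2]] := IHm (ltW h) isT; exists j; split => //; rewrite ltnW.
Qed.

Lemma iter_comm_le (A G : {linear H -> H}) (C e : R) j x : 0 <= C ->
  (forall x, nrm (A x) <= C * nrm x) -> (forall x, G (A x) = A (G x)) ->
  nrm (G x) <= e * nrm x -> nrm (G (iter j A x)) <= C ^+ j * (e * nrm x).
Proof.
move=> C0 hC GA h; rewrite iter_comm // (le_trans (iter_le C0 hC j _)) //.
exact: ler_wpM2l (exprn_ge0 _ C0) _ _ h.
Qed.

End PowerRatio.

(** * From a combination to joint approximate eigenvectors *)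

Section JointApproximation.
Context (R : realType) (H : completeNormedModType R[i]).
Context (dot : {dot H for Num.conj}) (hdot : hilbert_dot dot).
Context (d : nat) (T : 'I_d -> {linear H -> H}).
Hypothesis bT : forall k, bounded_op (T k).
Hypothesis cT : commuting_tuple T.
Variable c : 'I_d -> R[i].
Hypothesis c1 : \sum_(k < d) nrm (c k) ^+ 2 = 1.
Variable rho : R.
Hypothesis rho0 : 0 < rho.
Hypothesis hU : forall t, rho < t -> growth_le T (t ^+ 2).
Variable z : R[i].
Hypothesis z_rho : nrm z = rho.

Local Notation S := (combination T c).
Local Notation N := (component T c).

Lemma bounded_component k : bounded_op (N k).
Proof.
have [A A0 hA] := bT k; have [B B0 hB] := bounded_combination bT c.
exists (A + nrm (c k) * B); first by rewrite ltr_wpDr // mulr_ge0 ?nrm_ge0 // ltW.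
move=> x; rewrite (le_trans (nrmB _ _)) // mulrDl lerD // nrmZ nrm_conj -mulrA.
by rewrite ler_wpM2l ?nrm_ge0.
Qed.

Lemma component_comm i k x : N i (N k x) = N k (N i x).
Proof.
have h (a b : 'I_d) y : N a (N b y) =
    T a (T b y) - (c b)^* *: S (T a y) - (c a)^* *: S (N b y).
  rewrite -[N a _]/(T a (N b y) - _); congr (_ - _).
  rewrite -[N b y]/(T b y - (c b)^* *: S y) linearB; congr (_ - _).
  have -> : T a ((c b)^* *: S y) = (c b)^* *: T a (S y) by exact: linearZ.
  by rewrite (combination_comm cT).
have h2 (a b : 'I_d) y : N a (N b y) = T a (T b y) -
    ((c b)^* *: S (T a y) + (c a)^* *: S (T b y)) + ((c a)^* * (c b)^*) *: S (S y).
  rewrite h -[N b y]/(T b y - (c b)^* *: S y).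
  have -> : S (T b y - (c b)^* *: S y) = S (T b y) - (c b)^* *: S (S y).
    by rewrite linearB; congr (_ - _); exact: linearZ.
  by rewrite scalerBr scalerA !opprD opprK !addrA.
by rewrite !h2 cT addrC [RHS]addrC mulrC; congr (_ + (_ - _)); rewrite addrC.
Qed.

Lemma iter_combination_near j : exists2 D : R, 0 <= D & forall x (e : R),
  nrm (z *: x - S x) <= e * nrm x -> nrm (z ^+ j *: x - iter j S x) <= D * e * nrm x.
Proof.
elim: j => [|j [D D0 hD]].
  by exists 0 => // x e _; rewrite expr0 scale1r subrr nrm0 !mul0r.
have [C C0 hC] := bounded_combination bT c.
exists (C * D + rho ^+ j).
  by rewrite addr_ge0 ?mulr_ge0 ?(ltW C0) // exprn_ge0 // ltW.
move=> x e hx; have := hD x e hx => h.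
have -> : z ^+ j.+1 *: x - iter j.+1 S x =
    z ^+ j *: (z *: x - S x) + S (z ^+ j *: x - iter j S x).
  have -> : S (z ^+ j *: x - iter j S x) = z ^+ j *: S x - S (iter j S x).
    by rewrite linearB; congr (_ - _); exact: linearZ.
  by rewrite scalerBr scalerA -exprSr addrA subrK.
rewrite (le_trans (nrmD _ _)) // [leRHS](_ : _ = rho ^+ j * (e * nrm x) + C * (D * e * nrm x)).
  rewrite lerD // ?nrmZ ?nrmX ?z_rho.
    exact: ler_wpM2l (exprn_ge0 j (ltW rho0)) _ _ hx.
  by rewrite (le_trans (hC _)) // ler_wpM2l // ltW.
ring.
Qed.

(** If [x] is an approximate eigenvector of [S], then [|S^j N_k^m x|] is about [rho^j |N_k^m x|].
    For [j = p m - m], the growth bound at length [p m] and ['C(p m, m) >= p^m] then bound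
    [p^m rho^(2j) |N_k^m x|^2] by roughly [K t^(2pm) |x|^2]; a large [p] makes [N_k^m x] small. *)
Lemma component_power_small k (eta : R) : 0 < eta -> exists m (del : R),
  [/\ (0 < m)%N, 0 < del & forall x, nrm (z *: x - S x) <= del * nrm x ->
    nrm (iter m (N k) x) <= eta ^+ m * nrm x].
Proof.
move=> eta0.
(* One factor 4 of the 16 absorbs the ratio of [t^(2p)] to [rho^(2p)], the other one absorbs [4 K]
   through the choice of [m]. *)
pose p := (Num.truncn (16 * rho ^+ 2 / eta ^+ 2)).+1.
have e2 : 0 < eta ^+ 2 by rewrite exprn_gt0.
have hp : 16 * rho ^+ 2 <= eta ^+ 2 * p%:R.
  by rewrite [leRHS]mulrC -ler_pdivrMr // ltW // truncnS_gt.
have p0 : 1 <= p%:R :> R by rewrite ler1n.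
(* Chosen so that [(1 - a)^(2p) >= 1 - 2 p a = 1/4], that is [t^(2p) <= 4 rho^(2p)]. *)
pose a : R := 3 / 8 / p%:R.
have ap : a * p%:R = 3 / 8 by rewrite /a divfK // gt_eqF // (lt_le_trans _ p0).
have a0 : 0 < a by rewrite /a divr_gt0 // (lt_le_trans _ p0).
have a1 : a <= 3 / 8 by rewrite -ap ler_peMr // ltW.
have a1' : 0 < 1 - a by lra.
have [t [rt rE]] : exists t, rho < t /\ rho = t * (1 - a).
  exists (rho / (1 - a)); rewrite divfK ?gt_eqF //; split => //.
  by rewrite ltr_pdivlMr // gtr_pMr //; lra.
have [K' hK'] := hU rt; pose K := `|K'|.
have tp : t ^+ (2 * p) <= 4 * rho ^+ (2 * p).
  have := @bernoulli R (- a) (2 * p) ltac:(lra); rewrite natrM => h.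
  have h4 : 4^-1 <= (1 - a) ^+ (2 * p) by move: h; lra.
  rewrite rE exprMn mulrCA -[leLHS]mulr1 ler_wpM2l //.
    by rewrite exprn_ge0 // (le_trans (ltW rho0)) // ltW.
  by move: h4; lra.
pose m := (Num.truncn (4 * K)).+1.
have m4 : 4 * K <= 4 ^+ m.
  have h1 : 4 * K <= m%:R by rewrite ltW // truncnS_gt.
  have := @bernoulli R 3 m ltac:(lra) => h2; move: h1 h2; rewrite (_ : 1 + 3 = 4 :> R); last by lra.
  have := ler0n R m; lra.
pose j := ((p * m) - m)%N.
have pm : (p * m = m + j)%N by rewrite subnKC // leq_pmull.
have [D D0 hD] := iter_combination_near j.
have [B0 B00 hB0] := bounded_component k.
pose B := B0 ^+ m; have Bp : 0 <= B by rewrite exprn_ge0 // ltW.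
have hB x : nrm (iter m (N k) x) <= B * nrm x by exact: iter_le (ltW B00) hB0 m x.
have rj : 0 < rho ^+ j by rewrite exprn_gt0.
have em : 0 < eta ^+ m by rewrite exprn_gt0.
have BD1 : 0 < B * D + 1 by rewrite ltr_wpDl // mulr_ge0.
(* Half of the allowed size goes to the error of replacing [z^j x] by [S^j x]; [Y1] takes the other
   half. *)
exists m, (eta ^+ m * rho ^+ j / (2 * (B * D + 1))); split=> //.
  by rewrite divr_gt0 ?mulr_gt0.
move=> x; set del := (X in X * _) => hx.
have Y1 : nrm (iter j S (iter m (N k) x)) <= eta ^+ m * rho ^+ j / 2 * nrm x.
  rewrite -(ler_pXn2r (n := 2)) ?nnegrE ?nrm_ge0 //; last first.
    by rewrite !mulr_ge0 ?nrm_ge0 // ltW.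
  have := le_trans (word_normsq_ge_component hdot cT c1 k (p * m) m x) (hK' _ x).
  rewrite -/j; set Y := nrm _ ^+ 2; set X := nrm x ^+ 2 => hY.
  have Y0 : 0 <= Y by rewrite sqr_ge0.
  have X0 : 0 <= X by rewrite sqr_ge0.
  have h1 : p%:R ^+ m * Y <= K * (4 ^+ m * rho ^+ (2 * p) ^+ m) * X.
    apply: (@le_trans _ _ ('C(p * m, m)%:R * Y)).
      by rewrite ler_wpM2r // -natrX ler_nat expn_le_bin.
    apply: le_trans hY _; apply: ler_wpM2r => //.
    have t2 : 0 <= (t ^+ 2) ^+ (p * m) by rewrite exprn_ge0 // sqr_ge0.
    apply: (@le_trans _ _ (K * (t ^+ 2) ^+ (p * m))).
      by apply: ler_wpM2r => //; exact: ler_norm.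
    apply: ler_wpM2l; first exact: normr_ge0.
    have -> : t ^+ 2 ^+ (p * m) = t ^+ (2 * p) ^+ m by rewrite -!exprM mulnA.
    have -> : 4 ^+ m * rho ^+ (2 * p) ^+ m = (4 * rho ^+ (2 * p)) ^+ m by rewrite exprMn.
    apply: lerXn2r => //; rewrite nnegrE.
      by rewrite exprn_ge0 // (le_trans (ltW rho0)) // ltW.
    by rewrite mulr_ge0 // exprn_ge0 // ltW.
  have h2 : (16 * rho ^+ 2) ^+ m <= (eta ^+ 2 * p%:R) ^+ m.
    apply: lerXn2r => //; rewrite nnegrE; first by rewrite mulr_ge0 // sqr_ge0.
    by rewrite mulr_ge0 // ltW.
  have e2m : 0 < eta ^+ 2 ^+ m by rewrite exprn_gt0.
  have r2m : 0 < rho ^+ 2 ^+ m by rewrite !exprn_gt0.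
  have f4 : 0 < 4 ^+ m :> R by rewrite exprn_gt0.
  have r2j : 0 < rho ^+ 2 ^+ j by rewrite !exprn_gt0.
  have h3 : 4 ^+ m * Y <= K * eta ^+ 2 ^+ m * rho ^+ 2 ^+ j * X.
    rewrite -(ler_pM2l f4) -(ler_pM2l r2m).
    have e1 : rho ^+ 2 ^+ m * (4 ^+ m * (4 ^+ m * Y)) = (16 * rho ^+ 2) ^+ m * Y.
      rewrite (exprMn m 16) (_ : 16 = 4 * 4); last by lra.
      by rewrite (exprMn m 4); ring.
    rewrite e1 (le_trans (ler_wpM2r Y0 h2)) // (exprMn m (eta ^+ 2)) -[leLHS]mulrA.
    apply: le_trans (ler_wpM2l (ltW e2m) h1) _.
    have -> : rho ^+ (2 * p) ^+ m = rho ^+ 2 ^+ m * rho ^+ 2 ^+ j.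
      by rewrite -exprD -pm exprM -exprM.
    by rewrite le_eqVlt; apply/orP; left; apply/eqP; ring.
  have h4 : 4 * K * Y <= K * (eta ^+ 2 ^+ m * rho ^+ 2 ^+ j * X).
    by rewrite (le_trans (ler_wpM2r Y0 m4)) // (le_trans h3) // !mulrA.
  have E0 : 0 <= eta ^+ 2 ^+ m * rho ^+ 2 ^+ j * X.
    exact: mulr_ge0 (mulr_ge0 (ltW e2m) (ltW r2j)) X0.
  have -> : (eta ^+ m * rho ^+ j / 2 * nrm x) ^+ 2 =
      eta ^+ 2 ^+ m * rho ^+ 2 ^+ j * X / 4.
    by rewrite -!exprM !(mulnC 2) !exprM /X; field.
  have K0 : 0 <= K by exact: normr_ge0.
  have [K00|Kp] := eqVneq K 0.
    have : 4 ^+ m * Y <= 0 by rewrite (le_trans h3) // K00 !mul0r.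
    rewrite pmulr_rle0 // => Y00; rewrite (le_trans Y00) // divr_ge0 //.
  have {Kp} {}K0 : 0 < K by rewrite lt_def Kp.
  by move: h4; rewrite mulrAC mulrC ler_pM2l //; lra.
have key : rho ^+ j * nrm (iter m (N k) x) <= rho ^+ j * (eta ^+ m * nrm x).
  have -> : rho ^+ j * nrm (iter m (N k) x) = nrm (iter m (N k) (z ^+ j *: x)).
    by rewrite iter_scale nrmZ nrmX z_rho.
  have -> : z ^+ j *: x = (z ^+ j *: x - iter j S x) + iter j S x by rewrite subrK.
  have -> : iter m (N k) (z ^+ j *: x - iter j S x + iter j S x) =
     iter m (N k) (z ^+ j *: x - iter j S x) + iter j S (iter m (N k) x).
    rewrite -[X in X + iter j S x]scale1r iterP scale1r; congr (_ + _).
    elim: (j) => [//|q IHq]; rewrite [iter q.+1 S x]iterS [RHS]iterS -IHq.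
    by symmetry; apply: iter_comm => y; exact: combination_component.
  rewrite (le_trans (nrmD _ _)) //.
  have h1 := le_trans (hB _) (ler_wpM2l Bp (hD x del hx)).
  have h2 : B * D * del <= eta ^+ m * rho ^+ j / 2.
    have -> : eta ^+ m * rho ^+ j / 2 = (B * D + 1) * del.
      by rewrite /del; field; rewrite gt_eqF.
    by rewrite ler_wpM2r ?lerDl // /del divr_ge0 ?mulr_ge0 ?ltW.
  have h3 := ler_wpM2r (nrm_ge0 x) h2; move: h1 h3 Y1; rewrite !mulrA.
  by rewrite (mulrC (rho ^+ j)); lra.
by rewrite -(ler_pM2l rj).
Qed.

Hypothesis hS : forall e : R, 0 < e -> exists x : H, x != 0 /\
  nrm (z *: x - S x) <= e * nrm x.

(** Induction on the number [n] of components already small. The vector [x] is replaced by [N_k^j x]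
    with [j] from [power_ratio]: there [N_k] is small, and what commutes with [N_k] stays small
    because [N_k^j x] has norm at least [eta^j |x|]. *)
Lemma joint_components_small n (eta : R) : 0 < eta -> exists x, [/\ x != 0,
  nrm (z *: x - S x) <= eta * nrm x &
  forall i : 'I_d, (i < n)%N -> nrm (N i x) <= eta * nrm x].
Proof.
elim: n eta => [|n IHn] eta eta0.
  by have [x [x0 hx]] := hS eta0; exists x.
have [dn|nd] := leqP d n.
  have [x [x0 hx hN]] := IHn eta eta0; exists x; split => // i _.
  by apply: hN; rewrite (leq_trans _ dn).
pose k := Ordinal nd.
have [m [del [m0 del0 hm]]] := component_power_small k eta0.
have [C C0 hC] := bounded_component k.
(* The loss [(C / eta)^j] in passing to [N_k^j x] is at most [q^m] for every [j < m], so [eta'] can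
   be chosen before [j]. *)
pose q := 1 + C / eta.
have Ce : 0 < C / eta by rewrite divr_gt0.
have q1 : 1 <= q by rewrite lerDl ltW.
have qm : 0 < q ^+ m by rewrite exprn_gt0 // (lt_le_trans ltr01).
pose eta' := Num.min del (eta / q ^+ m).
have eta'0 : 0 < eta' by rewrite lt_min del0 divr_gt0.
have [x [x0 hx hN]] := IHn eta' eta'0.
have hx1 : nrm (z *: x - S x) <= del * nrm x.
  by rewrite (le_trans hx) // ler_wpM2r ?nrm_ge0 // ge_min lexx.
have [j [jm hj hj1]] := power_ratio eta0 (hm x hx1) x0 m0.
have ej : 0 < eta ^+ j by rewrite exprn_gt0.
have small : C ^+ j * (eta' * nrm x) <= eta * nrm (iter j (N k) x).
  apply: le_trans (ler_wpM2l (ltW eta0) hj).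
  rewrite mulrA [leRHS]mulrA ler_wpM2r ?nrm_ge0 //.
  apply: (@le_trans _ _ (C ^+ j * (eta / q ^+ m))).
    by rewrite ler_wpM2l ?exprn_ge0 ?(ltW C0) // ge_min lexx orbT.
  rewrite mulrCA ler_wpM2l ?(ltW eta0) // ler_pdivrMr // mulrC -ler_pdivrMr //.
  rewrite -expr_div_n; apply: (@le_trans _ _ (q ^+ j)).
    by apply: lerXn2r; rewrite ?nnegrE ?(ltW Ce) ?(le_trans ler01 q1) // lerDr.
  by rewrite ler_weXn2l // ltnW.
exists (iter j (N k) x); split.
- by rewrite -nrm_gt0 (lt_le_trans _ hj) // mulr_gt0 ?nrm_gt0.
- apply: le_trans small.
  have Gl : linear (fun y => z *: y - S y).
    move=> a u v; have SP : S (a *: u + v) = a *: S u + S v by exact: linearP.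
    by rewrite SP scalerDr opprD addrACA scalerBr !scalerA (mulrC z).
  apply: (iter_comm_le (G := linear_of Gl) j (ltW C0) hC) => // y.
  rewrite -[LHS]/(z *: N k y - S (N k y)) combination_component //.
  have -> : linear_of Gl y = z *: y - S y by [].
  have NZ : N k (z *: y) = z *: N k y by exact: linearZ.
  have NB : N k (z *: y - S y) = N k (z *: y) - N k (S y) by exact: linearB.
  by rewrite NB NZ.
- move=> i; rewrite ltnS leq_eqVlt => /orP[/eqP ik|lin].
    by have -> : i = k by exact: val_inj.
  apply: le_trans small; apply: iter_comm_le (ltW C0) hC _ (hN i lin) => y.
  exact: component_comm.
Qed.

Lemma joint_approximate_eigenvector (eta : R) : 0 < eta -> exists x, x != 0 /\
  forall k, nrm (T k x - (z * (c k)^*) *: x) <= eta * nrm x.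
Proof.
move=> eta0; have [|x [x0 hx hN]] := @joint_components_small d (eta / 2); first lra.
exists x; split => // k.
have -> : T k x - (z * (c k)^*) *: x = N k x - (c k)^* *: (z *: x - S x).
  rewrite -[N k x]/(T k x - (c k)^* *: S x) scalerBr scalerA (mulrC z).
  by rewrite opprB addrA subrK.
rewrite (le_trans (nrmB _ _)) // [eta]splitr mulrDl lerD ?hN //.
rewrite nrmZ nrm_conj (le_trans _ hx) // ler_piMl ?nrm_ge0 //.
rewrite -(@expr_le1 _ 2) ?nrm_ge0 // -c1 (bigD1 k) //= lerDl sumr_ge0 // => i _.
by rewrite sqr_ge0.
Qed.

End JointApproximation.

(** * Koszul complexes at joint approximate eigenvalues *)

Section KoszulApproximateKernel.
Context (R : realType) (H : completeNormedModType R[i]).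
Context (dot : {dot H for Num.conj}) (hdot : hilbert_dot dot).
Context (d : nat) (A : 'I_d -> {linear H -> H}).
Hypothesis bA : forall k, bounded_op (A k).
Hypothesis cA : commuting_tuple A.

(** These are the chains of degree 0; the differential sends them to the families of the [A j x]. *)
Definition vacuum (x : H) (S : {set 'I_d}) : H := if S == finset.set0 then x else 0.

Lemma koszul_diff_set1 g j : koszul_diff A g [set j]%SET = A j (g finset.set0).
Proof.
rewrite /koszul_diff finset.big_set1 (_ : ([set j] :\ j)%SET = finset.set0).
  rewrite (_ : [set i in [set j]%SET | (i < j)%N]%SET = finset.set0).
    by rewrite cards0 scale1r.
  by apply/setP => i; rewrite !inE; case: eqP => [->|//]; rewrite ltnn.
by apply/setP => i; rewrite !inE andNb.
Qed.

Lemma koszul_diff_vacuum1 x j : koszul_diff A (vacuum x) [set j]%SET = A j x.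
Proof. by rewrite koszul_diff_set1 /vacuum eqxx. Qed.

Lemma koszul_diff_vacuum0 x (S : {set 'I_d}) : #|S| != 1%N -> koszul_diff A (vacuum x) S = 0.
Proof.
move=> S1; rewrite /koszul_diff big1 // => j jS; rewrite /vacuum.
case: eqP => [h|_]; last by rewrite linear0 scaler0.
by case/negP: S1; rewrite (cardsD1 j) jS h cards0.
Qed.

(** Exactness in degree 0: every boundary is an empty sum at the empty set. *)
Lemma koszul_exact0_inj : koszul_exact A -> forall x, (forall k, A k x = 0) -> x = 0.
Proof.
move=> hex x Ax; have [|hk _] := hex 0%N (vacuum x).
  by move=> S; rewrite cards_eq0 /vacuum => /negPf ->.
have [|g [g0 gx]] := hk.
  apply/funext => S; have [/eqP/cards1P[j ->]|] := eqVneq #|S| 1%N.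
    by rewrite koszul_diff_vacuum1 Ax.
  exact: koszul_diff_vacuum0.
have := congr1 (fun f => f finset.set0) gx.
by rewrite /koszul_diff finset.big_set0 /vacuum eqxx.
Qed.

(** A limit of boundaries is a cycle, hence a boundary by exactness in degree 1: the column of the
    [A k] has closed range. *)
Lemma koszul_exact1_closed (X : nat -> H) (f : 'I_d -> H) : koszul_exact A ->
  (forall k, tends (fun n => A k (X n)) (f k)) -> exists g, forall k, A k g = f k.
Proof.
move=> hex hf.
have ex S : exists l, tends (fun n => koszul_diff A (vacuum (X n)) S) l.
  have [/eqP/cards1P[j ->]|S1] := eqVneq #|S| 1%N.
    by exists (f j); apply: tends_eq (hf j) => n; rewrite koszul_diff_vacuum1.
  exists 0; apply: tends_eq (tends_const _) => n.
  by rewrite koszul_diff_vacuum0.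
have [F hF] := choice ex.
have F1 : koszul_chain 1 F.
  move=> S S1; apply: tends_unique (hF S) _.
  by apply: tends_eq (tends_const _) => n; rewrite koszul_diff_vacuum0.
have [hk _] := hex 1%N F F1.
have [|g [_ gF]] := hk.
  apply/funext => S.
  apply: (@tends_unique _ _ (fun n => koszul_diff A (koszul_diff A (vacuum (X n))) S)).
    rewrite [X in tends _ X]/koszul_diff -big_enum /=.
    apply: tends_eq (tends_sum _ (fun j => tendsZ _ (tends_bounded_op (bA j) (hF _)))).
    by move=> n; rewrite big_enum.
  by apply: tends_eq (tends_const _) => n; rewrite koszul_diffK.
exists (g finset.set0) => k.
rewrite -koszul_diff_set1 gF; apply: tends_unique (hF _) _.
by apply: tends_eq (hf k) => n; rewrite koszul_diff_vacuum1.
Qed.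

Definition gram v := \sum_(k < d) adjoint dot (A k) (A k v).

Lemma gram_dot u v : dot (gram v) u = \sum_(k < d) dot (A k v) (A k u).
Proof.
rewrite /gram dot_suml; apply: eq_bigr => k _.
by rewrite dotC -(adjoint_dotP hdot bA) -dotC.
Qed.

(** Pairing a vector orthogonal to the range of [gram] with its own image gives the sum of its
    [|A k x|^2], so the vector is zero. *)
Lemma gram_dense : (forall x, (forall k, A k x = 0) -> x = 0) ->
  forall u (e : R), 0 < e -> exists v, nrm (u - gram v) <= e.
Proof.
move=> inj u e e0.
have [||p [hp orth]] := orthogonal_projection hdot (M := range gram) u.
- exists 0 => //; rewrite /gram big1 // => k _.
  by rewrite !linear0.
- move=> a _ _ [y _ <-] [w _ <-]; exists (a *: y + w) => //.
  rewrite /gram scaler_sumr -big_split; apply: eq_bigr => k _ /=.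
  have -> : A k (a *: y + w) = a *: A k y + A k w by exact: linearP.
  exact: linearP.
have up : u - p = 0.
  apply: inj => k.
  have : complex.Re (dot (u - p) (gram (u - p))) = 0.
    by rewrite orth //; exists (u - p).
  rewrite dotC gram_dot ReC Re_sum.
  under eq_bigr => i _ do rewrite (Re_dotxx hdot).
  move=> /psumr_eq0P h; apply: nrm0_eq0; apply/eqP; rewrite -sqrf_eq0; apply/eqP.
  by apply: h => // i _; rewrite sqr_ge0.
have [_ [v _ <-] hv] := hp e e0; exists v.
by rewrite (le_trans _ hv) // -[u](subrK p) up add0r.
Qed.

(** Each hump is long but has tiny images under the [A k], so [X n] is unbounded while [A k (X n)]
    is Cauchy. From the first step on, [gram (v n)] tests the direction of [X n]; [eps n] is fixed
    after [v n], which makes all later humps negligible for this test. *)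
Lemma gliding_hump : (forall u (e : R), 0 < e -> exists v, nrm (u - gram v) <= e) ->
  (forall eta : R, 0 < eta -> exists x, x != 0 /\ forall k, nrm (A k x) <= eta * nrm x) ->
  exists (X v : nat -> H) (eps : nat -> R), forall n,
    [/\ 0 < eps n, eps n.+1 <= eps n / 2,
        forall k, nrm (A k (X n.+1 - X n)) <= eps n,
        n%:R <= nrm (X n) &
        nrm ((nrm (X n.+1))^-1%:C *: X n.+1 - gram (v n.+1)) <= 2^-1 /\
        eps n.+1 * \sum_(k < d) nrm (A k (v n.+1)) <= 4^-1 ].
Proof.
move=> dense small.
pose P (s : H * R * H) (s' : H * R * H) := [/\ 0 < s'.1.2, s'.1.2 <= s.1.2 / 2,
  forall k, nrm (A k (s'.1.1 - s.1.1)) <= s.1.2, nrm s.1.1 + 1 <= nrm s'.1.1 &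
  nrm ((nrm s'.1.1)^-1%:C *: s'.1.1 - gram s'.2) <= 2^-1 /\
  s'.1.2 * \sum_(k < d) nrm (A k s'.2) <= 4^-1].
have step s : exists s', 0 < s.1.2 -> P s s'.
  case: s => [[x e] v0]; have [e0|] := boolP (0 < e); last by exists (x, e, v0).
  (* A hump of this norm makes the new vector longer than [x] by at least 1. *)
  pose M := 2 * nrm x + 1.
  have M0 : 0 < M by rewrite ltr_wpDl // mulr_ge0 ?nrm_ge0.
  have [y [y0 hy]] := small (e / M) (divr_gt0 e0 M0).
  have ny : 0 < nrm y by rewrite nrm_gt0.
  pose y' := (M / nrm y)%:C *: y.
  have ny' : nrm y' = M.
    by rewrite nrmZ nrmr ger0_norm ?divfK ?gt_eqF // divr_ge0 ?ltW.
  pose x' := x + y'.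
  have [v hv] := dense ((nrm x')^-1%:C *: x') 2^-1 ltac:(lra).
  pose a := \sum_(k < d) nrm (A k v).
  have a0 : 0 <= a by apply: sumr_ge0 => k _; apply: nrm_ge0.
  pose e' := Num.min (e / 2) (4 * (a + 1))^-1.
  exists (x', e', v) => _; split => /=.
  - by rewrite lt_min divr_gt0 //= invr_gt0 mulr_gt0 // ltr_wpDl.
  - by rewrite ge_min lexx.
  - move=> k; rewrite /x' addrAC subrr add0r.
    have -> : A k y' = (M / nrm y)%:C *: A k y by exact: linearZ.
    rewrite nrmZ nrmr ger0_norm ?divr_ge0 ?(ltW M0) ?nrm_ge0 //.
    rewrite (le_trans (ler_wpM2l _ (hy k))) ?divr_ge0 ?(ltW M0) ?nrm_ge0 //.
    by rewrite le_eqVlt; apply/orP; left; apply/eqP; field; rewrite !gt_eqF.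
  - have := nrm_le_add y' (- x); rewrite nrmN opprK (addrC y') -/x' ny' /M; lra.
  - split => //; rewrite -/a.
    apply: (@le_trans _ _ ((4 * (a + 1))^-1 * a)).
      by rewrite ler_wpM2r // ge_min lexx orbT.
    have a1 : 0 < a + 1 by rewrite ltr_wpDl.
    rewrite invfM -mulrA ler_piMr ?invr_ge0 // mulrC ler_pdivrMr // mul1r.
    by rewrite lerDl.
have [F hF] := choice step.
pose st n := iter n F (0, 1, 0).
have st0 n : 0 < (st n).1.2.
  by elim: n => [|n IHn] //=; have [] := hF _ IHn.
have hst n : P (st n) (st n.+1) by apply: hF.
have hX n : n%:R <= nrm (st n).1.1.
  elim: n => [|n IHn]; first exact: nrm_ge0.
  by have [_ _ _ h _] := hst n; rewrite -natr1 (le_trans _ h) // lerD2r.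
exists (fun n => (st n).1.1), (fun n => (st n).2), (fun n => (st n).1.2) => n.
by have [h1 h2 h3 h4 h5] := hst n.
Qed.

(** By exactness the limits of the [A k (X n)] are of the form [A k g]. Testing with [gram w], which
    is within 1/2 of the unit vector along [x = X n.+1], gives at least [|x| / 2] at [x], at most
    [3/2 |g|] at [g] and at most [1/2] at [x - g]. This bounds the norms of the [X n]. *)
Lemma koszul_not_exact :
  (forall eta : R, 0 < eta -> exists x, x != 0 /\ forall k, nrm (A k x) <= eta * nrm x) ->
  ~ koszul_exact A.
Proof.
move=> small hex.
have [X [v [eps h]]] := gliding_hump (gram_dense (koszul_exact0_inj hex)) small.
have eps0 n : 0 < eps n by have [] := h n.
have step n j k : nrm (A k (X (n + j)%N - X n)) <= 2 * eps n - 2 * eps (n + j)%N.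
  elim: j => [|j IHj]; first by rewrite addn0 !subrr linear0 nrm0.
  have [_ h1 h2 _ _] := h (n + j)%N; have h3 := h2 k.
  have -> : X (n + j.+1)%N - X n = (X (n + j).+1 - X (n + j)%N) + (X (n + j)%N - X n).
    by rewrite addnS addrA subrK.
  have -> : A k ((X (n + j).+1 - X (n + j)%N) + (X (n + j)%N - X n)) =
     A k (X (n + j).+1 - X (n + j)%N) + A k (X (n + j)%N - X n) by exact: linearD.
  rewrite (le_trans (nrmD _ _)) // addnS; lra.
have near m n k : (n <= m)%N -> nrm (A k (X m) - A k (X n)) <= 2 * eps n.
  move=> nm; have -> : A k (X m) - A k (X n) = A k (X m - X n).
    by symmetry; exact: linearB.
  have := step n (m - n)%N k; rewrite subnKC //; have := eps0 m; lra.
have epsX n : eps n <= (1 / 2) ^+ n * eps 0%N.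
  elim: n => [|n IHn]; first by rewrite expr0 mul1r.
  by have [_ h1 _ _ _] := h n; rewrite exprS; move: IHn h1; lra.
have eps_small (e : R) : 0 < e -> exists N, forall n, (N <= n)%N -> 2 * eps n <= e.
  move=> e0.
  have e1 : 0 < e / (2 * eps 0%N) by rewrite divr_gt0 // mulr_gt0.
  have [N hN] := @exprn_small R (1 / 2) _ ltac:(lra) e1.
  exists N => n /hN; rewrite ler_pdivlMr ?mulr_gt0 //; have := epsX n; lra.
have lim k : exists l, tends (fun n => A k (X n)) l.
  apply: nrm_complete => e /eps_small[N hN]; exists N => m n.
  wlog mn : m n / (n <= m)%N.
    move=> hw; case: (leqP n m) => [/hw //|/ltnW nm] Nm Nn.
    by rewrite nrmBC; apply: hw.
  by move=> _ /hN; apply: le_trans; apply: near.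
have [f hf] := choice lim.
have [g hg] := koszul_exact1_closed hex hf.
have gX n k : nrm (A k g - A k (X n)) <= 2 * eps n.
  rewrite hg; apply: (@tends_nrm_le _ _ (fun m => A k (X m) - A k (X n))).
    by apply: tendsD (hf k) (tends_const _).
  by exists n => m nm; apply: near.
have bound n : nrm (X n.+1) <= 3 * nrm g + 1.
  have [_ _ _ _ [h1 h2]] := h n.
  set x := X n.+1 in h1 *; set w := v n.+1 in h1 h2.
  have x0 : 0 < nrm x.
    by have [_ _ _ hx _] := h n.+1; rewrite (lt_le_trans _ hx) // ltr0Sn.
  pose u := (nrm x)^-1%:C *: x.
  have nu : nrm u = 1.
    by rewrite nrmZ nrmr ger0_norm ?mulVf ?gt_eqF // invr_ge0 ltW.
  have ux : complex.Re (dot u x) = nrm x.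
    rewrite dotZl (dotxx hdot) -rmorphM /=; field; exact: lt0r_neq0.
  have Bx : nrm x / 2 <= complex.Re (dot (gram w) x).
    have := Re_dot_le hdot (u - gram w) x; rewrite dotBl raddfB /= ux.
    have := ler_wpM2r (ltW x0) h1; rewrite -/u; lra.
  have Bg : complex.Re (dot (gram w) g) <= 3 / 2 * nrm g.
    rewrite (le_trans (Re_dot_le hdot _ _)) // ler_wpM2r ?nrm_ge0 //.
    have := nrm_le_add (gram w) u; rewrite nrmBC nu; move: h1; rewrite -/u; lra.
  have Bgx : complex.Re (dot (gram w) (x - g)) <= 2^-1.
    rewrite gram_dot Re_sum.
    apply: (@le_trans _ _ (2 * (eps n.+1 * \sum_(k < d) nrm (A k w)))); last by lra.
    rewrite mulrA mulr_sumr ler_sum // => k _.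
    rewrite (le_trans (Re_dot_le hdot _ _)) // mulrC ler_wpM2r ?nrm_ge0 //.
    have -> : A k (x - g) = A k x - A k g by exact: linearB.
    by rewrite nrmBC gX.
  move: Bgx; rewrite dotBr raddfB /=; lra.
have [n hn] : exists n, 3 * nrm g + 1 < n%:R.
  by exists (Num.truncn (3 * nrm g + 1)).+1; exact: truncnS_gt.
have [_ _ _ h1 _] := h n.+1; have := bound n.
by move: h1 hn; rewrite -natr1; lra.
Qed.

End KoszulApproximateKernel.

(** * Admissibility of the numbers above the spectral radius *)

Section SpectralRadius.
Context (R : realType) (H : completeNormedModType R[i]).
Context (dot : {dot H for Num.conj}) (hdot : hilbert_dot dot).

Lemma growth_leW d (T : 'I_d -> {linear H -> H}) (s t : R) : 0 <= s <= t ->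
  growth_le T s -> growth_le T t.
Proof.
move=> /andP[s0 st] [K hK]; exists `|K| => n x; rewrite (le_trans (hK n x)) //.
apply: (ler_wpM2r (sqr_ge0 _)).
apply: (@le_trans _ _ (`|K| * s ^+ n)).
  exact: ler_wpM2r (exprn_ge0 n s0) _ _ (ler_norm K).
by rewrite ler_wpM2l // lerXn2r ?nnegrE // (le_trans s0).
Qed.

Lemma joint_spectral_radius_ge0 d (T : 'I_d -> {linear H -> H}) :
  0 <= joint_spectral_radius T.
Proof. by apply: sup_nneg => _ [lam _ <-]; exact: sqrtr_ge0. Qed.

(** Every number above the infimum [rho] of the admissible ones is admissible. If [rho > 0], joint
    approximate eigenvectors provide a point of norm [rho] in the Taylor spectrum, so [rho] is at
    most the spectral radius. *)
Lemma growth_le_joint_spectral_radius d (T : 'I_d.+1 -> {linear H -> H}) (t : R) :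
  (forall k, bounded_op (T k)) -> commuting_tuple T ->
  joint_spectral_radius T < t -> growth_le T (t ^+ 2).
Proof.
move=> bT cT.
pose U := [set s : R | 0 < s /\ growth_le T (s ^+ 2)].
have s0 : U (joint_norm T + 1).
  have n0 := joint_norm_ge0 T.
  split; first by rewrite ltr_wpDl.
  apply: (@growth_leW _ _ (joint_norm T ^+ 2)).
    by rewrite sqr_ge0 lerXn2r ?nnegrE ?addr_ge0 // lerDl.
  by exists 1 => n x; rewrite mul1r; exact: growth_joint_norm.
have lbU : lbound U 0 by move=> s [/ltW].
have hU : has_inf U by split; [exists (joint_norm T + 1) | exists 0].
pose rho := inf U.
have rho0 : 0 <= rho by apply: lb_le_inf => //; case: hU.
have above s : rho < s -> growth_le T (s ^+ 2).
  move=> /(inf_lt hU.1)[q [q0 hq] qs]; apply: growth_leW hq.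
  by rewrite sqr_ge0 lerXn2r ?nnegrE ?(ltW q0) ?(ltW qs) // ltW // (lt_trans q0).
have below s : 0 < s < rho -> ~ growth_le T (s ^+ 2).
  move=> /andP[q0 sr] hs; move: sr; rewrite ltNge => /negP; apply.
  by apply: ge_inf; [case: hU | split].
suff rr : rho <= joint_spectral_radius T by move=> rt; apply/above/(le_lt_trans rr).
have [r0|rn] := eqVneq rho 0; first by rewrite r0 joint_spectral_radius_ge0.
have {rn} {}rho0 : 0 < rho by rewrite lt_def rn.
have [c [z [c1 zr hx]]] := exists_approximate_eigenvalue hdot bT cT rho0 above below.
pose lam k := z * (c k)^*.
have lam_rho : l2norm lam = rho.
  rewrite /l2norm /lam; under eq_bigr => k _ do rewrite -/(nrm _) nrmM nrm_conj zr exprMn.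
  by rewrite -mulr_sumr c1 mulr1 sqrtr_sqr gtr0_norm.
have hlam : taylor_spectrum T lam.
  apply: (koszul_not_exact hdot (A := shift T lam)).
  - exact: bounded_shift.
  - exact: shift_comm.
  - move=> eta eta0.
    exact: (joint_approximate_eigenvector hdot bT cT c1 rho0 above zr hx eta0).
rewrite -lam_rho; apply: ub_le_sup; last by exists lam.
(* An admissible number bounds the spectrum, so that [sup] is a true supremum. *)
exists (joint_norm T + 1) => _ [mu hmu <-].
by case: s0 => q0 hq; apply: taylor_spectrum_le hmu.
Qed.

End SpectralRadius.

Unset Implicit Arguments.
Set Strict Implicit.
Set Printing Implicit Defensive.

Theorem theorem4p1 (R : realType) (H : completeNormedModType R[i])
    (dot : {dot H for Num.conj}) (hdot : hilbert_dot dot)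
    (d : nat) (hd : (1 <= d)%N) (T : 'I_d -> {linear H -> H})
    (hT : bounded_tuple T) (hcomm : commuting_tuple T) :
  joint_norm (iter n (spherical_aluthge dot) T) @[n --> \oo]
    --> joint_spectral_radius T.
Proof.
case: d hd T hT hcomm => [//|d] _ T hT cT.
have bT k : bounded_op (T k) by apply/bounded_opP; exact: hT.
apply: (joint_norm_iter_aluthge_cvg hdot bT) => [|t|t].
- exact: joint_spectral_radius_ge0.
- exact: growth_le_joint_spectral_radius.
- exact: joint_spectral_radius_le.
Qed.
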